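(* Let $n\ge1$. The map $$\mathbf{P}_*(\mathcal{X}_{A_n})\longrightarrow\mathrm{St}(\mathcal{A}_{A_n}),\qquad f\longmapsto S_f,$$ sending $f$ to its support, is a bijection. Furthermore, for $f_1,f_2\in\mathbf{P}_*(\mathcal{X}_{A_n})$, $f_1\le f_2$ if and only if $S_{f_1}\subseteq S_{f_2}$.
   Context: Polygon. Fix an $(n+3)$-gon with vertices labeled $1,\dots,n+3$ clockwise; vertex indices are read modulo $n+3$. A segment $\{ij\}$ joins two distinct vertices; it is an edge if they are adjacent and a diagonal otherwise. A partial triangulation $T$ is a (possibly empty) set of pairwise non-crossing diagonals; it is complete if maximal. $\widetilde T$ is $T$ together with all edges. ''$i,j,k,l$ seated clockwise'' means four distinct vertices occurring in this cyclic clockwise order. Positive spaces. On a positive space $\mathcal{Y}$ (variety with an atlas of coordinate systems with subtraction-free transition maps), $\mathbb{L}_+(\mathcal{Y})$ is the set of functions that are Laurent polynomials with non-negative integer coefficients in every coordinate system; $F_1\ge F_2$ means $F_1-F_2\in\mathbb{L}_+(\mathcal{Y})$ (zero included). $\mathbf{E}(\mathcal{Y})$ is the set of nonzero elements of $\mathbb{L}_+(\mathcal{Y})$ that are not a sum of two nonzero elements of $\mathbb{L}_+(\mathcal{Y})$; $\mathbf{P}(\mathcal{Y})$ is the set of finite products of elements of $\mathbf{E}(\mathcal{Y})$. Tropical points. For $\mathbb{A}\in\{\mathbb{Z},\mathbb{R}\}$, a point $x\in\mathcal{A}_{A_n}(\mathbb{A}^t)$ is a collection of numbers $A_{ij}^t(x)\in\mathbb{A}$,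 one for each segment, with $A_{ij}^t(x)=0$ for edges and $A_{ik}^t(x)+A_{jl}^t(x)=\max\{A_{ij}^t(x)+A_{kl}^t(x),A_{il}^t(x)+A_{jk}^t(x)\}$ for $i,j,k,l$ seated clockwise. Stasheff polytopes. Let $c=\{c_{ij}\}$ be real numbers indexed by the diagonals. For a partial triangulation $T$, let $S(T)$ be the set of diagonals not in $T$ crossing no element of $T$, and $\mathcal{F}_c^T=\{x\in\mathcal{A}_{A_n}(\mathbb{R}^t) : A_{ij}^t(x)=c_{ij}\ \forall\{ij\}\in T,\ A_{ij}^t(x)\le c_{ij}\ \forall\{ij\}\in S(T)\}$. $\mathcal{F}_c^\emptyset$ is a Stasheff polytope if $T_1\subseteq T_2$ implies $\mathcal{F}_c^{T_2}\subseteq\mathcal{F}_c^{T_1}$ for all partial triangulations $T_1,T_2$; it is regular if all $c_{ij}$ are integers. $\mathrm{St}(\mathcal{A}_{A_n})$ is the set of regular Stasheff polytopes in $\mathcal{A}_{A_n}(\mathbb{Z}^t)$, i.e. of subsets $\mathcal{F}_c^\emptyset\cap\mathcal{A}_{A_n}(\mathbb{Z}^t)$ with $\mathcal{F}_c^\emptyset$ a regular Stasheff polytope. The spaces $\widetilde{\mathcal{A}}_{A_n}$, $\mathcal{X}_{A_n}$. $\widetilde{\mathcal{A}}_{A_n}$ is the positive space with coordinate systems $\{A_{ij}:\{ij\}\in\widetilde T\}$ ($T$ complete triangulation), glued via the Plücker relations $A_{ik}A_{jl}=A_{ij}A_{kl}+A_{il}A_{jk}$ ($i,j,k,l$ seated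 clockwise). $\mathcal{X}_{A_n}$ is the cluster $\mathcal{X}$-variety of type $A_n$: it has one coordinate system $\{X_E^T:E\in T\}$ for each complete triangulation $T$, and a surjective map $k:\widetilde{\mathcal{A}}_{A_n}\to\mathcal{X}_{A_n}$ with $k^*X^T_{\{pr\}}=\dfrac{A_{pq}A_{rs}}{A_{qr}A_{ps}}$, where $p,q,r,s$ (seated clockwise) are the vertices of the quadrilateral formed by the two triangles of $T$ adjacent to $\{pr\}$. The transition maps of $\mathcal{X}_{A_n}$ are those induced through the injection $k^*$, so the field of rational functions $\mathbb{Q}(\mathcal{X}_{A_n})$ is identified with the subfield of $\mathbb{Q}(\widetilde{\mathcal{A}}_{A_n})$ generated by these cross-ratios. $$\mathbf{P}_*(\mathcal{X}_{A_n}):=\{f\in\mathbb{L}_+(\mathcal{X}_{A_n}) : k^*(f)\in\mathbf{P}(\widetilde{\mathcal{A}}_{A_n})\}.$$ Canonical basis and supports. For $l\in\mathcal{A}_{A_n}(\mathbb{Z}^t)$ put $a_{pq}=A_{pq}^t(l)$, $a_{pp}=0$, $w_{pq}=a_{q-1,p-1}+a_{pq}-a_{p,q-1}-a_{p-1,q}$ for $p\ne q$ (indices mod $n+3$). $\mathbb{I}_{\mathcal{A}}(l)$ is the unique element of $\mathbb{Q}(\mathcal{X}_{A_n})$ with $k^*\mathbb{I}_{\mathcal{A}}(l)=\prod_{1\le p<q\le n+3}A_{pq}^{w_{pq}}$. The map $\mathbb{I}_{\mathcal{A}}$ is a bijection from $\mathcal{A}_{A_n}(\mathbb{Z}^t)$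 onto $\mathbf{E}(\mathcal{X}_{A_n})$, which is a $\mathbb{Z}$-basis of the coordinate ring of $\mathcal{X}_{A_n}$ (known facts). Each $f\in\mathbb{L}_+(\mathcal{X}_{A_n})$ is uniquely a finite sum $f=\sum_l c(f;l)\,\mathbb{I}_{\mathcal{A}}(l)$, and its support is $S_f=\{l\in\mathcal{A}_{A_n}(\mathbb{Z}^t) : c(f;l)\ne0\}$. *)

(* Defs.v *)
From HB Require Import structures.
From mathcomp Require Import all_boot all_order all_algebra mpoly.
From mathcomp Require Import boolp classical_sets functions cardinality fsbigop reals.

Set Implicit Arguments.
Unset Strict Implicit.
Unset Printing Implicit Defensive.

Import Order.TTheory GRing.Theory Num.Theory.
Local Open Scope ring_scope.

(* The vertices of the (n+3)-gon are 'I_n.+3, in clockwise order; the vertex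
   called n+3 in the 1-based labelling is 0 here.  Everything below only
   depends on the cyclic order of the vertices. *)

Definition seg n (i j : 'I_n.+3) : {set 'I_n.+3} := [set i; j]%SET.

Definition edge n (e : {set 'I_n.+3}) : bool :=
  [exists i : 'I_n.+3, e == seg i (ordS i)].

Definition diagonal n (e : {set 'I_n.+3}) : bool := (#|e| == 2) && ~~ edge e.

Definition clockwise n (i j k l : 'I_n.+3) : bool :=
  [|| [&& i < j, j < k & k < l], [&& j < k, k < l & l < i],
      [&& k < l, l < i & i < j] | [&& l < i, i < j & j < k]]%N.

Definition crossing n (e f : {set 'I_n.+3}) : bool :=
  [exists i, exists j, exists k, exists l,
    [&& clockwise i j k l, e == seg i k & f == seg j l]].

Definition partial_triangulation n (T : {set {set 'I_n.+3}}) : bool :=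
  [forall e in T, diagonal e]
  && [forall e in T, forall f in T, ~~ crossing e f].

Definition complete_triangulation n (T : {set {set 'I_n.+3}}) : bool :=
  maxset (@partial_triangulation n) T.

Definition with_edges n (T : {set {set 'I_n.+3}}) : {set {set 'I_n.+3}} :=
  (T :|: [set e | edge e])%SET.

(* An atlas on a space, seen through an ambient field [K] containing its field
   of rational functions: the chart [T] is the family
   [coord T i], [i \in chart_dom T]. *)
Record atlas (K : fieldType) := Atlas {
  chart : Type;
  chart_index : finType;
  chart_dom : chart -> {set chart_index};
  coord : chart -> chart_index -> K }.

(* A list entry [(c, m)] is the term with coefficient [c] and exponents [m]. *)
Definition nonneg_laurent (K : fieldType) (I : finType) (D : {set I})
    (x : I -> K) (f : K) : Prop :=
  exists s : seq (nat * {ffun I -> int}),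
    f = \sum_(t <- s) t.1%:R * \prod_(i in D) x i ^ t.2 i.

Definition Lplus (K : fieldType) (Y : atlas K) : set K :=
  fun f => forall T : chart Y, nonneg_laurent (chart_dom T) (coord T) f.

Definition Lle (K : fieldType) (Y : atlas K) (f g : K) : Prop := Lplus Y (g - f).

Definition Eset (K : fieldType) (Y : atlas K) : set K :=
  fun f => [/\ Lplus Y f, f != 0 &
    ~ exists g h, [/\ Lplus Y g, Lplus Y h, g != 0, h != 0 & f = g + h]].

Definition Pset (K : fieldType) (Y : atlas K) : set K :=
  fun f => exists s : seq K, (forall g, g \in s -> Eset Y g) /\ f = \prod_(g <- s) g.

(* The [x i], [i \in D], are algebraically independent and generate [K] as a
   field over the rationals (integer polynomials suffice; the independence
   forces characteristic zero). *)
Definition coordinate_system (K : fieldType) (I : finType) (D : {set I})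
    (x : I -> K) : Prop :=
  let ev (p : {mpoly int[#|D|]}) : K :=
    mmap intr (fun i => x (enum_val i)) p in
  (forall p, ev p = 0 -> p = 0)
  /\ (forall f : K, exists p q, ev q != 0 /\ f = ev p / ev q).

(* [K] is the field of rational functions of the space A-tilde of type A_n and
   [A (seg i j)] is the function A_ij; the values of [A] outside segments are
   irrelevant. *)
Definition Atilde_functions n (K : fieldType) (A : {set 'I_n.+3} -> K) : Prop :=
  (forall i j k l, clockwise i j k l ->
     A (seg i k) * A (seg j l)
     = A (seg i j) * A (seg k l) + A (seg i l) * A (seg j k))
  /\ (forall T, complete_triangulation T -> coordinate_system (with_edges T) A).

Definition Atilde n (K : fieldType) (A : {set 'I_n.+3} -> K) : atlas K :=
  @Atlas K {T : {set {set 'I_n.+3}} | complete_triangulation T} {set 'I_n.+3}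
    (fun T => with_edges (val T)) (fun _ => A).

(* The two triangles of [T] adjacent to the diagonal [e = {pr}] are
   [pqr] and [prs]. *)
Definition quad n (T : {set {set 'I_n.+3}}) (e : {set 'I_n.+3})
    (p q r s : 'I_n.+3) : bool :=
  [&& clockwise p q r s, e == seg p r,
      seg p q \in with_edges T, seg q r \in with_edges T,
      seg r s \in with_edges T & seg p s \in with_edges T].

(* The quadrilateral is unique up to the half-turn (p,q,r,s) -> (r,s,p,q), which
   does not change the cross-ratio; the value 0 is only used for [e \notin T]. *)
Definition Xcoord n (K : fieldType) (A : {set 'I_n.+3} -> K)
    (T : {set {set 'I_n.+3}}) (e : {set 'I_n.+3}) : K :=
  if [pick v : 'I_n.+3 * 'I_n.+3 * ('I_n.+3 * 'I_n.+3)
        | quad T e v.1.1 v.1.2 v.2.1 v.2.2] is Some ((p, q), (r, s))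
  then (A (seg p q) * A (seg r s)) / (A (seg q r) * A (seg p s))
  else 0.

(* Rational functions on the cluster X-variety are identified with their
   pullbacks by the injection k^*, so its coordinates live in [K] as well. *)
Definition Xspace n (K : fieldType) (A : {set 'I_n.+3} -> K) : atlas K :=
  @Atlas K {T : {set {set 'I_n.+3}} | complete_triangulation T} {set 'I_n.+3}
    (fun T => val T) (fun T => Xcoord A (val T)).

Definition Pstar n (K : fieldType) (A : {set 'I_n.+3} -> K) : set K :=
  fun f => Lplus (Xspace A) f /\ Pset (Atilde A) f.

(* The number A^t_ij of a tropical point [x] is [x (seg i j)].  The value on a
   set that is not a segment is normalised to 0, so that equality of tropical
   points is equality of functions and, as [seg p p] is a singleton, a_pp = 0. *)
Definition tropical n (D : realDomainType) : set {ffun {set 'I_n.+3} -> D} :=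
  fun x => (forall e, ~~ diagonal e -> x e = 0)
    /\ (forall i j k l, clockwise i j k l ->
          x (seg i k) + x (seg j l)
          = Num.max (x (seg i j) + x (seg k l)) (x (seg i l) + x (seg j k))).

Definition realify n (R : realDomainType) (l : {ffun {set 'I_n.+3} -> int}) :
    {ffun {set 'I_n.+3} -> R} :=
  [ffun e => (l e)%:~R].

Definition compatible n (T : {set {set 'I_n.+3}}) : {set {set 'I_n.+3}} :=
  [set e | [&& diagonal e, e \notin T & [forall f in T, ~~ crossing e f]]]%SET.

(* Only the values of [c] on diagonals matter. *)
Definition face n (R : realType) (c : {set 'I_n.+3} -> R)
    (T : {set {set 'I_n.+3}}) : set {ffun {set 'I_n.+3} -> R} :=
  fun x => [/\ tropical x, (forall e, e \in T -> x e = c e)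
             & (forall e, e \in compatible T -> x e <= c e)].

Definition stasheff n (R : realType) (c : {set 'I_n.+3} -> R) : Prop :=
  forall T1 T2 : {set {set 'I_n.+3}},
    partial_triangulation T1 -> partial_triangulation T2 ->
    T1 \subset T2 -> (face c T2 `<=` face c T1)%classic.

Definition regular_data n (R : realType) (c : {set 'I_n.+3} -> R) : Prop :=
  forall e, diagonal e -> exists m : int, c e = m%:~R.

Definition St n (R : realType) : set (set {ffun {set 'I_n.+3} -> int}) :=
  fun S => exists c : {set 'I_n.+3} -> R,
    [/\ stasheff c, regular_data c
      & S = (fun l => tropical l /\ face c finset.set0 (realify R l))].

Definition wexp n (l : {ffun {set 'I_n.+3} -> int}) (p q : 'I_n.+3) : int :=
  l (seg (ord_pred q) (ord_pred p)) + l (seg p q)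
  - l (seg p (ord_pred q)) - l (seg (ord_pred p) q).

(* The product lies in the subfield of rational functions on the X-variety. *)
Definition I_A n (K : fieldType) (A : {set 'I_n.+3} -> K)
    (l : {ffun {set 'I_n.+3} -> int}) : K :=
  \prod_(p < n.+3) \prod_(q < n.+3 | (p < q)%N) A (seg p q) ^ wexp l p q.

Definition expansion n (K : fieldType) (A : {set 'I_n.+3} -> K) (f : K)
    (c : {ffun {set 'I_n.+3} -> int} -> int) : Prop :=
  let S : set {ffun {set 'I_n.+3} -> int} := fun l => c l != 0 in
  [/\ finite_set S, (S `<=` @tropical n int)%classic
    & f = \sum_(l \in S) (c l)%:~R * I_A A l].

(* c(f;l): the expansion is unique when it exists, and exists for every [f] in
   [Lplus (Xspace A)]. *)
Definition coef n (K : fieldType) (A : {set 'I_n.+3} -> K) (f : K) :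
    {ffun {set 'I_n.+3} -> int} -> int :=
  xget (fun _ => 0) (expansion A f).

Definition supp_set n (K : fieldType) (A : {set 'I_n.+3} -> K) (f : K) :
    set {ffun {set 'I_n.+3} -> int} :=
  fun l => tropical l /\ coef A f l != 0.

(* Main.v *)
Require Import Defs.
From mathcomp Require Import all_boot all_order all_algebra mpoly zify ring.
From mathcomp Require Import boolp classical_sets functions cardinality fsbigop reals.
(* [diagonal] is to mean the diagonals of the polygon. *)
Import Defs.

Set Implicit Arguments.
Unset Strict Implicit.
Unset Printing Implicit Defensive.

Import Order.TTheory GRing.Theory Num.Theory.
Local Open Scope ring_scope.

(** Write a monomial in the functions [A (seg p q)] as the exponent vector [m],
indexed by segments; the diagonals may have any exponents at least 0, the edges
any integral exponents.  The cut [cut a b m] counts, with exponents, the segments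
crossed by the chord from the middle of the edge after [a] to the middle of the edge
after [b].  Cuts and exponents determine each other: up to a factor 2, the exponents
are the mixed second differences of the cuts ([cut_cell]).
For a monomial of degree 0 at all vertices, half the cuts form a collection
[c_ab] indexed by the diagonals; it satisfies the inequalities of a Stasheff
polytope because the diagonals have exponents at least 0 ([pos_stasheff]), and
conversely ([stasheff_wvec_pos]); it is a tropical point exactly when no two
diagonals in the monomial cross ([tropical_lam], [lam_tropical]).  So, once P_*
is known to consist of the monomials of degree 0 ([PstarP]), both sides of the
bijection are parametrized by the same collections [c].

The Pluecker relation [A_ik A_jl = A_ij A_kl + A_il A_jk] replaces a monomial by
two others with smaller cuts, and in the end by cluster monomials, that is, the
monomials without crossings ([resolve]).  The combinatorial heart is [dom_step]:
if all cuts of [m1] are at most those of [m2] and the degrees agree, then some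
crossing of [m2] has a resolution that still dominates [m1].  It has three
consequences.
- Two cluster monomials are never comparable ([lam_anti]).  Since all terms of a
  Laurent expansion lie below the monomial expanded, a cluster monomial of a
  chart [T] occurs in the expansion in [T] of no other cluster monomial.  So the
  multiplicity of a cluster monomial is a coefficient in a chart ([lam_coef]).
- The multiplicities grow with the cuts ([count_mono]).
- A cluster monomial occurs in [m] exactly if its cuts are at most those of [m]
  ([in_resolution]): the support is the Stasheff polytope.
As each cut of [m] is attained on its support, inclusion of supports, domination
of cuts, and the order on P_* are equivalent ([supp_set_subset], [Lle_dom]).

To identify P_* one has to show that the extremal elements of the A-tilde space
are the cluster monomials ([Eset_lam]).  A function that is a Laurent polynomial
in all charts is a combination of cluster monomials ([lam_span]): subtract the
cluster monomials with the coefficients found in the charts, and look at a term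
of largest total cut in all charts of the remainder; a negative exponent on a
diagonal would produce, by flipping it, a term of still larger total cut
([flip_tot]).  That the coefficient does not depend on the chart follows from the
connectedness of the flip graph ([flip_connected]). *)

(** * Segments and arcs of the polygon *)

Section Cyclic.
Variable n : nat.
Implicit Types (i j k l a b p q r s : 'I_n.+3) (e f : {set 'I_n.+3}).

Lemma ord_eqE i j : (i == j) = (nat_of_ord i == nat_of_ord j).
Proof. by rewrite -(inj_eq val_inj). Qed.

Lemma seg_sym i j : seg i j = seg j i.
Proof. by rewrite /seg finset.setUC. Qed.

Lemma ordS_val i : ordS i = (if i == n.+2 :> nat then 0 else i.+1)%N :> nat.
Proof.
rewrite /=; case: eqP => [->|h]; first by rewrite modnn.
by rewrite modn_small //; have := ltn_ord i; lia.
Qed.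

Lemma eq_ordS i j : (j == ordS i) =
  (j == i.+1 :> nat) || (i == n.+2 :> nat) && (j == 0 :> nat).
Proof.
rewrite ord_eqE ordS_val.
by have := ltn_ord i; have := ltn_ord j; case: ifP => /eqP h; lia.
Qed.

Lemma ord_pred_val i : ord_pred i = (if i == 0 :> nat then n.+2 else i.-1)%N :> nat.
Proof.
rewrite /=; case: eqP => [->|h]; first by rewrite add0n modn_small.
have -> : (i + n.+3).-1 = (i.-1 + n.+3)%N by lia.
by rewrite modnDr modn_small //; have := ltn_ord i; lia.
Qed.

Lemma seg_eq i j k l :
  (seg i j == seg k l) = ((i == k) && (j == l)) || ((i == l) && (j == k)).
Proof.
apply/eqP/idP => [/setP h|/orP[] /andP[/eqP-> /eqP->] //]; last exact: seg_sym.
move: (h i) (h j) (h k) (h l); rewrite !inE !eqxx ?orbT /= -!val_eqE /=.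
lia.
Qed.

Lemma card_seg i j : (#|seg i j| == 2)%N = (i != j).
Proof. by rewrite cards2; case: (i != j). Qed.

Lemma segP e : #|e| == 2%N -> exists i j, [/\ (i < j)%N, i != j & e = seg i j].
Proof.
case/cards2P => x [y [nxy ->]].
have := nxy; rewrite neq_ltn => /orP[] lt.
  by exists x, y; split.
by exists y, x; split; rewrite 1?eq_sym // -/(seg x y) seg_sym.
Qed.

Lemma edge_seg i j : edge (seg i j) = (j == ordS i) || (i == ordS j).
Proof.
apply/existsP/idP => [[k]|].
  by rewrite seg_eq => /orP[] /andP[/eqP-> /eqP->]; rewrite eqxx ?orbT.
case/orP => /eqP->; first by exists i.
by exists j; rewrite seg_sym.
Qed.

Lemma edge_card e : edge e -> #|e| == 2%N.
Proof.
case/existsP => i /eqP ->; rewrite card_seg; apply/eqP.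
move/(congr1 (@nat_of_ord _)); rewrite ordS_val; case: ifP => [/eqP|_]; lia.
Qed.

Lemma diag_seg i j : diagonal (seg i j) =
  ((i.+1 < j) && ~~ ((i == 0 :> nat) && (j == n.+2 :> nat))
   || (j.+1 < i) && ~~ ((j == 0 :> nat) && (i == n.+2 :> nat)))%N.
Proof.
rewrite /diagonal card_seg edge_seg !eq_ordS ord_eqE.
have := ltn_ord i; have := ltn_ord j; lia.
Qed.

Lemma crossing_seg a b c d :
  crossing (seg a b) (seg c d) = clockwise a c b d || clockwise a d b c.
Proof.
apply/existsP/idP => [[i /existsP[j /existsP[k /existsP[l]]]]|].
  rewrite !seg_eq => /and3P[cw].
  by case/orP=> /andP[/eqP-> /eqP->] /orP[] /andP[/eqP-> /eqP->];
     move: cw; rewrite /clockwise; lia.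
case/orP => h.
  by exists a; apply/existsP; exists c; apply/existsP; exists b;
     apply/existsP; exists d; rewrite h !eqxx.
by exists a; apply/existsP; exists d; apply/existsP; exists b;
   apply/existsP; exists c; rewrite h eqxx seg_sym eqxx.
Qed.

Lemma crossing_sym e f : crossing e f = crossing f e.
Proof.
suff h : forall e f, crossing e f -> crossing f e.
  by apply/idP/idP; apply: h.
move=> {}e {}f /existsP[i /existsP[j /existsP[k /existsP[l]]]] /and3P[cw /eqP-> /eqP->].
by rewrite crossing_seg; move: cw; rewrite /clockwise; lia.
Qed.

Lemma clockwise_rot i j k l : clockwise i j k l = clockwise j k l i.
Proof. by rewrite /clockwise; lia. Qed.

(** The arc (a, b], clockwise; it is the side of the chord from the middle of the
edge after [a] to the middle of the edge after [b].  For [a = b] it is the whole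
polygon, which separates nothing. *)
Definition inarc a b p : bool :=
  ((a < b) && (a < p <= b) || (b <= a) && ((a < p) || (p <= b)))%N.

Lemma clockwise_inarc i j k l a b : clockwise i j k l ->
  inarc a b i = inarc a b k -> inarc a b j = inarc a b l ->
  inarc a b i = inarc a b j.
Proof. by rewrite /clockwise /inarc; lia. Qed.

Lemma clockwise_neq i j k l : clockwise i j k l ->
  [/\ i != j, i != k, i != l & [/\ j != k, j != l & k != l]].
Proof.
rewrite !ord_eqE => cw.
by split; [..|split]; move: cw; rewrite /clockwise; lia.
Qed.

Lemma inarc_edge a x : inarc a (ordS a) x = (x == ordS a).
Proof.
rewrite eq_ordS /inarc ordS_val.
by have := ltn_ord a; have := ltn_ord x; case: ifP => /eqP; lia.
Qed.

Lemma inarc_sym a b x : a != b -> inarc b a x = ~~ inarc a b x.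
Proof. by rewrite -(inj_eq val_inj) /inarc /=; lia. Qed.

Lemma inarc_id a x : inarc a a x.
Proof. by rewrite /inarc; lia. Qed.

End Cyclic.

(** * Cuts of exponent vectors *)

Section Cut.
Variable n : nat.
Notation V := 'I_n.+3.
Notation exps := {ffun {set V} -> int}.
Implicit Types (i j k l a b p q r s x y : V) (e f : {set V}) (m : exps).

Definition delta e : exps := [ffun f => (f == e)%:Z].

Lemma deltaE e f : delta e f = (f == e)%:Z. Proof. by rewrite ffunE. Qed.

Lemma expsD m1 m2 e : (m1 + m2) e = m1 e + m2 e. Proof. by rewrite ffunE. Qed.

Lemma expsN m e : (- m) e = - m e. Proof. by rewrite ffunE. Qed.

Lemma exps_mulz m (c : int) e : (m *~ c) e = m e * c.
Proof.
by rewrite -mulrzz; case: c => c; rewrite ?NegzE ?mulrNz -?pmulrn ?ffunE ffunMnE.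
Qed.

Definition expsE := (deltaE, expsD, expsN, exps_mulz).

Definition Cut (J : pred V) m : int :=
  \sum_(p | J p) \sum_(q | ~~ J q) m (seg p q).

Definition cut a b m : int := Cut (inarc a b) m.

Lemma CutE J m : Cut J m = \sum_p \sum_q (J p && ~~ J q)%:Z * m (seg p q).
Proof.
rewrite /Cut big_mkcond; apply: eq_bigr => p _.
case: (J p); last by rewrite big1 // => q _; rewrite mul0r.
rewrite big_mkcond; apply: eq_bigr => q _ /=.
by case: (J q); rewrite ?mul0r ?mul1r.
Qed.

(** As exponents are indexed by unordered pairs, a weight on ordered pairs only
matters through its symmetrization. *)
Lemma pair_sum_sym m (F G : V -> V -> int) :
  (forall p q, F p q + F q p = G p q + G q p) ->
  \sum_p \sum_q F p q * m (seg p q) = \sum_p \sum_q G p q * m (seg p q).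
Proof.
move=> FG.
have h H : 2 * (\sum_p \sum_q H p q * m (seg p q))
         = \sum_p \sum_q (H p q + H q p) * m (seg p q).
  rewrite -[2]/(1 + 1) mulrDl mul1r {2}exchange_big /= -big_split /=.
  apply: eq_bigr => p _; rewrite -big_split /=; apply: eq_bigr => q _.
  by rewrite [seg q p]seg_sym mulrDl.
apply: (@mulfI _ 2) => //; rewrite !h.
by apply: eq_bigr => p _; apply: eq_bigr => q _; rewrite FG.
Qed.

Lemma Cut_eq J J' m : J =1 J' -> Cut J m = Cut J' m.
Proof.
by move=> h; rewrite !CutE; apply: eq_bigr => p _; apply: eq_bigr => q _; rewrite !h.
Qed.

Lemma Cut_compl J J' m : (forall x, J x = ~~ J' x) -> Cut J m = Cut J' m.
Proof.
move=> h; rewrite !CutE; apply: pair_sum_sym => p q; rewrite !h.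
by case: (J' p); case: (J' q).
Qed.

Lemma cut_sym a b m : cut a b m = cut b a m.
Proof.
have [->//|nab] := eqVneq a b.
by apply: Cut_compl => x; rewrite inarc_sym // eq_sym.
Qed.

Lemma cut_id a m : cut a a m = 0.
Proof.
rewrite /cut CutE big1 // => p _; rewrite big1 // => q _.
by rewrite !inarc_id mul0r.
Qed.

(** The defect in the submodularity of cuts: a pair of vertices is separated by as
many positive as negative terms, except for the pairs joining [R1] to [R3], which are
separated by both positive terms and by no negative one. *)
Lemma Cut_defect (R1 R2 R3 : pred V) m :
  (forall x, ~~ (R1 x && R2 x)) -> (forall x, ~~ (R1 x && R3 x)) ->
  (forall x, ~~ (R2 x && R3 x)) ->
  Cut (fun x => R1 x || R2 x) m + Cut (fun x => R2 x || R3 x) m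
  - Cut (fun x => [|| R1 x, R2 x | R3 x]) m - Cut R2 m
  = 2 * \sum_(p | R1 p) \sum_(q | R3 q) m (seg p q).
Proof.
move=> h12 h13 h23.
have -> : \sum_(p | R1 p) \sum_(q | R3 q) m (seg p q)
        = \sum_p \sum_q (R1 p && R3 q)%:Z * m (seg p q).
  rewrite big_mkcond; apply: eq_bigr => p _.
  case: (R1 p); last by rewrite big1 // => q _; rewrite mul0r.
  rewrite big_mkcond; apply: eq_bigr => q _ /=.
  by case: (R3 q); rewrite ?mul0r ?mul1r.
rewrite !CutE mulr_sumr -!sumrN -!big_split /=.
rewrite (eq_bigr (fun p => \sum_q
  (((R1 p || R2 p) && ~~ (R1 q || R2 q))%:Z
  + ((R2 p || R3 p) && ~~ (R2 q || R3 q))%:Z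
  - ([|| R1 p, R2 p | R3 p] && ~~ [|| R1 q, R2 q | R3 q])%:Z
  - (R2 p && ~~ R2 q)%:Z) * m (seg p q))); last first.
  move=> p _; rewrite -!sumrN -!big_split /=; apply: eq_bigr => q _.
  by rewrite !mulrBl mulrDl.
rewrite (@pair_sum_sym m _ (fun p q => 2 * (R1 p && R3 q)%:Z)).
  by apply: eq_bigr => p _; rewrite mulr_sumr; apply: eq_bigr => q _; rewrite mulrA.
move=> p q; move: (h12 p) (h13 p) (h23 p) (h12 q) (h13 q) (h23 q).
by case: (R1 p); case: (R2 p); case: (R3 p); case: (R1 q); case: (R2 q); case: (R3 q).
Qed.

(** Inverts the definition of the cuts: this is [Cut_defect] for the regions [p],
[q] and the arc strictly between them. *)
Lemma cut_cell p q m : p != q ->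
  cut (ord_pred p) (ord_pred q) m + cut p q m
  - cut (ord_pred p) q m - cut p (ord_pred q) m = 2 * m (seg p q).
Proof.
move=> npq.
pose R2 x := inarc p q x && (x != q).
have inE' : forall a b x, inarc a b x =
  ((a < b) && (a < x <= b) || (b <= a) && ((a < x) || (x <= b)))%N by [].
have vp := ord_pred_val p; have vq := ord_pred_val q.
have hp := ltn_ord p; have hq := ltn_ord q.
have -> : m (seg p q) = \sum_(x | pred1 p x) \sum_(y | pred1 q y) m (seg x y).
  by rewrite big_pred1_eq big_pred1_eq.
have npq' : p != q :> nat by [].
rewrite -(@Cut_defect (pred1 p) R2 (pred1 q)); first last.
- by move=> x; rewrite /R2 /=; case: (x == q); rewrite ?andbF.
- by move=> x /=; case: eqP => // ->.
- move=> x /=; rewrite /R2; case: eqP => // ->; rewrite /inarc; lia.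
congr (_ + _ - _ - _).
- apply: Cut_eq => x; rewrite inE' vp vq /R2 /inarc /= !ord_eqE.
  have hx := ltn_ord x; case: ifP => /eqP; case: ifP => /eqP; lia.
- apply: Cut_eq => x; rewrite /R2 /= ; case: (eqVneq x q) => [->|]; rewrite ?andbT ?orbF ?orbT //.
  by rewrite inE'; lia.
- apply: Cut_eq => x; rewrite inE' vp /R2 /inarc /= !ord_eqE.
  have hx := ltn_ord x; case: ifP => /eqP; lia.
- case: (eqVneq (ord_pred q) p) => [e|ne].
    apply: Cut_compl => x; rewrite /R2 e inarc_id.
    have : nat_of_ord (ord_pred q) = p by rewrite e.
    rewrite vq inE' /= !ord_eqE.
    have hx := ltn_ord x; case: ifP => /eqP; lia.
  apply: Cut_eq => x; rewrite inE' vq /R2 /inarc /= !ord_eqE.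
  have : ord_pred q != p :> nat by [].
  rewrite vq; have hx := ltn_ord x; case: ifP => /eqP; lia.
Qed.

Lemma cut_defect i j k l m : clockwise i j k l ->
  cut i k m + cut j l m - cut i l m - cut j k m
  = 2 * \sum_(p | inarc i j p) \sum_(q | inarc k l q) m (seg p q).
Proof.
move=> cw; rewrite -(@Cut_defect (inarc i j) (inarc j k) (inarc k l)); first last.
- by move=> x; move: cw; rewrite /clockwise /inarc; lia.
- by move=> x; move: cw; rewrite /clockwise /inarc; lia.
- by move=> x; move: cw; rewrite /clockwise /inarc; lia.
by congr (_ + _ - _ - _); apply: Cut_eq => x; move: cw; rewrite /clockwise /inarc; lia.
Qed.

Lemma CutD J m1 m2 : Cut J (m1 + m2) = Cut J m1 + Cut J m2.
Proof.
rewrite !CutE -big_split; apply: eq_bigr => p _; rewrite -big_split /=.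
by apply: eq_bigr => q _; rewrite ffunE mulrDr.
Qed.

Lemma cutD a b m1 m2 : cut a b (m1 + m2) = cut a b m1 + cut a b m2.
Proof. exact: CutD. Qed.

Lemma cut0 a b : cut a b 0 = 0.
Proof. by have := cutD a b 0 0; rewrite addr0; lia. Qed.

Lemma cutN a b m : cut a b (- m) = - cut a b m.
Proof. by have := cutD a b m (- m); rewrite subrr cut0; lia. Qed.

Lemma cutB a b m1 m2 : cut a b (m1 - m2) = cut a b m1 - cut a b m2.
Proof. by rewrite cutD cutN. Qed.

Lemma cutMz a b m (c : int) : cut a b (m *~ c) = cut a b m * c.
Proof.
rewrite /cut !CutE mulr_suml; apply: eq_bigr => p _; rewrite mulr_suml.
by apply: eq_bigr => q _; rewrite exps_mulz mulrA.
Qed.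

Lemma cut_sum a b (I : Type) (t : seq I) (P : pred I) (F : I -> exps) :
  cut a b (\sum_(z <- t | P z) F z) = \sum_(z <- t | P z) cut a b (F z).
Proof.
by apply: (big_morph (cut a b)); [move=> ??; exact: cutD|exact: cut0].
Qed.

Lemma Cut_delta J i j : i != j -> Cut J (delta (seg i j)) = (J i != J j)%:Z.
Proof.
move=> nij; rewrite CutE.
have E p q : delta (seg i j) (seg p q)
    = (p == i)%:Z * (q == j)%:Z + (p == j)%:Z * (q == i)%:Z.
  rewrite ffunE seg_eq; have [->|_] := eqVneq p i; last by case: (p == j); case: (q == i).
  by rewrite (negbTE nij) andFb orbF mul0r addr0; case: (q == j).
have S a b (F : V -> V -> int) : \sum_p \sum_q F p q * ((p == a)%:Z * (q == b)%:Z) = F a b.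
  rewrite (bigD1 a) //= (bigD1 b) //= !eqxx !mulr1 !big1 ?addr0 // => [p /negbTE np|q /negbTE nq].
    by rewrite big1 // => q _; rewrite np mul0r mulr0.
  by rewrite nq !mulr0.
under eq_bigr do under eq_bigr do rewrite E mulrDr.
under eq_bigr do rewrite big_split.
rewrite big_split /= !S.
by case: (J i); case: (J j).
Qed.

Lemma cut_delta a b i j : i != j ->
  cut a b (delta (seg i j)) = (inarc a b i != inarc a b j)%:Z.
Proof. exact: Cut_delta. Qed.

(** What [m] loses when the Pluecker relation replaces the crossing pair [ik], [jl]
by [ij], [kl]. *)
Definition resol i j k l : exps :=
  delta (seg i k) + delta (seg j l) - delta (seg i j) - delta (seg k l).

Definition separates a b i j k l :=
  [&& inarc a b i == inarc a b j, inarc a b k == inarc a b l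
    & inarc a b i != inarc a b k].

(** A chord that separates [ij] from [kl] meets both [ik] and [jl], and neither [ij]
nor [kl]; any other chord meets the two pairs equally often. *)
Lemma cut_resol a b i j k l : clockwise i j k l ->
  cut a b (resol i j k l) = 2 * (separates a b i j k l)%:Z.
Proof.
move=> cw; have [? ? ? [? ? ?]] := clockwise_neq cw.
rewrite /resol !cutB cutD !cut_delta //.
have := clockwise_inarc (a := a) (b := b) cw; rewrite /separates.
by case: (inarc a b i); case: (inarc a b j); case: (inarc a b k); case: (inarc a b l) => // h;
  have := h erefl erefl.
Qed.

(** The arc (a, ordS a] is a single vertex, and the cut along it is the degree at
that vertex: [dom] compares exponents of equal degrees only. *)
Definition dom m1 m2 :=
  (forall a b, cut a b m1 <= cut a b m2)
  /\ (forall a, cut a (ordS a) m1 = cut a (ordS a) m2).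

Lemma dom_refl m : dom m m. Proof. by []. Qed.

Lemma dom_trans m2 m1 m3 : dom m1 m2 -> dom m2 m3 -> dom m1 m3.
Proof.
move=> [h1 h2] [h3 h4]; split=> [a b|a]; first exact: le_trans (h3 a b).
by rewrite h2.
Qed.

Lemma domD m1 m2 m3 m4 : dom m1 m3 -> dom m2 m4 -> dom (m1 + m2) (m3 + m4).
Proof.
move=> [h1 h2] [h3 h4]; split=> [a b|a]; rewrite !cutD; first exact: lerD.
by rewrite h2 h4.
Qed.

Lemma dom_resol i j k l : clockwise i j k l -> dom 0 (resol i j k l).
Proof.
move=> cw; split=> [a b|a]; rewrite cut_resol // cut0; first by [].
have [ij _ _ [_ _ kl]] := clockwise_neq cw.
have h x y : x != y -> ~~ ((x == ordS a) && (y == ordS a)).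
  by apply: contra => /andP[/eqP-> /eqP->].
rewrite /separates !inarc_edge; move: (h _ _ ij) (h _ _ kl).
by case: (i == _); case: (j == _); case: (k == _); case: (l == _).
Qed.

End Cut.

(** * Positive rectangles of functions on the integer lattice *)

Lemma last_zero (f : int -> int) x0 u : (forall x, 0 <= f x) ->
  f x0 = 0 -> 0 < f u -> x0 < u ->
  exists x, [/\ x0 <= x < u, f x = 0 & forall z, x < z <= u -> 0 < f z].
Proof.
move=> f0 fx fu lt.
suff h (k : nat) : (exists x, [/\ x0 <= x < u, f x = 0 & forall z, x < z <= u -> 0 < f z])
    \/ (forall z, u - k%:Z <= z <= u -> 0 < f z).
  have [//|/(_ x0)] := h (absz (u - x0)%R); rewrite fx; lia.
elim: k => [|k [IH|IH]]; first by right=> z hz; have -> : z = u by lia.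
  by left.
have [e|ne] := eqVneq (f (u - k.+1%:Z)) 0; last first.
  right=> z hz; have [->|nz] := eqVneq z (u - k.+1%:Z); last by apply: IH; lia.
  by have := f0 (u - k.+1%:Z); lia.
have [lt2|ge2] := ltP (u - k.+1%:Z) x0.
  by have := IH x0; rewrite fx; lia.
by left; exists (u - k.+1%:Z); split=> [|//|z hz]; [lia|apply: IH; lia].
Qed.

Lemma first_zero (f : int -> int) x0 u : (forall x, 0 <= f x) ->
  f x0 = 0 -> 0 < f u -> u < x0 ->
  exists x, [/\ u < x <= x0, f x = 0 & forall z, u <= z < x -> 0 < f z].
Proof.
move=> f0 fx fu lt.
have [||||x [hx fx0 hz]] := @last_zero (fun x => f (- x)) (- x0) (- u); rewrite ?opprK //.
  by lia.
exists (- x); split=> // [|z hzz]; first by lia.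
by rewrite -[z]opprK; apply: hz; lia.
Qed.

Section Rectangle.
Variables (d : int -> int -> int) (N : int).
Hypothesis d_ge0 : forall a b, 0 <= d a b.
Hypothesis d_strip : forall a b, 0 < d a b -> a + 1 < b < a + N - 1.

(** The exponent at the segment [pq], up to a factor 2, when [d] is made of cuts. *)
Definition cell p q := d p q + d (p - 1) (q - 1) - d (p - 1) q - d p (q - 1).

(** Going down from the row [y0], the difference [d (x + 1) y - d x y] starts
positive and can only drop at a positive cell; as long as it stays positive so does
[d (x + 1) y], which must vanish at the end of the strip. *)
Lemma left_cell x y0 : d x y0 = 0 -> 0 < d (x + 1) y0 ->
  exists q, [/\ q <= y0, 0 < cell (x + 1) q & forall y, q <= y <= y0 -> 0 < d (x + 1) y].
Proof.
move=> dx dx1.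
suff h (k : nat) : (exists q, [/\ q <= y0, 0 < cell (x + 1) q
      & forall y, q <= y <= y0 -> 0 < d (x + 1) y])
    \/ (forall y, y0 - k%:Z <= y <= y0 -> 0 < d (x + 1) y)
      /\ 0 < d (x + 1) (y0 - k%:Z) - d x (y0 - k%:Z).
  have [//|[/(_ (y0 - (absz (y0 - x)%R)%:Z)) h1 _]] := h (absz (y0 - x)%R).
  have := d_strip (h1 _); lia.
elim: k => [|k [IH|[IH1 IH2]]]; first 2 [by left].
  right; split=> [y hy|]; first by have -> : y = y0 by lia.
  by rewrite subr0 dx subr0.
pose q := y0 - k%:Z.
have [c0|c0] := ltP 0 (cell (x + 1) q).
  by left; exists q; split=> //; lia.
right; move: c0; rewrite /cell /q addrK => c0.
have e : y0 - k%:Z - 1 = y0 - k.+1%:Z by lia.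
rewrite e in c0; have := d_ge0 x (y0 - k.+1%:Z) => c1.
split=> [y hy|]; last by lia.
have [->|ny] := eqVneq y (y0 - k.+1%:Z); first by lia.
by apply: IH1; lia.
Qed.

(** The mirror image of [left_cell], going up from the row [y0]. *)
Lemma right_cell x y0 : 0 < d x y0 -> d (x + 1) y0 = 0 ->
  exists q, [/\ y0 < q, 0 < cell (x + 1) q & forall y, y0 <= y < q -> 0 < d x y].
Proof.
move=> dx dx1.
suff h (k : nat) : (exists q, [/\ y0 < q, 0 < cell (x + 1) q
      & forall y, y0 <= y < q -> 0 < d x y])
    \/ (forall y, y0 <= y <= y0 + k%:Z -> 0 < d x y)
      /\ d (x + 1) (y0 + k%:Z) - d x (y0 + k%:Z) < 0.
  have [//|[/(_ (y0 + (absz (x + N - y0)%R)%:Z)) h1 _]] := h (absz (x + N - y0)%R).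
  have := d_strip (h1 _); lia.
elim: k => [|k [IH|[IH1 IH2]]]; first 2 [by left].
  right; split=> [y hy|]; first by have -> : y = y0 by lia.
  by rewrite addr0 dx1; lia.
pose q := y0 + k.+1%:Z.
have [c0|c0] := ltP 0 (cell (x + 1) q).
  left; exists q; split=> [|//|y hy]; first by rewrite /q; lia.
  by apply: IH1; rewrite /q in hy; lia.
right; move: c0; rewrite /cell /q addrK => c0.
have e : y0 + k.+1%:Z - 1 = y0 + k%:Z by lia.
rewrite e in c0; have := d_ge0 (x + 1) (y0 + k.+1%:Z) => c1.
split=> [y hy|]; last by lia.
have [->|ny] := eqVneq y (y0 + k.+1%:Z); first by lia.
by apply: IH1; lia.
Qed.

(** The two cells touch the rectangle from outside at opposite corners: they are
the two crossing segments that a resolution removes, and [d] drops on the rectangle. *)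
Definition positive_rectangle p p' q q' :=
  [/\ p < p', q < q', 0 < cell p q, 0 < cell p' q'
    & forall x y, p <= x < p' -> q <= y < q' -> 0 < d x y].

(** A configuration in which the row [v] is positive, and the left and right columns
are positive from that row to a positive cell.  A zero of the rectangle lies in
another row, say above; between the last zero of that row and the right column, which
is positive there, one finds a narrower configuration, with a new cell supplied by
[left_cell].  Below the row [v], the left column and [right_cell] take over. *)
Lemma shrink_rectangle (k : nat) u u' q1 q2 v :
  u' - u < k%:Z -> u <= u' -> q1 <= v < q2 ->
  (forall x, u <= x <= u' -> 0 < d x v) ->
  (forall y, q1 <= y <= v -> 0 < d u y) ->
  (forall y, v <= y < q2 -> 0 < d u' y) ->
  0 < cell u q1 -> 0 < cell (u' + 1) q2 ->
  exists p p' q q', positive_rectangle p p' q q'.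
Proof.
elim: k u u' q1 q2 v => [|k IH] u u' q1 q2 v; first by lia.
move=> lt le hv row col col' c1 c2.
have [all_pos|] := pselect (forall x y, u <= x <= u' -> q1 <= y < q2 -> 0 < d x y).
  exists u, (u' + 1), q1, q2; split=> //; [lia|lia|].
  by move=> x y hx hy; apply: all_pos; lia.
move=> /existsNP[x0] /existsNP[y0] /not_implyP[hx] /not_implyP[hy] /negP.
rewrite lt_neqAle d_ge0 andbT negbK eq_sym => /eqP d0.
have nyv : y0 != v.
  by apply/eqP => e; have := row x0 hx; rewrite -e d0.
have [lty|gey] := ltP v y0.
  have du' : 0 < d u' y0 by apply: col'; lia.
  have ltx : x0 < u' by rewrite lt_neqAle; apply/andP; split; [apply/eqP => e; move: d0 du'; rewrite -e => ->|lia].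
  have [//||||x [hx1 dx hz]] := @last_zero (d^~ y0) x0 u' => //.
  have dx1 : 0 < d (x + 1) y0 by apply: hz; lia.
  have [q [hq cq colq]] := left_cell dx dx1.
  by apply: (IH (x + 1) u' q q2 y0) => //; [lia|lia|lia|move=> z ?; apply: hz; lia|move=> y ?; apply: col'; lia].
have du : 0 < d u y0 by apply: col; lia.
have ltx : u < x0 by rewrite lt_neqAle; apply/andP; split; [apply/eqP => e; move: d0 du; rewrite -e => ->|lia].
have [//||||x [hx1 dx hz]] := @first_zero (d^~ y0) x0 u => //.
have dx1 : 0 < d (x - 1) y0 by apply: hz; lia.
have [|q [hq cq colq]] := right_cell dx1; first by rewrite subrK.
apply: (IH u (x - 1) q1 q y0) => //; [lia|lia|lia|move=> z ?; apply: hz; lia|move=> y ?; apply: col; lia].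
Qed.

(** The positive stretch of a row through a positive point ends in zeros on both
sides, next to which there are positive cells. *)
Lemma rectangle_exists u v : 0 < d u v ->
  exists p p' q q', positive_rectangle p p' q q'.
Proof.
move=> duv; have s := d_strip duv.
have z x : ~~ (x + 1 < v < x + N - 1) -> d x v = 0.
  by move=> h; have := d_strip (a := x) (b := v); have := d_ge0 x v; lia.
have [||||x [hx dx hz]] := @last_zero (d^~ v) (v - N) u => //; [apply: z; lia|lia|].
have [||||x' [hx' dx' hz']] := @first_zero (d^~ v) v u => //; [apply: z; lia|lia|].
have [|q1 [hq1 cq1 col1]] := left_cell dx; first by apply: hz; lia.
have [||q2 [hq2 cq2 col2]] := @right_cell (x' - 1) v; [by apply: hz'; lia|by rewrite subrK|].
apply: (@shrink_rectangle (absz (x' - x)%R).+1 (x + 1) (x' - 1) q1 q2 v) => //; [lia|lia|lia|].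
by move=> y hy; have [|] := leP y u => ?; [apply: hz|apply: hz']; lia.
Qed.

End Rectangle.

(** * Domination of cuts is generated by resolutions of crossings *)

Section Order.
Variable n : nat.
Notation V := 'I_n.+3.
Notation exps := {ffun {set V} -> int}.
Notation N := (n.+3%:Z).
Implicit Types (i j k l a b p q r s x y : V) (e f : {set V}) (m : exps).

Definition onseg m := forall e, #|e| != 2%N -> m e = 0.
Definition pos m := forall e, diagonal e -> 0 <= m e.

Lemma ord_predK a : ordS (ord_pred a) = a.
Proof.
apply/eqP; rewrite eq_sym eq_ordS ord_pred_val.
by have := ltn_ord a; case: ifP => /eqP; lia.
Qed.

Lemma ordSK a : ord_pred (ordS a) = a.
Proof.
apply/eqP; rewrite ord_eqE ord_pred_val ordS_val.
by have := ltn_ord a; case: (_ =P n.+2) => /= h; try case: ifP; lia.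
Qed.

Lemma cut_deg p m : cut (ord_pred p) p m = \sum_(q | q != p) m (seg p q).
Proof.
rewrite /cut (@Cut_eq _ _ (pred1 p)) => [|x]; last by rewrite -[X in inarc _ X]ord_predK inarc_edge ord_predK.
by rewrite /Cut big_pred1_eq.
Qed.

(** Adding up the degrees over an arc counts the segments inside it twice. *)
Lemma cut_parity a b m :
  exists c, cut a b m = \sum_(p | inarc a b p) cut (ord_pred p) p m + 2 * c.
Proof.
rewrite {1}/cut; move: (inarc a b) => J.
exists (- \sum_(p | J p) \sum_(q | J q && (p < q)%N) m (seg p q)).
have E : \sum_(p | J p) \sum_(q | J q && (q < p)%N) m (seg p q)
       = \sum_(p | J p) \sum_(q | J q && (p < q)%N) m (seg p q).
  rewrite (exchange_big_dep J) /=; last by move=> ? ? _ /andP[].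
  apply: eq_bigr => p Jp; apply: eq_big => [q|q _]; last by rewrite seg_sym.
  by rewrite Jp.
rewrite mulrN -[2]/(1 + 1) mulrDl mul1r -{1}E opprD.
rewrite -!sumrN -!big_split /=; apply: eq_bigr => p Jp.
have -> : cut (ord_pred p) p m = \sum_(q | J q && (q < p)%N) m (seg p q)
    + \sum_(q | J q && (p < q)%N) m (seg p q) + \sum_(q | ~~ J q) m (seg p q).
  rewrite cut_deg (bigID J) /= (bigID (fun q => q < p)%N) /=; congr (_ + _ + _).
  - by apply: eq_bigl => q; rewrite ?ord_eqE; case: (J q) => /=; rewrite ?andbT ?andbF //; lia.
  - by apply: eq_bigl => q; rewrite ?ord_eqE; case: (J q) => /=; rewrite ?andbT ?andbF //; lia.
  - by apply: eq_bigl => q; case: (eqVneq q p) => [->|_]; rewrite ?Jp ?andbT.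
by ring.
Qed.

Lemma cut_inj m1 m2 : onseg m1 -> onseg m2 ->
  (forall a b, cut a b m1 = cut a b m2) -> m1 = m2.
Proof.
move=> s1 s2 h; apply/ffunP => e.
have [ce|ce] := boolP (#|e| == 2)%N; last by rewrite s1 // s2.
have [p [q [_ npq ->]]] := segP ce.
apply: (@mulfI _ 2) => //; rewrite -!cut_cell // !h //.
Qed.

(** The integers as the universal cover of the polygon. *)
Definition iord (x : int) : V := inord (absz (x %% N)%Z).

Lemma iordE (x : int) : iord x = (x %% N)%Z :> int.
Proof.
rewrite /iord inordK ?gez0_abs ?modz_ge0 //.
by rewrite -ltz_nat gez0_abs ?modz_ge0 // ltz_pmod.
Qed.

Lemma iord_rel (p x : int) : p <= x < p + N ->
  (iord x = (iord p)%:Z + (x - p) :> int) \/ (iord x = (iord p)%:Z + (x - p) - N :> int).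
Proof.
move=> h; have e : (iord x)%:Z = (((iord p)%:Z + (x - p)) %% N)%Z.
  rewrite !iordE; apply/eqP; rewrite eqz_mod_dvd.
  have := divz_eq p N; set c := (p %/ N)%Z; set r := (p %% N)%Z => ->.
  have -> : x - (r + (x - (c * N + r))) = c * N by ring.
  exact: dvdz_mull.
have hp : 0 <= (iord p)%:Z < N by have := ltn_ord (iord p); lia.
rewrite e; have [lt|ge] := ltP ((iord p)%:Z + (x - p)) N.
  by left; rewrite modz_small //; lia.
right; rewrite -{1}[(iord p)%:Z + (x - p)](subrK N) modzDr modz_small //; lia.
Qed.

Lemma iord_nat a : iord a = a.
Proof. by apply: val_inj; apply/eqP; rewrite -eqz_nat iordE modz_small // ltz_nat ltn_ord. Qed.

Lemma iord_pred (x : int) : iord (x - 1) = ord_pred (iord x).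
Proof.
apply: val_inj; apply/eqP; rewrite -[_ == _]/(nat_of_ord _ == nat_of_ord _) ord_pred_val.
have := ltn_ord (iord (x - 1)); have := ltn_ord (iord x).
by case: (@iord_rel (x - 1) x) => [|h|h]; first lia; case: ifP => /eqP; lia.
Qed.

Lemma iord_lift (p : int) a : exists x : int, p <= x < p + N /\ iord x = a.
Proof.
pose x := if (iord p <= a)%N then p + (a%:Z - (iord p)%:Z) else p + (a%:Z - (iord p)%:Z) + N.
have hp := ltn_ord (iord p); have ha := ltn_ord a.
have hx : p <= x < p + N by rewrite /x; case: ifP; lia.
exists x; split=> //; apply: val_inj; rewrite /=.
have := ltn_ord (iord x).
by case: (iord_rel hx); rewrite /x; case: ifP; lia.
Qed.

Lemma iord_clockwise (p p' q q' : int) : p < p' -> p' < q -> q < q' -> q' < p + N ->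
  clockwise (iord p) (iord p') (iord q) (iord q').
Proof.
move=> h1 h2 h3 h4.
have [] : [/\ p <= p' < p + N, p <= q < p + N & p <= q' < p + N] by split; lia.
move=> /iord_rel r1 /iord_rel r2 /iord_rel r3.
have := (ltn_ord (iord p)); have := (ltn_ord (iord p')).
have := (ltn_ord (iord q)); have := (ltn_ord (iord q')).
rewrite /clockwise; lia.
Qed.

Lemma iord_diag (p q : int) : p + 1 < q -> q < p + N - 1 ->
  diagonal (seg (iord p) (iord q)).
Proof.
move=> h1 h2; have /iord_rel r1 : p <= q < p + N by lia.
have := (ltn_ord (iord p)); have := (ltn_ord (iord q)).
rewrite diag_seg; lia.
Qed.

Lemma iord_inarc (p x y z : int) :
  p <= x < p + N -> p <= y < p + N -> p <= z < p + N ->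
  inarc (iord x) (iord y) (iord z)
  = (x < y) && (x < z <= y) || (y <= x) && ((x < z) || (z <= y)).
Proof.
move=> hx hy hz; move: (iord_rel hx) (iord_rel hy) (iord_rel hz).
have := (ltn_ord (iord p)); have := (ltn_ord (iord x)).
have := (ltn_ord (iord y)); have := (ltn_ord (iord z)).
rewrite /inarc => ? ? ? ? h1 h2 h3.
case: h1; case: h2; case: h3; lia.
Qed.

Lemma separates_lift (p p' q q' : int) a b :
  p < p' -> p' < q -> q < q' -> q' < p + N ->
  separates a b (iord p') (iord q) (iord q') (iord p) ->
  exists x y : int, [/\ p <= x < p', q <= y < q' &
    (iord x = a /\ iord y = b) \/ (iord y = a /\ iord x = b)].
Proof.
move=> h1 h2 h3 h4; have [x [hx <-]] := iord_lift p a.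
have [y [hy <-]] := iord_lift p b.
rewrite /separates !(@iord_inarc p) //; try lia.
move=> h; have [lt|ge] := ltP x y.
  by exists x, y; split; [lia|lia|left].
by exists y, x; split; [lia|lia|right].
Qed.

(** The difference [d] of the cuts, on the universal cover, vanishes on edges and has,
up to a factor 2, the second differences [m2 - m1].  A positive rectangle for [d] gives two crossing
diagonals of [m2]; resolving them costs 2 on the chords of the rectangle only, where
[d] is positive and even. *)
Lemma dom_step m1 m2 : onseg m1 -> onseg m2 -> pos m1 -> dom m1 m2 -> m1 <> m2 ->
  exists i j k l, [/\ clockwise i j k l, 0 < m2 (seg i k), 0 < m2 (seg j l)
    & dom m1 (m2 - resol i j k l)].
Proof.
move=> s1 s2 p1 [le12 eq12] ne.
pose D a b := cut a b m2 - cut a b m1.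
have Dsym a b : D a b = D b a by rewrite /D cut_sym [cut a b m1]cut_sym.
have D_ge0 a b : 0 <= D a b by rewrite subr_ge0.
have D_id a : D a a = 0 by rewrite /D !cut_id.
have D_edge a : D a (ordS a) = 0 by rewrite /D eq12 subrr.
have D_even a b : exists c, D a b = 2 * c.
  have [c1 e1] := cut_parity a b m1; have [c2 e2] := cut_parity a b m2.
  exists (c2 - c1); rewrite /D e1 e2 (eq_bigr (fun p => cut (ord_pred p) p m1)); first by ring.
  by move=> p _; rewrite -[X in cut _ X]ord_predK eq12 ord_predK.
pose d (x y : int) := if x + 1 < y < x + N - 1 then D (iord x) (iord y) else 0.
have dE (x y : int) : x <= y <= x + N -> d x y = D (iord x) (iord y).
  move=> h; rewrite /d; case: ifP => // hh.
  have ordSp (z : int) : iord (z + 1) = ordS (iord z).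
    by rewrite -[in RHS](addrK 1 z) iord_pred ord_predK.
  have perN (z : int) : iord (z + N) = iord z by apply: val_inj; apply/eqP; rewrite -eqz_nat !iordE modzDr.
  have [->|ne1] := eqVneq x y; first by rewrite D_id.
  have [->|ne2] := eqVneq y (x + 1); first by rewrite ordSp D_edge.
  have [->|ne3] := eqVneq y (x + N); first by rewrite perN D_id.
  have -> : iord x = ordS (iord y) by rewrite -ordSp -(perN x); congr iord; lia.
  by rewrite Dsym D_edge.
have d_ge0 (x y : int) : 0 <= d x y by rewrite /d; case: ifP.
have d_strip (x y : int) : 0 < d x y -> x + 1 < y < x + N - 1 by rewrite /d; case: ifP.
have cellE (p q : int) : 0 < cell d p q -> [/\ p + 1 < q, q < p + N - 1
    & 0 < m2 (seg (iord p) (iord q))].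
  move=> c0.
  have [in1 in2] : p < q /\ q < p + N.
    have z (x y : int) : ~~ (x + 1 < y < x + N - 1) -> d x y = 0 by rewrite /d => /negbTE ->.
    split; rewrite ltNge; apply/negP => h; move: c0; rewrite /cell !z ?ltxx //; lia.
  have [in3 in4] : p + 1 < q /\ q < p + N - 1.
    have z (x y : int) : ~~ (x + 1 < y < x + N - 1) -> d x y = 0 by rewrite /d => /negbTE ->.
    split; rewrite lt_neqAle; apply/andP; split; try lia; apply/eqP => h; move: c0;
      rewrite /cell (z p q) ?(z (p - 1) (q - 1)); try lia;
      have := d_ge0 (p - 1) q; have := d_ge0 p (q - 1); lia.
  split=> //; have dg := iord_diag in3 in4.
  have npq : iord p != iord q by move: dg; rewrite /diagonal card_seg => /andP[].
  move: c0; rewrite /cell !dE; try lia; rewrite !iord_pred /D => c0.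
  have := cut_cell m1 npq; have := cut_cell m2 npq; have := p1 _ dg; lia.
have [a [b Dab]] : exists a b, 0 < D a b.
  apply: contrapT => h; apply: ne; apply: cut_inj => // a b.
  have := D_ge0 a b; rewrite le_eqVlt => /orP[/eqP|h']; first by rewrite /D; lia.
  by case: h; exists a, b.
have [u [v duv]] : exists u v : int, 0 < d u v.
  have [y [hy ey]] := iord_lift (a%:Z) b.
  by exists a%:Z, y; rewrite dE ?iord_nat ?ey //; lia.
have [p [p' [q [q' [h1 h2 c1 c2 hd]]]]] := rectangle_exists d_ge0 d_strip duv.
have [? ? mpq] := cellE _ _ c1; have [? ? mpq'] := cellE _ _ c2.
have s1' := d_strip (p' - 1) q (hd _ _ _ _).
have s2' := d_strip p (q' - 1) (hd _ _ _ _).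
have {s1'} s1' : p' < q by lia.
have {s2'} s2' : q' < p + N by lia.
have cw := iord_clockwise h1 s1' h2 s2'.
(* The chords of the rectangle separate p' and q from q' and p. *)
exists (iord p'), (iord q), (iord q'), (iord p).
have cw' : clockwise (iord p') (iord q) (iord q') (iord p) by rewrite -clockwise_rot.
split=> //; first by rewrite seg_sym.
split=> [x y|x]; rewrite cutB; last first.
  by rewrite eq12; have [_ /(_ x)] := dom_resol cw'; rewrite cut0 => <-; rewrite subr0.
rewrite cut_resol //; case sep : separates; last by rewrite mulr0 subr0.
rewrite mulr1.
have [x1 [y1 [hx1 hy1 hxy]]] := separates_lift h1 s1' h2 s2' sep.
have : 0 < D x y.
  have := hd _ _ hx1 hy1; rewrite dE; last by lia.
  by case: hxy => -[-> ->] //; rewrite Dsym.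
by have [c] := D_even x y; rewrite /D; lia.
Qed.

End Order.

(** * Triangulations *)

Section Triangulations.
Variable n : nat.
Notation V := 'I_n.+3.
Notation exps := {ffun {set V} -> int}.
Implicit Types (i j k l a b p q r s x y : V) (e f g : {set V}) (m : exps)
  (T : {set {set V}}).

(** Edges cross nothing, and their exponents are unrestricted. *)
Definition noncrossing_support m := forall e f, diagonal e -> diagonal f ->
  0 < m e -> 0 < m f -> ~~ crossing e f.

(** The exponents of cluster monomials, with edges inverted. *)
Definition lam m := [/\ onseg m, pos m & noncrossing_support m].

Lemma clockwise_diag i j k l : clockwise i j k l ->
  diagonal (seg i k) && diagonal (seg j l).
Proof.
have := ltn_ord i; have := ltn_ord j; have := ltn_ord k; have := ltn_ord l.
by rewrite !diag_seg /clockwise; lia.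
Qed.

Lemma clockwise_crossing i j k l : clockwise i j k l -> crossing (seg i k) (seg j l).
Proof. by rewrite crossing_seg => ->. Qed.

Lemma crossingP a b g : crossing (seg a b) g ->
  exists s t, g = seg s t /\ clockwise a s b t.
Proof.
move=> /existsP[i /existsP[j /existsP[k /existsP[l /and3P[cw]]]]].
rewrite seg_eq => /orP[] /andP[/eqP-> /eqP->] /eqP->; first by exists j, l.
by exists l, j; rewrite seg_sym -clockwise_rot -clockwise_rot.
Qed.

(** A cluster monomial has no crossing to which [dom_step] could apply. *)
Lemma lam_anti m1 m2 : lam m1 -> lam m2 -> dom m1 m2 -> m1 = m2.
Proof.
move=> [s1 p1 _] [s2 _ nc2] d12; apply: contrapT => ne.
have [i [j [k [l [cw h1 h2 _]]]]] := dom_step s1 s2 p1 d12 ne.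
have /andP[dik djl] := clockwise_diag cw.
by have := nc2 _ _ dik djl h1 h2; rewrite clockwise_crossing.
Qed.

Lemma edge_crossing e f : edge e -> ~~ crossing e f.
Proof.
move=> ee; have [a [b [_ _ E]]] := segP (edge_card ee); subst e.
apply/negP => /crossingP[s [t [_ cw]]]; move: ee.
by case/andP: (clockwise_diag cw); rewrite /diagonal => /andP[_ /negbTE ->].
Qed.

Lemma ptriP T : reflect ((forall e, e \in T -> diagonal e)
    /\ (forall e f, e \in T -> f \in T -> ~~ crossing e f))
  (partial_triangulation T).
Proof.
apply: (iffP andP) => [[/forall_inP h1 /forall_inP h2]|[h1 h2]]; split=> //.
- by move=> e f he hf; apply: (forall_inP (h2 _ he)).
- exact/forall_inP.
- by apply/forall_inP => e he; apply/forall_inP => f; apply: h2.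
Qed.

Lemma with_edgesE T e : (e \in with_edges T) = (e \in T) || edge e.
Proof. by rewrite /with_edges finset.in_setU finset.in_set. Qed.

Lemma diagonalE e : diagonal e = (#|e| == 2%N) && ~~ edge e. Proof. by []. Qed.

Lemma diag_card e : diagonal e -> #|e| == 2%N. Proof. by case/andP. Qed.

Lemma chart_noncrossing T e f : partial_triangulation T ->
  e \in with_edges T -> f \in with_edges T -> ~~ crossing e f.
Proof.
move=> /ptriP[_ nc]; rewrite !with_edgesE => /orP[he|/edge_crossing->//].
move=> /orP[hf|/edge_crossing h]; first exact: nc.
by rewrite crossing_sym.
Qed.

Lemma chart_card T e : partial_triangulation T -> e \in with_edges T -> #|e| == 2%N.
Proof.
move=> /ptriP[hd _]; rewrite with_edgesE => /orP[/hd /diag_card //|].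
exact: edge_card.
Qed.

Lemma crossing_self e : ~~ crossing e e.
Proof.
apply/negP => h; have [i [j [k [l]]]] : exists i j k l, [&& clockwise i j k l, e == seg i k & e == seg j l].
  by move: h => /existsP[i /existsP[j /existsP[k /existsP[l h]]]]; exists i, j, k, l.
by case/and3P => cw /eqP->; rewrite seg_eq; have [/negbTE-> _ /negbTE-> _] := clockwise_neq cw.
Qed.

(* Only the characterizations of these notions are used below; unfolded, they make
   unification compare sets of vertices. *)
#[local] Opaque seg crossing with_edges diagonal edge partial_triangulation complete_triangulation.

Lemma completeP T : complete_triangulation T <-> partial_triangulation T
  /\ forall e, diagonal e -> (forall f, f \in T -> ~~ crossing e f) -> e \in T.
Proof.
split=> [/maxsetP[pT mx]|[pT h]].
  split=> // e de nc; have <- : (e |: T)%SET = T; last by rewrite setU11.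
  apply: mx; last exact: finset.subsetUr.
  have [hd hn] := ptriP _ pT; apply/ptriP; split=> [f|f g]; rewrite !finset.in_setU1.
    by case/orP => [/eqP->//|]; apply: hd.
  case/orP => [/eqP->|hf]; case/orP => [/eqP->|hg].
  - exact: crossing_self.
  - exact: nc.
  - by rewrite crossing_sym nc.
  - exact: hn.
apply/maxsetP; split=> // B pB TB; apply/eqP; rewrite finset.eqEsubset TB andbT.
have [hd hn] := ptriP _ pB; apply/fintype.subsetP => e eB; apply: h; first exact: hd.
by move=> f fT; apply: hn => //; apply: (fintype.subsetP TB).
Qed.

Lemma complete_partial T : complete_triangulation T -> partial_triangulation T.
Proof. by move=> /completeP[]. Qed.

Lemma extend_complete T : partial_triangulation T ->
  exists2 T', complete_triangulation T' & T \subset T'.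
Proof. by move=> /maxset_exists[T' h1 h2]; exists T'. Qed.

Definition cyc3 p q r := [|| p < q < r, q < r < p | r < p < q]%N.

Lemma clockwise3 p q r s : cyc3 p q r -> cyc3 r s p -> clockwise p q r s.
Proof. rewrite /cyc3 /clockwise; lia. Qed.

Lemma cyc3_rot p q r : cyc3 p q r = cyc3 q r p.
Proof. rewrite /cyc3; lia. Qed.

(** The clockwise distance from [b] to [x]; it turns cyclic orders into chains of
inequalities. *)
Definition offset b x : nat := if (b <= x)%N then (x - b)%N else (x + n.+3 - b)%N.

Lemma offset_inj b x y : offset b x = offset b y -> x = y.
Proof.
rewrite /offset => e; apply/eqP; rewrite ord_eqE.
have := ltn_ord x; have := ltn_ord y; have := ltn_ord b; move: e.
by case: ifP; case: ifP; lia.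
Qed.

Lemma offset_id b : offset b b = 0%N.
Proof. by rewrite /offset leqnn subnn. Qed.

Lemma clockwise_offset b i j k : clockwise b i j k = (0 < offset b i < offset b j)%N && (offset b j < offset b k)%N.
Proof.
have := ltn_ord i; have := ltn_ord j; have := ltn_ord k; have := ltn_ord b.
rewrite /clockwise /offset.
by case: ifP => h1; case: ifP => h2; case: ifP => h3 h4 h5 h6 h7; apply/idP/idP; lia.
Qed.

Lemma cyc3_offset b i j : cyc3 b i j = (0 < offset b i < offset b j)%N.
Proof.
have := ltn_ord i; have := ltn_ord j; have := ltn_ord b.
rewrite /cyc3 /offset.
by case: ifP => h1; case: ifP => h2 h4 h5 h6; apply/idP/idP; lia.
Qed.

Lemma offset_clockwise b i j k l :
  (offset b i < offset b j)%N -> (offset b j < offset b k)%N -> (offset b k < offset b l)%N -> clockwise i j k l.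
Proof.
have := ltn_ord i; have := ltn_ord j; have := ltn_ord k; have := ltn_ord b; have := ltn_ord l.
rewrite /clockwise /offset.
by case: ifP => h1; case: ifP => h2; case: ifP => h3; case: ifP => h4; lia.
Qed.

Lemma offset_lt b x y : x != y -> (offset b x < offset b y)%N \/ (offset b y < offset b x)%N.
Proof.
move=> ne; have : offset b x != offset b y by apply: contra ne => /eqP /offset_inj ->.
by rewrite neq_ltn => /orP.
Qed.

Lemma crossing_cw a b s t : clockwise a s b t -> crossing (seg a b) (seg s t).
Proof. by rewrite crossing_seg => ->. Qed.

Lemma crossing_cw' a b s t : clockwise a t b s -> crossing (seg a b) (seg s t).
Proof. by rewrite crossing_seg => ->; rewrite orbT. Qed.

Lemma triangle_crossing p q r s t : cyc3 p q r -> clockwise q s r t -> t != p ->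
  crossing (seg p r) (seg s t) || crossing (seg p q) (seg s t).
Proof.
rewrite cyc3_rot cyc3_offset clockwise_offset => /andP[r0 rp] /andP[/andP[s0 sr] rt] ntp.
have [lt|lt] := offset_lt q ntp; apply/orP; [left|right].
  by apply: crossing_cw; rewrite clockwise_rot; exact: (offset_clockwise sr rt lt).
apply: crossing_cw'; rewrite -clockwise_rot -clockwise_rot.
by apply: (offset_clockwise _ (ltn_trans sr rp) lt); rewrite offset_id.
Qed.

(** Take for [q] the neighbour of [p] farthest from [p] within the arc.  A diagonal
of [T] crossing [qr] would have to end in [p], and its other end would be farther. *)
Lemma triangle_exists T p r x : complete_triangulation T ->
  seg p r \in with_edges T -> cyc3 p x r ->
  exists q, [/\ cyc3 p q r, seg p q \in with_edges T & seg q r \in with_edges T].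
Proof.
move=> cT pr px; have [pT mx] := (completeP T).1 cT.
have P0 : cyc3 p (ordS p) r && (seg p (ordS p) \in with_edges T).
  rewrite with_edgesE edge_seg eqxx orbT andbT.
  move: px; rewrite /cyc3 ordS_val; have := ltn_ord p; have := ltn_ord x; have := ltn_ord r.
  by case: ifP => /eqP; lia.
case: (@arg_maxnP _ (ordS p) (fun q => cyc3 p q r && (seg p q \in with_edges T)) (offset p) P0) => q /andP[c3 pq] mq.
exists q; split=> //.
rewrite with_edgesE; have [//|ne] := boolP (edge (seg q r)); rewrite ?orbT // orbF.
apply: mx.
  rewrite diagonalE ne andbT card_seg ord_eqE; move: c3; rewrite /cyc3; lia.
move=> f fT; apply/negP => /crossingP[s [t [ef cw]]]; subst f.
have fT' : seg s t \in with_edges T by rewrite with_edgesE fT.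
have n1 := chart_noncrossing pT pr fT'; have n2 := chart_noncrossing pT pq fT'.
have etp : t = p.
  have [//|ntp] := eqVneq t p.
  by have := triangle_crossing c3 cw ntp; rewrite (negbTE n1) (negbTE n2).
subst t; rewrite seg_sym in fT'.
move: cw; rewrite -clockwise_rot clockwise_offset => /andP[/andP[q0 qs] sr].
have := mq s; rewrite fT' cyc3_offset (ltn_trans q0 qs) sr => /(_ isT).
by move=> h; have := leq_ltn_trans h qs; rewrite ltnn.
Qed.

Lemma quad_exists T e : complete_triangulation T -> e \in T ->
  exists p q r s, quad T e p q r s.
Proof.
move=> cT eT; have [pT mx] := (completeP T).1 cT.
have [hd _] := ptriP _ pT; have de := hd _ eT.
have [p [r [_ _ E]]] := segP (diag_card de); subst e.
have prT : seg p r \in with_edges T by rewrite with_edgesE eT.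
have rpT := prT; rewrite seg_sym in rpT.
have [|q [c1 pq qr]] := @triangle_exists T p r (ordS p) cT prT.
  move: de; rewrite diag_seg /cyc3 ordS_val; have := ltn_ord p; have := ltn_ord r.
  by case: ifP => /eqP; lia.
have [|s [c2 rs sp]] := @triangle_exists T r p (ordS r) cT rpT.
  move: de; rewrite diag_seg /cyc3 ordS_val; have := ltn_ord p; have := ltn_ord r.
  by case: ifP => /eqP; lia.
exists p, q, r, s; rewrite /quad clockwise3 // eqxx pq qr rs /=.
by rewrite seg_sym sp.
Qed.

Lemma quad_crossing p q r s g : clockwise p q r s -> crossing (seg p r) g ->
  ~~ crossing (seg p q) g -> ~~ crossing (seg q r) g ->
  ~~ crossing (seg r s) g -> ~~ crossing (seg p s) g -> g = seg q s.
Proof.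
move=> cw /crossingP[a [b [-> cw']]].
have L p' q' r' s' a' b' : clockwise p' q' r' s' -> clockwise p' a' r' b' ->
   a' != q' -> crossing (seg p' q') (seg a' b') || crossing (seg q' r') (seg a' b').
  rewrite !(clockwise_offset p') => /andP[/andP[q0 qr] rs] /andP[/andP[a0 ar] rb] ne.
  apply/orP; have [lt|lt] := offset_lt p' ne; [left|right]; apply: crossing_cw.
    by apply: (offset_clockwise _ lt (ltn_trans qr rb)); rewrite offset_id.
  exact: (offset_clockwise lt ar rb).
have := L p q r s a b cw cw'; have := L r s p q b a.
rewrite -clockwise_rot -clockwise_rot => /(_ cw); rewrite -clockwise_rot -clockwise_rot => /(_ cw').
rewrite [seg b a]seg_sym [seg s p]seg_sym.
case: (eqVneq a q) => [->|_]; case: (eqVneq b s) => [->|_] //.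
- by move=> /(_ isT) /orP[->|->] ; rewrite ?andbF.
- by move=> _ /(_ isT) /orP[->|->].
- by move=> _ /(_ isT) /orP[->|->].
Qed.

Definition flip T e q s : {set {set V}} := (seg q s |: T :\ e)%SET.

Lemma in_flip T e q s f : (f \in flip T e q s) = (f == seg q s) || (f != e) && (f \in T).
Proof. by rewrite finset.in_setU1 finset.in_setD1. Qed.

Lemma quad_sides T e p q r s : quad T e p q r s ->
  [/\ seg p q \in with_edges T, seg q r \in with_edges T, seg r s \in with_edges T,
   seg p s \in with_edges T & clockwise p q r s].
Proof. by case/and5P => ? ? ? ? /andP[]. Qed.

Lemma quadE T e p q r s : quad T e p q r s -> e = seg p r.
Proof. by case/andP => ? /andP[/eqP]. Qed.

Lemma clockwise_segs p q r s : clockwise p q r s ->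
  [/\ seg p q != seg p r, seg q r != seg p r, seg r s != seg p r & seg p s != seg p r]
  /\ [/\ seg p q != seg q s, seg q r != seg q s, seg r s != seg q s & seg p s != seg q s].
Proof.
move=> cw; have [/negbTE h1 /negbTE h2 /negbTE h3 [/negbTE h4 /negbTE h5 /negbTE h6]] := clockwise_neq cw.
by rewrite !seg_eq !eqxx ?[_ == p]eq_sym ?[r == q]eq_sym ?[s == q]eq_sym ?[s == r]eq_sym ?h1 ?h2 ?h3 ?h4 ?h5 ?h6.
Qed.

Lemma flip_sides T e p q r s : quad T e p q r s ->
  [/\ seg p q \in with_edges (flip T e q s), seg q r \in with_edges (flip T e q s),
   seg r s \in with_edges (flip T e q s) & seg p s \in with_edges (flip T e q s)].
Proof.
move=> h; have [h1 h2 h3 h4 cw] := quad_sides h.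
have [[e1 e2 e3 e4] _] := clockwise_segs cw.
have H f : f != seg p r -> f \in with_edges T -> f \in with_edges (flip T e q s).
  by rewrite (quadE h) !with_edgesE in_flip => -> /orP[] ->; rewrite ?orbT.
by split; apply: H.
Qed.

(** A diagonal compatible with the flipped set either does not cross [e], and is in
[T], or crosses [e] and none of the sides, and is the new diagonal. *)
Lemma flip_complete T e p q r s : complete_triangulation T -> e \in T ->
  quad T e p q r s -> complete_triangulation (flip T e q s).
Proof.
move=> /completeP[pT mx] eT qd; have Ee := quadE qd.
have [h1 h2 h3 h4 cw] := quad_sides qd.
have [k1 k2 k3 k4] := flip_sides qd.
have [hd hn] := ptriP _ pT.
have dqs : diagonal (seg q s) by case/andP: (clockwise_diag cw).
have cross_qs f : diagonal f -> crossing (seg q s) f -> ~~ crossing (seg p q) f ->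
    ~~ crossing (seg q r) f -> ~~ crossing (seg r s) f -> ~~ crossing (seg p s) f -> f = e.
  move=> df c n1 n2 n3 n4; rewrite Ee [seg p r]seg_sym.
  rewrite [seg p s]seg_sym in n4; rewrite [seg p q]seg_sym in n1.
  by apply: (quad_crossing _ c n2 n3 n4 n1); rewrite -clockwise_rot.
have nc f g : f \in with_edges T -> g \in T -> ~~ crossing f g.
  by move=> hf hg; apply: (chart_noncrossing pT) => //; rewrite with_edgesE hg.
have pF : partial_triangulation (flip T e q s).
  have nqs f : f \in T -> f != e -> ~~ crossing (seg q s) f.
    move=> fT fe; apply/negP => c; case/eqP: fe.
    by apply: cross_qs => //; [apply: hd|apply: nc..].
  apply/ptriP; split=> [f|f g]; rewrite ?in_flip.
    by case/orP => [/eqP->//|/andP[_]]; apply: hd.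
  case/orP => [/eqP->|/andP[fe fT]]; case/orP => [/eqP->|/andP[ge gT]].
  - exact: crossing_self.
  - exact: nqs.
  - by rewrite crossing_sym nqs.
  - exact: hn.
apply/completeP; split=> // g dg ncg.
have ncg' f : f \in with_edges (flip T e q s) -> ~~ crossing f g.
  rewrite with_edgesE => /orP[fF|/edge_crossing //].
  by rewrite crossing_sym; apply: ncg.
have [c|c] := boolP (crossing e g).
  rewrite Ee in c; have -> : g = seg q s by apply: (quad_crossing cw c); apply: ncg'.
  by rewrite setU11.
have gT : g \in T.
  apply: (mx _ dg) => f fT; have [->|fe] := eqVneq f e; first by rewrite crossing_sym.
  by apply: ncg; rewrite in_flip fe fT orbT.
have [Eg|ge] := eqVneq g e; last by rewrite ?in_flip ge gT orbT.
have := ncg' (seg q s); rewrite Eg Ee with_edgesE in_flip eqxx => /(_ isT).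
by rewrite crossing_sym clockwise_crossing.
Qed.

Definition ncross T e := #|[set f in T | crossing e f]%SET|.

Lemma in_crossers T e g : (g \in [set f in T | crossing e f]%SET) = (g \in T) && crossing e g.
Proof. by rewrite finset.in_set. Qed.

Lemma ncross0 T e : ncross T e = 0%N -> forall f, f \in T -> ~~ crossing e f.
Proof.
move=> /eqP; rewrite cards_eq0 => /eqP h f fT; apply/negP => c.
by have : f \in (finset.set0 : {set {set V}}); [rewrite -h in_crossers fT | rewrite finset.in_set0].
Qed.

Lemma ncross_gt0 T e : (0 < ncross T e)%N -> exists2 f, f \in T & crossing e f.
Proof. by case/card_gt0P => f; rewrite in_crossers => /andP[]; exists f. Qed.

Lemma crossing_share x y z : ~~ crossing (seg x y) (seg y z).
Proof. rewrite crossing_seg /clockwise; lia. Qed.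

(** A diagonal of [T] that crosses the side [aa'] cannot cross [a'b'], and leaves the
region between [aa'], [ab] and [a'b'] through [ab].  The inequality is strict because
[a'b'] itself crosses [ab] but not [aa']. *)
Lemma ncross_side T a b a' b' : partial_triangulation T -> clockwise a a' b b' ->
  seg a' b' \in T -> (ncross T (seg a a') < ncross T (seg a b))%N.
Proof.
move=> pT cw fT; apply: proper_card; apply/properP; split.
  apply/fintype.subsetP => g; rewrite !in_crossers => /andP[gT c]; rewrite gT andTb.
  have [s [t [Eg cw']]] := crossingP c; subst g.
  have := (ptriP _ pT).2 _ _ fT gT; apply: contraR => nc.
  move: cw cw'; rewrite !(clockwise_offset a) => /andP[/andP[a0 ab] bb] /andP[/andP[s0 sa] at'].
  have [lt|le] := ltnP (offset a t) (offset a b').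
    by apply: crossing_cw'; rewrite -clockwise_rot; exact: (offset_clockwise sa at' lt).
  case/negP: nc; apply: crossing_cw; apply: (@offset_clockwise a); rewrite ?offset_id //.
    exact: ltn_trans ab.
  exact: leq_trans le.
exists (seg a' b'); rewrite in_crossers fT /=; first exact: clockwise_crossing.
exact: crossing_share.
Qed.

Lemma ncross_side' T a b a' b' : partial_triangulation T -> clockwise a a' b b' ->
  seg a' b' \in T -> (ncross T (seg a b') < ncross T (seg a b))%N.
Proof.
move=> pT cw fT; apply: proper_card; apply/properP; split.
  apply/fintype.subsetP => g; rewrite !in_crossers => /andP[gT c]; rewrite gT andTb.
  have [s [t [Eg cw']]] := crossingP c; subst g.
  have := (ptriP _ pT).2 _ _ fT gT; apply: contraR => nc.
  move: cw cw'; rewrite !(clockwise_offset a) => /andP[/andP[a0 ab] bb] /andP[/andP[s0 sb] bt].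
  have [lt|le] := ltnP (offset a a') (offset a s).
    by apply: crossing_cw; apply: offset_clockwise lt sb bt.
  case/negP: nc; apply: crossing_cw; apply: (@offset_clockwise a); rewrite ?offset_id //.
    exact: leq_ltn_trans ab.
  exact: ltn_trans bt.
exists (seg a' b'); rewrite in_crossers fT /=; first exact: clockwise_crossing.
by rewrite [seg a' b']seg_sym crossing_share.
Qed.

Lemma ncross_sides T a b f : partial_triangulation T -> f \in T -> crossing (seg a b) f ->
  exists a' b', [/\ f = seg a' b', clockwise a a' b b' &
   [/\ (ncross T (seg a a') < ncross T (seg a b))%N, (ncross T (seg a' b) < ncross T (seg a b))%N,
   (ncross T (seg b b') < ncross T (seg a b))%N & (ncross T (seg a b') < ncross T (seg a b))%N]].
Proof.
move=> pT fT /crossingP[s [t [Ef cw]]]; subst f; exists s, t; split=> //.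
have cw2 : clockwise b t a s by rewrite -clockwise_rot -clockwise_rot.
have fT' : seg t s \in T by rewrite seg_sym.
split.
- exact: ncross_side cw fT.
- by rewrite [seg s b]seg_sym [seg a b]seg_sym; apply: ncross_side' cw2 fT'.
- by rewrite [seg a b]seg_sym; apply: ncross_side cw2 fT'.
- exact: ncross_side' cw fT.
Qed.

End Triangulations.

(** * Connectedness under flips *)

Section FlipConnected.
Variable n : nat.
Notation V := 'I_n.+3.
Implicit Types (i j k l a b p q r s x y : V) (e f g : {set V}) (T S : {set {set V}}).

Lemma cyc3_ordS a b : diagonal (seg a b) -> cyc3 a (ordS a) b.
Proof.
rewrite diag_seg /cyc3 ordS_val; have := ltn_ord a; have := ltn_ord b.
by case: ifP => /eqP; lia.
Qed.

Lemma clockwise_cyc3 a p b q : clockwise a p b q -> cyc3 p b q.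
Proof. rewrite /cyc3 /clockwise; lia. Qed.

(** Let [p] be the last neighbour of [a] before [b].  The triangle on the side of
[pa] facing [b] has its third side [pq] across [ab]; the flip of [pq] ends in [a],
hence does not cross [ab]. *)
Lemma flip_toward T a b : complete_triangulation T -> diagonal (seg a b) ->
  seg a b \notin T -> exists e p q r s, [/\ e \in T, crossing (seg a b) e,
    quad T e p q r s & (ncross (flip T e q s) (seg a b) < ncross T (seg a b))%N].
Proof.
move=> cT dab nT; have [pT mx] := (completeP T).1 cT.
have nT' : seg a b \notin with_edges T.
  by rewrite with_edgesE negb_or nT; move: dab; rewrite diagonalE => /andP[].
have P0 : cyc3 a (ordS a) b && (seg a (ordS a) \in with_edges T).
  by rewrite cyc3_ordS // with_edgesE edge_seg eqxx orbT.
case: (@arg_maxnP _ (ordS a) (fun p => cyc3 a p b && (seg a p \in with_edges T)) (offset a) P0)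
  => p /andP[c3 ap] mp.
have c3' : cyc3 p b a by rewrite -cyc3_rot.
have pa : seg p a \in with_edges T by rewrite seg_sym.
have [q [cq pq qa]] := triangle_exists cT pa c3'.
have nqb : q != b by apply: contra nT' => /eqP <-; rewrite seg_sym.
move: (cq) (c3); rewrite cyc3_rot cyc3_rot !cyc3_offset => /andP[p0 pq0] /andP[_ pb0].
have bq : (offset a b < offset a q)%N.
  have [lt|//] := offset_lt a nqb.
  have := mp q; rewrite cyc3_offset (ltn_trans p0 pq0) lt seg_sym qa => /(_ isT) h.
  by have := leq_ltn_trans h pq0; rewrite ltnn.
have cw : clockwise a p b q by rewrite clockwise_offset p0 pb0.
have crab := clockwise_crossing cw.
have pqT : seg p q \in T.
  move: pq; rewrite with_edgesE => /orP[//|/edge_crossing h].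
  by have := h (seg a b); rewrite crossing_sym crab.
have [|x [cx px xq]] := triangle_exists (x := b) cT pq.
  exact: clockwise_cyc3 cw.
have cwx : clockwise p x q a by apply: clockwise3 => //; rewrite -cyc3_rot.
exists (seg p q), p, x, q, a; split=> //.
  by rewrite /quad cwx eqxx px xq qa pa.
apply: proper_card; apply/properP; split.
  apply/fintype.subsetP => g; rewrite !in_crossers in_flip => /andP[/orP[/eqP->|/andP[_ gT]] c].
    by move: c; rewrite crossing_sym [seg x a]seg_sym [seg a x]seg_sym (negbTE (crossing_share _ _ _)).
  by apply/andP; split.
exists (seg p q); rewrite in_crossers; first by rewrite pqT.
have [[_ _ _ _] [_ _ _ _]] := clockwise_segs cwx.
have ne : seg p q != seg x a.
  have [/negbTE h1 _ /negbTE h2 _] := clockwise_neq cwx.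
  by rewrite seg_eq h1 h2.
by rewrite in_flip (negbTE ne) eqxx.
Qed.

(** The diagonals of [T'] are reached one after the other by [flip_toward].  Only
diagonals crossing some element of [T'] are flipped, so those of [S] are kept. *)
Lemma flip_connected (P : {set {set V}} -> Prop) S :
  (forall T e p q r s, complete_triangulation T -> S \subset T -> e \in T -> e \notin S ->
     quad T e p q r s -> P T -> P (flip T e q s)) ->
  forall T T', complete_triangulation T -> complete_triangulation T' ->
  S \subset T -> S \subset T' -> P T -> P T'.
Proof.
move=> step T T' cT cT' + ST'; move: {2}#|_|.+1 (ltnSn #|T' :\: T|%SET) => c.
have [pT' mx'] := (completeP T').1 cT'.
elim: c T cT => // c IH T cT lt ST PT.
have [h|/fintype.subsetPn[e eT' eT]] := boolP (T' \subset T).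
  suff <- : T = T' by [].
  by case/maxsetP: cT' => _; apply=> //; exact: complete_partial.
have de : diagonal e by apply: (ptriP _ pT').1.
have [a [b [_ _ Ee]]] := segP (diag_card de).
have in1 (k : nat) T1 : complete_triangulation T1 -> S \subset T1 -> P T1 ->
    T :&: T' \subset T1 -> (ncross T1 e < k)%N ->
    exists T2, [/\ complete_triangulation T2, S \subset T2, P T2, (T :&: T')%SET \subset T2 & e \in T2].
  elim: k T1 => // k IHk T1 cT1 ST1 PT1 sub1 ltk.
  have [eT1|eT1] := boolP (e \in T1); first by exists T1.
  have [f [p [q [r [s [fT1 cr qd lt1]]]]]] : exists f p q r s, [/\ f \in T1,
      crossing (seg a b) f, quad T1 f p q r s
      & (ncross (flip T1 f q s) (seg a b) < ncross T1 (seg a b))%N].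
    by apply: flip_toward => //; rewrite -Ee.
  have fT' : f \notin T'.
    by apply/negP => fT'; have := (ptriP _ pT').2 _ _ eT' fT'; rewrite Ee cr.
  have keep g : g \in T1 -> g \in T' -> g \in flip T1 f q s.
    move=> g1 g2; rewrite in_flip g1 andbT; apply/orP; right.
    by apply: contraNneq fT' => <-.
  apply: (IHk (flip T1 f q s)).
  - exact: flip_complete qd.
  - by apply/fintype.subsetP => g gS; apply: keep; [apply: (fintype.subsetP ST1)|apply: (fintype.subsetP ST')].
  - apply: (step T1 f p q r s) => //; apply: contra fT' => ?; exact: (fintype.subsetP ST').
  - apply/fintype.subsetP => g gS; apply: keep; first exact: (fintype.subsetP sub1).
    by move: gS; rewrite finset.in_setI => /andP[].
  - by rewrite Ee; apply: leq_trans lt1 _; rewrite -Ee.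
have [|T2 [cT2 ST2 PT2 sub2 eT2]] := in1 _ T cT ST PT _ (ltnSn _).
  exact: finset.subsetIl.
apply: (IH T2) => //; rewrite -ltnS; apply: leq_trans lt; rewrite ltnS.
apply: proper_card; apply/properP; split.
  apply/fintype.subsetP => g; rewrite !finset.in_setD => /andP[g2 gT']; rewrite gT' andbT.
  by apply: contra g2 => gT; apply: (fintype.subsetP sub2); rewrite finset.in_setI gT.
by exists e; rewrite finset.in_setD ?eT ?eT2.
Qed.

End FlipConnected.

(** * Laurent expansions in a chart *)

Section Laurent.
Variables (n : nat) (K : fieldType) (A : {set 'I_n.+3} -> K).
Hypothesis hA : Atilde_functions A.
Notation V := 'I_n.+3.
Notation exps := {ffun {set V} -> int}.
Implicit Types (i j k l a b p q r s x y : V) (e f g : {set V}) (m : exps)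
  (T : {set {set V}}) (L : seq (int * exps)).

Lemma partial0 : partial_triangulation (finset.set0 : {set {set V}}).
Proof. by apply/ptriP; split=> [e|e f]; rewrite finset.in_set0. Qed.

Lemma partial1 e : diagonal e -> partial_triangulation [set e]%SET.
Proof.
move=> de; apply/ptriP; split=> [f|f g]; rewrite !finset.in_set1.
  by move=> /eqP->.
by move=> /eqP-> /eqP->; apply: crossing_self.
Qed.

Lemma segment_in_chart e : #|e| == 2%N ->
  exists2 T, complete_triangulation T & e \in with_edges T.
Proof.
move=> ce; have [ee|ee] := boolP (edge e).
  have [T cT _] := extend_complete partial0.
  by exists T => //; rewrite with_edgesE ee orbT.
have de : diagonal e by rewrite diagonalE ce ee.
have [T cT /fintype.subsetP sT] := extend_complete (partial1 de).
by exists T => //; rewrite with_edgesE sT // finset.in_set1.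
Qed.

Lemma A_neq0 e : #|e| == 2%N -> A e != 0.
Proof.
move=> /segment_in_chart[T cT eT]; have [inj _] := hA.2 T cT.
apply/eqP => Ae0.
have [i ei] : exists i : 'I_#|with_edges T|, enum_val i = e.
  by exists (enum_rank_in eT e); rewrite enum_rankK_in.
have : ('X_i : {mpoly int[#|with_edges T|]}) = 0.
  by apply: inj; rewrite mmapX mmap1U ei.
by move/(congr1 (mcoeff U_(i))); rewrite mcoeffX eqxx mcoeff0.
Qed.

Definition mon m : K := \prod_(e : {set V} | #|e| == 2%N) A e ^ m e.

Lemma monD m1 m2 : mon (m1 + m2) = mon m1 * mon m2.
Proof.
rewrite /mon -big_split /=; apply: eq_bigr => e ce.
by rewrite ffunE expfzDr // A_neq0.
Qed.

Lemma mon0 : mon 0 = 1.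
Proof. by rewrite /mon big1 // => e _; rewrite ffunE expr0z. Qed.

Lemma mon_neq0 m : mon m != 0.
Proof. by apply/prodf_neq0 => e ce; rewrite expfz_eq0 negb_and A_neq0 // orbT. Qed.

Lemma monN m : mon (- m) = (mon m)^-1.
Proof.
by apply: (mulfI (mon_neq0 m)); rewrite -monD subrr mon0 divff ?mon_neq0.
Qed.

Lemma monMz m (k : int) : mon (m *~ k) = mon m ^ k.
Proof.
have nat_case (c : nat) : mon (m *+ c) = mon m ^+ c.
  by elim: c => [|c IH]; rewrite ?mulr0n ?mon0 // mulrS exprS monD // IH.
case: k => c; first by rewrite -pmulrn nat_case.
have -> : m *~ Negz c = - (m *+ c.+1) by [].
by rewrite monN // nat_case.
Qed.

Lemma mon_delta e : #|e| == 2%N -> mon (delta e) = A e.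
Proof.
move=> ce; rewrite /mon (bigD1 e) //= big1 ?mulr1.
  by rewrite ffunE eqxx expr1z.
by move=> f /andP[_ /negbTE fe]; rewrite ffunE fe expr0z.
Qed.

Definition tsup T m := forall e, e \notin with_edges T -> m e = 0.

Lemma tsup_onseg T m : partial_triangulation T -> tsup T m -> onseg m.
Proof. by move=> pT h e ce; apply: h; apply: contra ce; apply: chart_card. Qed.

Lemma tsupD T m1 m2 : tsup T m1 -> tsup T m2 -> tsup T (m1 + m2).
Proof. by move=> h1 h2 e he; rewrite ffunE h1 // h2. Qed.

Lemma tsupN T m : tsup T m -> tsup T (- m).
Proof. by move=> h e he; rewrite ffunE h // oppr0. Qed.

Lemma tsupB T m1 m2 : tsup T m1 -> tsup T m2 -> tsup T (m1 - m2).
Proof. by move=> h1 h2; apply: tsupD => //; apply: tsupN. Qed.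

Lemma tsup0 T : tsup T 0.
Proof. by move=> e _; rewrite ffunE. Qed.

Lemma tsup_delta T e : e \in with_edges T -> tsup T (delta e).
Proof. by move=> eT f fT; rewrite ffunE; case: eqP fT => // ->; rewrite eT. Qed.

Lemma mon_tsup T m : partial_triangulation T -> tsup T m ->
  mon m = \prod_(e in with_edges T) A e ^ m e.
Proof.
move=> pT h; rewrite /mon [LHS]big_mkcond [RHS]big_mkcond; apply: eq_bigr => e _.
have [eT|eT] := boolP (e \in _); first by rewrite (chart_card pT eT).
by rewrite h // expr0z; case: ifP.
Qed.

(** The list entry [(c, m)] is the term with coefficient [c] and exponents [m]. *)
Definition lsum L : K := \sum_(t <- L) t.1%:~R * mon t.2.
Definition lco L m : int := \sum_(t <- L | t.2 == m) t.1.
Definition lsup T L := forall t, t \in L -> tsup T t.2.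

Lemma absz_shift (x y : int) (B : nat) : - B%:Z <= x -> - B%:Z <= y ->
  absz (x + B%:Z)%R = absz (y + B%:Z)%R -> x = y.
Proof. lia. Qed.

(** Multiplying by a large monomial in the chart variables turns the relation into a
polynomial one. *)
Lemma lsum_indep T L m : complete_triangulation T -> lsup T L ->
  lsum L = 0 -> lco L m = 0.
Proof.
move=> cT sL L0; have pT := complete_partial cT.
have [inj _] := hA.2 T cT.
have [/hasP[t0 t0L /eqP Em]|/hasPn nm] := boolP (has (fun t => t.2 == m) L); last first.
  by rewrite /lco big_seq_cond big1 // => t /andP[/nm /negbTE ->].
(* All exponents become natural numbers after adding B. *)
pose B := (\sum_(t <- L) \sum_e absz (t.2 e))%N.
have hB t e : t \in L -> - B%:Z <= t.2 e.
  move=> tL; suff : (absz (t.2 e) <= B)%N by lia.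
  rewrite /B (big_rem t) //= (bigD1 e) //= -addnA; exact: leq_addr.
set k := #|with_edges T|.
pose h0 (i : 'I_#|with_edges T|) := A (enum_val i).
pose mn m := [multinom absz (m (enum_val (i : 'I_#|with_edges T|)) + B%:Z)%R | i < k].
pose P : {mpoly int[k]} := \sum_(t <- L) t.1 *: 'X_[mn t.2].
have mnE t : t \in L -> mmap1 h0 (mn t.2)
    = mon t.2 * \prod_(e in with_edges T) A e ^+ B.
  move=> tL; rewrite (mon_tsup pT (sL _ tL)) -big_split /= big_enum_val /mmap1.
  apply: eq_bigr => i _; rewrite mnmE /h0 !exprnP -expfzDr; last first.
    by apply: A_neq0; apply: chart_card pT _; exact: enum_valP.
  by rewrite gez0_abs // -[X in _ + X]opprK subr_ge0; exact: hB.
have P0 : P = 0.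
  apply: inj; rewrite /P raddf_sum /=.
  have -> : \sum_(t <- L) mmap intr h0 (t.1 *: 'X_[mn t.2])
    = lsum L * \prod_(e in with_edges T) A e ^+ B.
    rewrite /lsum mulr_suml; apply: eq_big_seq => t tL.
    by rewrite mmapZ mmapX mnE // mulrA.
  by rewrite L0 mul0r.
have := mcoeff0 int (mn m); rewrite -P0 /P raddf_sum /= => h.
rewrite -[RHS]h /lco big_mkcond; apply: eq_big_seq => t tL.
rewrite mcoeffZ mcoeffX; have [->|ne] := eqVneq t.2 m; first by rewrite eqxx mulr1.
suff /negbTE -> : mn t.2 != mn m by rewrite mulr0.
apply: contra ne => /eqP e; apply/eqP/ffunP => f.
have [fT|fT] := boolP (f \in with_edges T); last by rewrite (sL _ tL) // -Em (sL _ t0L).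
have := congr1 (fun M : 'X_{1..k} => M (enum_rank_in fT f)) e.
rewrite !mnmE enum_rankK_in // => e'.
by apply: (absz_shift (hB t f tL) _ e'); rewrite -Em; exact: hB.
Qed.

Lemma lsum_cat L1 L2 : lsum (L1 ++ L2) = lsum L1 + lsum L2.
Proof. by rewrite /lsum big_cat. Qed.

Lemma lco_cat L1 L2 m : lco (L1 ++ L2) m = lco L1 m + lco L2 m.
Proof. by rewrite /lco big_cat. Qed.

Lemma lsup_cat T L1 L2 : lsup T L1 -> lsup T L2 -> lsup T (L1 ++ L2).
Proof. by move=> h1 h2 t; rewrite mem_cat => /orP[/h1|/h2]. Qed.

Definition lscale (c : int) L := [seq (c * t.1, t.2) | t <- L].

Lemma lsum_scale c L : lsum (lscale c L) = c%:~R * lsum L.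
Proof.
rewrite /lsum big_map mulr_sumr; apply: eq_bigr => t _.
by rewrite /= intrM mulrA.
Qed.

Lemma lco_scale c L m : lco (lscale c L) m = c * lco L m.
Proof. by rewrite /lco big_map mulr_sumr. Qed.

Lemma lsup_scale T c L : lsup T L -> lsup T (lscale c L).
Proof. by move=> h t /mapP[u uL ->]; exact: (h u uL). Qed.

Lemma lsum_inj T L1 L2 : complete_triangulation T -> lsup T L1 -> lsup T L2 ->
  lsum L1 = lsum L2 -> lco L1 =1 lco L2.
Proof.
move=> cT s1 s2 e m.
have := @lsum_indep T (L1 ++ lscale (-1) L2) m cT (lsup_cat s1 (@lsup_scale T (-1) L2 s2)).
rewrite lsum_cat lsum_scale e mulN1r subrr => /(_ erefl).
by rewrite lco_cat lco_scale mulN1r => /subr0_eq.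
Qed.

Lemma lsumE L (U : seq exps) : uniq U -> {subset [seq t.2 | t <- L] <= U} ->
  lsum L = \sum_(m <- U) (lco L m)%:~R * mon m.
Proof.
move=> uU sub; rewrite /lsum /lco.
under [RHS]eq_bigr do rewrite rmorph_sum mulr_suml /=.
rewrite (exchange_big_dep predT) //=; apply: eq_big_seq => t tL.
under eq_bigl do rewrite eq_sym.
have tU : t.2 \in U by apply: sub; apply: map_f.
by rewrite -big_filter filter_pred1_uniq // big_seq1.
Qed.

End Laurent.

(** * Subtraction-free expansions *)

Section Expansions.
Variables (n : nat) (K : fieldType) (A : {set 'I_n.+3} -> K).
Hypothesis hA : Atilde_functions A.
Notation V := 'I_n.+3.
Notation exps := {ffun {set V} -> int}.
Implicit Types (i j k l a b p q r s x y : V) (e f g : {set V}) (m : exps)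
  (T : {set {set V}}) (L : seq (int * exps)) (M : seq exps).
Notation mon := (mon A).
Notation lsum := (lsum A).

Definition msum M : K := \sum_(m <- M) mon m.

Lemma msum_cat M1 M2 : msum (M1 ++ M2) = msum M1 + msum M2.
Proof. by rewrite /msum big_cat. Qed.

Lemma msum1 m : msum [:: m] = mon m.
Proof. by rewrite /msum big_seq1. Qed.

Definition msums M1 M2 := [seq m1 + m2 | m1 <- M1, m2 <- M2].

Lemma msum_mul M1 M2 : msum (msums M1 M2) = msum M1 * msum M2.
Proof.
rewrite /msum /msums big_flatten big_map mulr_suml; apply: eq_bigr => m1 _.
by rewrite big_map mulr_sumr; apply: eq_bigr => m2 _; rewrite monD.
Qed.

Definition ones M : seq (int * exps) := [seq (1, m) | m <- M].

Lemma lsum_ones M : lsum (ones M) = msum M.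
Proof. by rewrite /lsum big_map; apply: eq_bigr => m _; rewrite mul1r. Qed.

Lemma lco_ones M m : lco (ones M) m = count_mem m M.
Proof.
rewrite /lco big_map; elim: M => [|u M IH]; first by rewrite big_nil.
by rewrite big_cons IH /=; case: (u == m).
Qed.

Lemma dom_sub m1 m2 : dom m1 m2 <-> dom 0 (m2 - m1).
Proof.
split=> h.
  by have := domD h (dom_refl (- m1)); rewrite subrr.
by have := domD h (dom_refl m1); rewrite add0r subrK.
Qed.

(** The terms lie below [m] for [dom]; this plays the role of a leading term
condition, uniformly in the charts. *)
Definition expands T m := exists M, mon m = msum M
  /\ forall m', m' \in M -> tsup T m' /\ dom m' m.

Lemma expandsD T m1 m2 : expands T m1 -> expands T m2 -> expands T (m1 + m2).
Proof.
move=> [M1 [e1 h1]] [M2 [e2 h2]]; exists (msums M1 M2).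
split; first by rewrite monD // e1 e2 msum_mul.
move=> m' /allpairsP[[u v] /= [/h1[u1 u2] /h2[v1 v2] ->]].
by split; [apply: tsupD|apply: domD].
Qed.

Lemma expands_tsup T m : tsup T m -> expands T m.
Proof.
move=> h; exists [:: m]; split; first by rewrite msum1.
by move=> m'; rewrite mem_seq1 => /eqP->; split.
Qed.

(** If a diagonal [f] of [T] crosses [ab], then the Pluecker relation, divided by the
chart variable [A f], expresses [A (seg a b)] by segments with fewer crossings. *)
Lemma expands_seg T e : complete_triangulation T -> #|e| == 2%N -> expands T (delta e).
Proof.
move=> cT; have [pT mx] := (completeP T).1 cT.
move: {2}(ncross T e).+1 (ltnSn (ncross T e)) => c; elim: c e => // c IH e ltc ce.
have [eT|eT] := boolP (e \in with_edges T).
  by apply: expands_tsup; apply: tsup_delta.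
have [a [b [_ _ Ee]]] := segP ce; subst e.
have [eT1 ee] : seg a b \notin T /\ ~~ edge (seg a b).
  by apply/andP; rewrite -negb_or -with_edgesE.
have dab : diagonal (seg a b) by rewrite diagonalE ce ee.
have : ncross T (seg a b) != 0%N.
  by apply: contra eT1 => /eqP /ncross0; apply: mx.
rewrite -lt0n => /ncross_gt0[f fT cf].
have [a' [b' [Ef cw [n1 n2 n3 n4]]]] := ncross_sides pT fT cf; subst f.
have [na1 na2 na3 [na4 na5 na6]] := clockwise_neq cw.
have fT' : seg a' b' \in with_edges T by rewrite with_edgesE fT.
have cf' : #|seg a' b'| == 2%N by rewrite card_seg.
have X1 : expands T (delta (seg a a')) by apply: IH; [exact: leq_trans n1 _|rewrite card_seg].
have X2 : expands T (delta (seg b b')) by apply: IH; [exact: leq_trans n3 _|rewrite card_seg].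
have X3 : expands T (delta (seg a b')) by apply: IH; [exact: leq_trans n4 _|rewrite card_seg].
have X4 : expands T (delta (seg a' b)) by apply: IH; [exact: leq_trans n2 _|rewrite card_seg].
have Xf : expands T (- delta (seg a' b')) by apply: expands_tsup; apply: tsupN; apply: tsup_delta.
have [M1 [e1 h1]] := expandsD (expandsD X1 X2) Xf.
have [M2 [e2 h2]] := expandsD (expandsD X3 X4) Xf.
exists (M1 ++ M2); split.
  rewrite msum_cat -e1 -e2 !monD // !monN // !mon_delta ?card_seg // -mulrDl.
  by rewrite -(hA.1 _ _ _ _ cw) mulfK // A_neq0.
move=> m'; rewrite mem_cat => /orP[/h1|/h2] [t d]; split=> //; apply: dom_trans d _.
  apply/dom_sub; have := dom_resol cw; congr (dom 0 _).
  by apply/ffunP => g; rewrite !ffunE; ring.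
have cw' : clockwise a' b b' a by rewrite -clockwise_rot.
apply/dom_sub; have := dom_resol cw'; congr (dom 0 _).
by rewrite /resol [seg b a]seg_sym [seg b' a]seg_sym; apply/ffunP => g; rewrite !ffunE; ring.
Qed.

Lemma exps_decomp m : m = \sum_e delta e *~ m e.
Proof.
apply/ffunP => f; rewrite sum_ffunE (bigD1 f) //= big1 ?addr0 => [|e /negbTE ne].
  by rewrite exps_mulz ffunE eqxx mul1r.
by rewrite exps_mulz ffunE eq_sym ne mul0r.
Qed.

Lemma expands_chart T m : complete_triangulation T -> onseg m ->
  (forall e, e \notin with_edges T -> 0 <= m e) -> expands T m.
Proof.
move=> cT sm hm; rewrite [m]exps_decomp.
apply: (big_ind (expands T)) => [|m1 m2|e _]; [exact: expands_tsup (@tsup0 _ _)|exact: expandsD|].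
have exn (u : exps) (k : nat) : expands T u -> expands T (u *+ k).
  move=> h; elim: k => [|k IH]; first by rewrite mulr0n; exact: expands_tsup (@tsup0 _ _).
  by rewrite mulrS; exact: expandsD.
have [eT|eT] := boolP (e \in with_edges T).
  by case: (m e) => k; rewrite ?NegzE ?mulrNz -?mulNrn; apply: exn; apply: expands_tsup;
    [|apply: tsupN]; apply: tsup_delta.
have [ce|ce] := boolP (#|e| == 2%N); last by rewrite sm // mulr0z; exact: expands_tsup (@tsup0 _ _).
have := hm e eT; case: (m e) => k // _; apply: exn; exact: expands_seg.
Qed.

End Expansions.

(** * Resolution into cluster monomials *)

Section Resolution.
Variables (n : nat) (K : fieldType) (A : {set 'I_n.+3} -> K).
Hypothesis hA : Atilde_functions A.
Notation V := 'I_n.+3.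
Notation exps := {ffun {set V} -> int}.
Implicit Types (i j k a b p q r s x y : V) (e f g : {set V}) (m : exps)
  (T : {set {set V}}) (L : seq (int * exps)) (M : seq exps).
Notation mon := (mon A).
Notation lsum := (lsum A).
Notation msum := (msum A).

Lemma onseg_delta e : #|e| == 2%N -> onseg (delta e).
Proof. by move=> ce f; rewrite ffunE; have [->|//] := eqVneq f e; rewrite ce. Qed.

Lemma onsegD m1 m2 : onseg m1 -> onseg m2 -> onseg (m1 + m2).
Proof. by move=> h1 h2 e he; rewrite ffunE h1 // h2. Qed.

Lemma onsegN m : onseg m -> onseg (- m).
Proof. by move=> h1 e he; rewrite ffunE h1 // oppr0. Qed.

Lemma onsegB m1 m2 : onseg m1 -> onseg m2 -> onseg (m1 - m2).
Proof. by move=> h1 h2; apply: onsegD => //; apply: onsegN. Qed.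

Lemma onseg_resol i j k l : clockwise i j k l -> onseg (resol i j k l).
Proof.
move=> /clockwise_neq[? ? ? [? ? ?]].
by apply: onsegB; [apply: onsegB; first apply: onsegD|]; apply: onseg_delta; rewrite card_seg.
Qed.

Lemma mon_plucker i j k l m : clockwise i j k l ->
  mon m = mon (m - resol i j k l) + mon (m - resol j k l i).
Proof.
have H i' j' k' l' : clockwise i' j' k' l' ->
    mon (m - resol i' j' k' l') * (A (seg i' k') * A (seg j' l'))
    = mon m * (A (seg i' j') * A (seg k' l')).
  move=> /clockwise_neq[n1 n2 _ [_ n5 n6]].
  rewrite -!(mon_delta A) ?card_seg ?n1 ?n2 ?n5 ?n6 // -!(monD hA); apply: (congr1 mon).
  by apply/ffunP => e; rewrite !ffunE; ring.
move=> cw; have cw' : clockwise j k l i by rewrite -clockwise_rot.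
have [_ n2 _ [_ n5 _]] := clockwise_neq cw.
have ne0 : A (seg i k) * A (seg j l) != 0 by rewrite mulf_neq0 // A_neq0 // card_seg.
apply: (mulIf ne0); rewrite mulrDl H // [A (seg i k) * _]mulrC [seg i k]seg_sym H //.
by rewrite -mulrDr [seg l i]seg_sym [A (seg j k) * _]mulrC -(hA.1 _ _ _ _ cw) [seg k i]seg_sym mulrC.
Qed.

Lemma resol_ge0 i j k l m f : clockwise i j k l ->
  0 < m (seg i k) -> 0 < m (seg j l) -> 0 <= m f -> 0 <= (m - resol i j k l) f.
Proof.
move=> cw h1 h2 h3; rewrite !ffunE.
have ne : seg i k != seg j l.
  have [/negbTE n1 _ /negbTE n3 _] := clockwise_neq cw.
  by rewrite seg_eq n1 n3.
have [E|_] := eqVneq f (seg i k).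
  rewrite -E in h1 ne; rewrite (negbTE ne); move: (m f) h1; clear => z.
  by case: (f == _); case: (f == _) => /=; lia.
have [E|_] := eqVneq f (seg j l).
  by rewrite -E in h2; move: (m f) h2; clear => z; case: (f == _); case: (f == _) => /=; lia.
by move: (m f) h3; clear => z; case: (f == _); case: (f == _) => /=; lia.
Qed.

(** A single integer that decreases under resolutions. *)
Definition tot m : int := \sum_a \sum_b cut a b m.

Lemma totB m1 m2 : tot (m1 - m2) = tot m1 - tot m2.
Proof.
rewrite /tot -sumrB; apply: eq_bigr => a _; rewrite -sumrB.
by apply: eq_bigr => b _; rewrite cutB.
Qed.

Lemma tot_dom m1 m2 : dom m1 m2 -> tot m1 <= tot m2.
Proof. by move=> [h _]; apply: ler_sum => a _; apply: ler_sum => b _. Qed.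

Lemma inarc_quad i j k l : clockwise i j k l -> separates j l i j k l.
Proof. rewrite /clockwise /separates /inarc; lia. Qed.

Lemma tot_resol i j k l : clockwise i j k l -> 0 < tot (resol i j k l).
Proof.
move=> cw; have [h0 _] := dom_resol cw.
rewrite /tot (bigD1 j) //= (bigD1 l) //= cut_resol // inarc_quad //.
have ge0 a b : 0 <= cut a b (resol i j k l) by rewrite -(cut0 a b).
apply: ltr_pwDl; last by apply: sumr_ge0 => a _; apply: sumr_ge0 => b _.
by apply: ltr_pwDl => //; apply: sumr_ge0 => b _.
Qed.

Lemma tot_ge0 m : (forall e, 0 <= m e) -> 0 <= tot m.
Proof.
by move=> h; apply: sumr_ge0 => a _; apply: sumr_ge0 => b _; apply: sumr_ge0 => p _; apply: sumr_ge0.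
Qed.

Lemma crossing_support m : ~ noncrossing_support m ->
  exists i j k l, [/\ clockwise i j k l, 0 < m (seg i k) & 0 < m (seg j l)].
Proof.
move=> h; apply: contrapT => h'; apply: h => e f de df me mf; apply/negP => c; apply: h'.
have [a [b [_ _ Ee]]] := segP (diag_card de); subst e.
have [s [t [Ef cw]]] := crossingP c; subst f.
by exists a, s, b, t.
Qed.

Lemma not_both_separate i j k l a b : clockwise i j k l ->
  ~~ (separates a b i j k l && separates a b j k l i).
Proof.
move=> cw; rewrite /separates.
by case: (inarc a b i); case: (inarc a b j); case: (inarc a b k); case: (inarc a b l).
Qed.

(** Resolutions lower the total cut, which is at least 0 for exponents at least 0.
A given chord is not lowered by both resolutions of a crossing, so one of them keeps
its cut. *)
Lemma resolve_nonneg m : onseg m -> (forall e, 0 <= m e) ->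
  exists M, [/\ mon m = msum M,
    forall m', m' \in M -> [/\ onseg m', (forall e, 0 <= m' e), noncrossing_support m' & dom m' m]
    & forall a b, exists2 m', m' \in M & cut a b m' = cut a b m].
Proof.
move: {2}(absz (tot m)).+1 (ltnSn (absz (tot m))) => c.
elim: c m => // c IH m ltc sm m0.
have [nc|/crossing_support[i [j [k [l [cw h1 h2]]]]]] := pselect (noncrossing_support m).
  exists [:: m]; split=> [|m'|a b]; first by rewrite msum1.
    by rewrite mem_seq1 => /eqP->.
  by exists m; rewrite ?mem_seq1.
have cw' : clockwise j k l i by rewrite -clockwise_rot.
have h1' : 0 < m (seg k i) by rewrite seg_sym.
have t0 := tot_ge0 m0.
have step i' j' k' l' : clockwise i' j' k' l' -> 0 < m (seg i' k') -> 0 < m (seg j' l') ->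
    [/\ (absz (tot (m - resol i' j' k' l'))%R < c)%N, onseg (m - resol i' j' k' l')
      & forall e, 0 <= (m - resol i' j' k' l') e].
  move=> cwi hi hj.
  have ge0 e : 0 <= (m - resol i' j' k' l') e by apply: resol_ge0.
  split=> //; last by apply: onsegB => //; apply: onseg_resol.
  have := tot_ge0 ge0; have := tot_resol cwi; rewrite totB; move: ltc t0.
  by clear; lia.
have [lt1 s1 g1] := step _ _ _ _ cw h1 h2.
have [lt2 s2 g2] := step _ _ _ _ cw' h2 h1'.
have [M1 [e1 p1 q1]] := IH _ lt1 s1 g1.
have [M2 [e2 p2 q2]] := IH _ lt2 s2 g2.
have d1 : dom (m - resol i j k l) m by apply/dom_sub; rewrite opprB addrC subrK; exact: dom_resol.
have d2 : dom (m - resol j k l i) m by apply/dom_sub; rewrite opprB addrC subrK; exact: dom_resol.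
exists (M1 ++ M2); split.
- by rewrite msum_cat -e1 -e2 -mon_plucker.
- move=> m'; rewrite mem_cat => /orP[/p1|/p2] [? ? ? d]; split=> //.
    exact: dom_trans d1.
  exact: dom_trans d2.
- move=> a b; case sep : (separates a b i j k l).
    have [m' mM Em] := q2 a b; exists m'; first by rewrite mem_cat mM orbT.
    rewrite Em cutB cut_resol //; have := not_both_separate a b cw; rewrite sep /= => /negbTE ->.
    by rewrite mulr0 subr0.
  have [m' mM Em] := q1 a b; exists m'; first by rewrite mem_cat mM.
  by rewrite Em cutB cut_resol // sep mulr0 subr0.
Qed.

Lemma diag_not_edge e : diagonal e -> edge e = false.
Proof. by rewrite diagonalE => /andP[_ /negbTE]. Qed.

(** Only diagonals cross, so the exponents on edges can be set aside. *)
Lemma resolve m : onseg m -> pos m ->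
  exists M, [/\ mon m = msum M, forall l : exps, l \in M -> lam l /\ dom l m
    & forall a b, exists2 l : exps, l \in M & cut a b l = cut a b m].
Proof.
move=> sm pm; pose mE : exps := [ffun e => if edge e then m e else 0].
have sE : onseg mE.
  by move=> e ce; rewrite ffunE; case: ifP => // /edge_card h; rewrite h in ce.
have [|e|M [e1 h1 h2]] := @resolve_nonneg (m - mE); first exact: onsegB.
  rewrite !ffunE; case: ifP => [_|ne]; first by rewrite subrr.
  have [ce|ce] := boolP (#|e| == 2%N); last by rewrite sm.
  by rewrite subr0 pm // diagonalE ce ne.
exists [seq l + mE | l <- M]; split.
- rewrite -[m in LHS](subrK mE) monD // e1 /msum mulr_suml big_map.
  by apply: eq_bigr => l _; rewrite monD.
- move=> l /mapP[l' /h1[s1 p1 n1 d1] ->]; split; last first.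
    by rewrite -[m](subrK mE); apply: domD.
  split; first exact: onsegD.
    by move=> e de; rewrite !ffunE diag_not_edge // addr0 p1.
  by move=> e f de df; rewrite !ffunE !diag_not_edge // !addr0; apply: n1.
- move=> a b; have [l lM El] := h2 a b; exists (l + mE); first exact: map_f.
  by rewrite cutD El -cutD subrK.
Qed.

Lemma lam_chart (l : exps) : lam l -> exists2 T : {set {set V}}, complete_triangulation T & tsup T l.
Proof.
move=> [sl pl nc]; pose S := [set e | diagonal e && (0 < l e)]%SET.
have SE e : (e \in S) = diagonal e && (0 < l e) by rewrite finset.in_set.
have pS : partial_triangulation S.
  apply/ptriP; split=> [e|e f]; rewrite !SE; first by case/andP.
  by move=> /andP[? ?] /andP[? ?]; apply: nc.
have [T cT /fintype.subsetP sT] := extend_complete pS.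
exists T => // e; rewrite with_edgesE negb_or => /andP[eT ee].
have [ce|ce] := boolP (#|e| == 2%N); last by rewrite sl.
have de : diagonal e by rewrite diagonalE ce ee.
apply: contraNeq eT => le; apply: sT; rewrite SE de lt0r le pl //.
Qed.

Definition lamlist L := forall t, t \in L -> lam t.2.

(** The expansion in [T] of another cluster monomial only has terms below it for
[dom]; by [lam_anti] the cluster monomials of [T] are not among them. *)
Lemma lam_coef T L : complete_triangulation T -> lamlist L ->
  exists L', [/\ lsup T L', lsum L' = lsum L
    & forall l : exps, lam l -> tsup T l -> lco L' l = lco L l].
Proof.
move=> cT; elim: L => [|[c l'] L IH] hL.
  by exists [::]; split=> //.
have [t tL|L1 [s1 e1 c1]] := IH; first by apply: hL; rewrite inE tL orbT.
have ll' : lam l' by apply: (hL (c, l')); rewrite mem_head.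
have [||M [eM hM]] := @expands_chart _ _ _ hA T l' cT; first by case: ll'.
  move=> e; rewrite with_edgesE negb_or => /andP[_ ee]; case: ll' => sl pl _.
  have [ce|ce] := boolP (#|e| == 2%N); last by rewrite sl.
  by apply: pl; rewrite diagonalE ce.
have sM : lsup T (ones M) by move=> t /mapP[u /hM[h _] ->].
exists (lscale c (ones M) ++ L1); split.
- by apply: lsup_cat => //; apply: lsup_scale.
- by rewrite lsum_cat lsum_scale lsum_ones -eM e1 /lsum big_cons.
- move=> l lamL tl; rewrite lco_cat lco_scale c1 // lco_ones /lco big_cons /=.
  have [E|ne] := eqVneq l' l; last first.
    rewrite (count_memPn _) ?mulr0 ?add0r //; apply/negP => /hM[_ d].
    by case/eqP: ne; rewrite (lam_anti lamL ll' d).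
  subst l'; congr (_ + _); rewrite -[RHS]mulr1; congr (_ * _).
  have := @lsum_inj _ _ _ hA T (ones M) (ones [:: l]) cT sM.
  rewrite !lsum_ones msum1 -eM => /(_ _ erefl l); rewrite !lco_ones /= eqxx => -> //.
  by move=> t; rewrite mem_seq1 => /eqP->.
Qed.

Lemma lam_indep L (l : exps) : lamlist L -> lsum L = 0 -> lam l -> lco L l = 0.
Proof.
move=> hL L0 ll; have [T cT tl] := lam_chart ll.
have [L' [s' e' c']] := lam_coef cT hL.
by rewrite -c' // (@lsum_indep _ _ _ hA T L' l cT) // e'.
Qed.

Lemma lam_coef_uniq L1 L2 (l : exps) : lamlist L1 -> lamlist L2 -> lsum L1 = lsum L2 ->
  lam l -> lco L1 l = lco L2 l.
Proof.
move=> h1 h2 e ll; have := @lam_indep (L1 ++ lscale (-1) L2) l.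
rewrite lsum_cat lsum_scale e mulN1r subrr lco_cat lco_scale mulN1r => h.
apply/eqP; rewrite -subr_eq0; apply/eqP; apply: h => //.
by move=> t; rewrite mem_cat => /orP[/h1//|/mapP[u /h2 hu ->]].
Qed.

Lemma lamlist_ones M : (forall l : exps, l \in M -> lam l) -> lamlist (ones M).
Proof. by move=> h t /mapP[u /h hu ->]. Qed.

Lemma count_uniq M1 M2 (l : exps) : (forall l : exps, l \in M1 -> lam l) -> (forall l : exps, l \in M2 -> lam l) ->
  msum M1 = msum M2 -> count_mem l M1 = count_mem l M2.
Proof.
move=> h1 h2 e; have [ll|nl] := pselect (lam l); last first.
  have z M : (forall l : exps, l \in M -> lam l) -> count_mem l M = 0%N.
    by move=> h; apply/count_memPn/negP => /h.
  by rewrite !z.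
apply/eqP; rewrite -eqz_nat -!lco_ones; apply/eqP.
by apply: lam_coef_uniq => //; [apply: lamlist_ones|apply: lamlist_ones|rewrite !lsum_ones].
Qed.

(** Follow the resolutions of [dom_step] from [m2] down to [m1]: each step drops one
of two summands, whose multiplicities are at least 0. *)
Lemma count_mono m1 m2 M1 M2 (l : exps) : onseg m1 -> pos m1 -> onseg m2 -> pos m2 -> dom m1 m2 ->
  mon m1 = msum M1 -> mon m2 = msum M2 ->
  (forall l : exps, l \in M1 -> lam l) -> (forall l : exps, l \in M2 -> lam l) ->
  (count_mem l M1 <= count_mem l M2)%N.
Proof.
move: {2}(absz (tot (m2 - m1))%R).+1 (ltnSn (absz (tot (m2 - m1))%R)) => c.
elim: c m2 M2 => // c IH m2 M2 ltc s1 p1 s2 p2 d12 e1 e2 h1 h2.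
have [E|ne] := pselect (m1 = m2).
  by rewrite (@count_uniq M1 M2) // -e1 -e2 E.
have [i [j [k [l' [cw k1 k2 d]]]]] := dom_step s1 s2 p1 d12 ne.
have cw' : clockwise j k l' i by rewrite -clockwise_rot.
have k1' : 0 < m2 (seg k i) by rewrite seg_sym.
have s2' : onseg (m2 - resol i j k l') by apply: onsegB => //; apply: onseg_resol.
have s2'' : onseg (m2 - resol j k l' i) by apply: onsegB => //; apply: onseg_resol.
have p2' : pos (m2 - resol i j k l') by move=> e de; apply: resol_ge0 => //; apply: p2.
have p2'' : pos (m2 - resol j k l' i) by move=> e de; apply: resol_ge0 => //; apply: p2.
have [M2' [e2' h2' _]] := resolve s2' p2'.
have [M2'' [e2'' h2'' _]] := resolve s2'' p2''.
rewrite (@count_uniq M2 (M2' ++ M2'') l) //; first last.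
- by rewrite msum_cat -e2' -e2'' -mon_plucker // e2.
- by move=> u; rewrite mem_cat => /orP[/h2'[]|/h2''[]].
rewrite count_cat; apply: leq_trans (leq_addr _ _).
apply: (IH _ _ _ s1 p1 s2' p2' d e1 e2' h1) => [|u /h2'[]//].
have := tot_dom d; have := tot_resol cw; rewrite !totB in ltc *; move: ltc; clear; lia.
Qed.

End Resolution.

(** * Comparison of the charts related by a flip *)

#[local] Opaque delta.

Section UniversallyLaurent.
Variables (n : nat) (K : fieldType) (A : {set 'I_n.+3} -> K).
Hypothesis hA : Atilde_functions A.
Notation V := 'I_n.+3.
Notation exps := {ffun {set V} -> int}.
Implicit Types (p q r s : V) (e f g : {set V}) (m l : exps)
  (T : {set {set V}}) (L : seq (int * exps)) (M : seq exps).
Notation mon := (mon A).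
Notation lsum := (lsum A).
Notation msum := (msum A).

Lemma lco_notin L m : m \notin [seq t.2 | t <- L] -> lco L m = 0.
Proof.
move=> h; rewrite /lco big_seq_cond big1 // => t /andP[tL /eqP E].
by case/negP: h; rewrite -E; apply: map_f.
Qed.

Lemma lco_in L m : lco L m != 0 -> exists2 t, t \in L & t.2 = m.
Proof.
move=> h; have /mapP[t tL ->] : m \in [seq t.2 | t <- L].
  by apply: contraR h => /lco_notin ->.
by exists t.
Qed.

Lemma lco_filter (P : pred exps) L m :
  lco [seq t : int * exps <- L | P t.2] m = if P m then lco L m else 0.
Proof.
rewrite /lco big_filter_cond /=; case: ifP => Pm.
  by apply: eq_bigl => t; case: eqP => [->|]; rewrite ?Pm ?andbF.
by rewrite big_pred0 // => t; case: eqP => [->|]; rewrite ?Pm ?andbF.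
Qed.

Lemma lsum_ext L1 L2 : lco L1 =1 lco L2 -> lsum L1 = lsum L2.
Proof.
move=> h; set U := undup ([seq t.2 | t <- L1] ++ [seq t.2 | t <- L2]).
have uU : uniq U := undup_uniq _.
rewrite !(@lsumE _ _ _ _ U) //; first by apply: eq_bigr => m _; rewrite h.
- by move=> m h2; rewrite mem_undup mem_cat h2 orbT.
- by move=> m h1; rewrite mem_undup mem_cat h1.
Qed.

(** Terms of [L] may cancel each other; those of [lred L] do not. *)
Definition lred L : seq (int * exps) :=
  [seq t <- [seq (lco L m, m) | m <- undup [seq t.2 | t <- L]] | t.1 != 0].

Lemma lco_lred L : lco (lred L) =1 lco L.
Proof.
move=> m; rewrite /lred /lco big_filter_cond big_map.
rewrite [LHS](_ : _ = \sum_(u <- undup [seq t.2 | t <- L] | u == m) lco L u); last first.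
  rewrite big_mkcond [RHS]big_mkcond; apply: eq_bigr => u _ /=.
  by case: (eqVneq (lco L u) 0) => [->|] /=; case: (u == m).
have [mL|mL] := boolP (m \in undup [seq t.2 | t <- L]).
  by rewrite -big_filter filter_pred1_uniq ?undup_uniq // big_seq1.
rewrite big_seq_cond big1 => [|u /andP[uL /eqP E]]; last by rewrite -E uL in mL.
by rewrite -/(lco L m) lco_notin // -mem_undup.
Qed.

Lemma lred_neq0 L t : t \in lred L -> lco L t.2 != 0.
Proof. by rewrite mem_filter => /andP[h /mapP[m _ E]]; move: h; rewrite E. Qed.

Lemma lsup_lred T L : lsup T L -> lsup T (lred L).
Proof. by move=> h t /lred_neq0 /lco_in[u uL <-]; apply: h. Qed.

(** The terms of the power [b] of a sum of two monomials, with repetitions. *)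
Fixpoint powers (u v : exps) (b : nat) : seq exps :=
  if b is b'.+1 then msums [:: u; v] (powers u v b') else [:: 0].

Lemma msum_powers u v (b : nat) : msum (powers u v b) = (mon u + mon v) ^+ b.
Proof.
elim: b => [|b IH]; first by rewrite msum1 mon0.
have msum2 : msum [:: u; v] = mon u + mon v by rewrite /msum !big_cons big_nil addr0.
by rewrite exprS -IH -msum2 -msum_mul.
Qed.

Lemma powers_ind (P : exps -> Prop) u v (b : nat) : P 0 -> (forall w, P w -> P (u + w)) ->
  (forall w, P w -> P (v + w)) -> forall w, w \in powers u v b -> P w.
Proof.
move=> P0 Pu Pv; elim: b => [|b IH] w; first by rewrite mem_seq1 => /eqP->.
move=> /allpairsP[[x y] /= [+ /IH h ->]].
by rewrite !in_cons in_nil orbF => /orP[] /eqP->; [exact: Pu|exact: Pv].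
Qed.

Section Flip.
Variables (T : {set {set V}}) (e : {set V}) (p q r s : V).
Hypotheses (cT : complete_triangulation T) (eT : e \in T) (qd : quad T e p q r s).
Let e' := seg q s.
Let T' := flip T e q s.
Let u : exps := delta (seg p q) + delta (seg r s).
Let v : exps := delta (seg q r) + delta (seg p s).
Let cw : clockwise p q r s. Proof. by case: (quad_sides qd). Qed.
Let pT := complete_partial cT.
Let cT' : complete_triangulation T' := flip_complete cT eT qd.

Let ce : #|e| == 2%N.
Proof. by apply: (chart_card pT); rewrite with_edgesE eT. Qed.

Let ce' : #|e'| == 2%N.
Proof. by have [_ _ _ [_ ? _]] := clockwise_neq cw; rewrite card_seg. Qed.

Let e'T : e' \notin with_edges T.
Proof.
apply/negP => h; have eT2 : e \in with_edges T by rewrite with_edgesE eT.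
by have := chart_noncrossing pT eT2 h; rewrite (quadE qd) clockwise_crossing.
Qed.

Let ee' : e != e'.
Proof. by apply: contra e'T => /eqP <-; rewrite with_edgesE eT. Qed.

Let eT' : e \notin with_edges T'.
Proof.
rewrite with_edgesE in_flip (negbTE ee') eqxx /=.
by rewrite diag_not_edge // (quadE qd); case/andP: (clockwise_diag cw).
Qed.

Let with_flip g : g \in with_edges T' -> g != e' -> g \in with_edges T.
Proof.
rewrite !with_edgesE in_flip => /orP[/orP[/eqP->|/andP[_ ->]//]|->]; last by rewrite orbT.
by rewrite eqxx.
Qed.

Let sides : [/\ seg p q != e, seg q r != e, seg r s != e & seg p s != e].
Proof. by rewrite (quadE qd); case: (clockwise_segs cw). Qed.

Let tsup_u : tsup T u /\ u e = 0.
Proof.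
have [h1 h2 h3 h4 _] := quad_sides qd; have [n1 n2 n3 n4] := sides.
split; first by apply: tsupD; apply: tsup_delta.
by rewrite !expsE ![e == _]eq_sym (negbTE n1) (negbTE n3).
Qed.

Let tsup_v : tsup T v /\ v e = 0.
Proof.
have [h1 h2 h3 h4 _] := quad_sides qd; have [n1 n2 n3 n4] := sides.
split; first by apply: tsupD; apply: tsup_delta.
by rewrite !expsE ![e == _]eq_sym (negbTE n2) (negbTE n4).
Qed.

Let powersP b w : w \in powers u v b -> tsup T w /\ w e = 0.
Proof.
have [u1 u2] := tsup_u; have [v1 v2] := tsup_v.
apply: (@powers_ind (fun w => tsup T w /\ w e = 0)) => [|{}w [h1 h2]|{}w [h1 h2]].
- by split; [exact: tsup0|rewrite ffunE].
- by split; [exact: tsupD|rewrite ffunE u2 h2].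
- by split; [exact: tsupD|rewrite ffunE v2 h2].
Qed.

Let B := mon u + mon v.

Let B_eq : B = A e * A e'.
Proof.
have [n1 n2 n3 [n4 n5 n6]] := clockwise_neq cw.
by rewrite /B !monD // !mon_delta ?card_seg // (quadE qd) (hA.1 _ _ _ _ cw) [A (seg q r) * _]mulrC.
Qed.

Let B_neq0 : B != 0.
Proof. by rewrite B_eq mulf_neq0 // A_neq0. Qed.

(** The exponents without [e] and [e'] of a term with [e'] to the power [j], after the
factor [(A e')^j] is rewritten as [B^j (A e)^-j]. *)
Definition strip (j : int) m : exps := m - delta e' *~ j - delta e *~ j.

Let mon_strip (j : int) m : mon (strip j m) * B ^ j = mon m.
Proof.
have x0 : A e ^ j != 0 by rewrite expfz_eq0 negb_and A_neq0 // orbT.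
have y0 : A e' ^ j != 0 by rewrite expfz_eq0 negb_and A_neq0 // orbT.
rewrite /strip !(monD hA) !(monN hA) !(monMz hA) (mon_delta A ce) (mon_delta A ce') B_eq expfzMl.
by rewrite -!mulrA mulKf // mulVf // mulr1.
Qed.

Let strip_tsup j m : tsup T' m -> m e' = j -> tsup T (strip j m) /\ strip j m e = - j.
Proof.
move=> tm mj; split=> [g gT|].
  have ge : g != e by apply: contra gT => /eqP->; rewrite with_edgesE eT.
  rewrite !expsE (negbTE ge) mul0r subr0.
  have [->|ge'] := eqVneq g e'; first by rewrite mj mul1r subrr.
  by rewrite mul0r subr0 tm //; apply: contra gT => /with_flip; apply.
by rewrite !expsE eqxx (negbTE ee') tm // mul0r mul1r subr0 sub0r.
Qed.

(** Let [B = A e * A e'], a sum of two monomials without [e] and [e'].  Replacing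
[A e'] by [B / A e] in the expansion [L'], and clearing negative powers of [B], gives
two expansions in [T]; compare their parts with a fixed power of [A e]. *)
Lemma flip_part L L' (a : nat) : lsup T L -> lsup T' L' -> lsum L = lsum L' ->
  lsum [seq t : int * exps <- L | t.2 e == - a%:Z]
  = B ^+ a * lsum [seq (t.1, strip a t.2) | t : int * exps <- L' & t.2 e' == a].
Proof.
move=> sL sL' EL.
(* The power of B that clears all denominators B ^ j. *)
pose b := (\sum_(t <- L') absz (t.2 e'))%N.
have hb t : t \in L' -> 0 <= b%:Z + t.2 e'.
  move=> tL; suff : (absz (t.2 e') <= b)%N by clear; lia.
  by rewrite /b (big_rem t) //=; exact: leq_addr.
pose L1 := [seq (t.1, t.2 + w) | t <- L, w <- powers u v b].
pose L2 := [seq (t.1, strip (t.2 e') t.2 + w) | t : int * exps <- L', w : exps <- powers u v (absz (b%:Z + t.2 e')%R)].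
have s1 : lsup T L1.
  by move=> t /allpairsP[[x w] /= [/sL tx /powersP[tw _] ->]]; apply: tsupD.
have s2 : lsup T L2.
  move=> t /allpairsPdep[x [w /= [/sL' tx /powersP[tw _] ->]]]; apply: tsupD => //.
  by case: (strip_tsup tx erefl).
have part P1 : lsum [seq t : int * exps <- L1 | P1 t.2] = lsum [seq t : int * exps <- L2 | P1 t.2].
  apply: lsum_ext => m; rewrite !lco_filter; case: ifP => // _.
  apply: (lsum_inj hA cT s1 s2).
  rewrite /lsum !big_allpairs_dep.
  transitivity (lsum L * B ^+ b).
    rewrite mulr_suml; apply: eq_bigr => t _; rewrite -mulrA; rewrite -msum_powers mulr_sumr mulr_sumr.
    by apply: eq_bigr => w _; rewrite /= monD.
  rewrite EL mulr_suml; apply: eq_big_seq => t tL.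
  rewrite -(mon_strip (t.2 e') t.2) -!mulrA exprnP -expfzDr // [_ + b%:Z]addrC.
  rewrite -[b%:Z + _]gez0_abs ?hb // -exprnP -msum_powers mulr_sumr mulr_sumr.
  by apply: eq_bigr => w _; rewrite /= monD.
apply: (mulfI (expf_neq0 b B_neq0)).
transitivity (lsum [seq t : int * exps <- L1 | t.2 e == - a%:Z]).
  rewrite /lsum !big_filter big_mkcond [RHS]big_mkcond big_allpairs_dep mulr_sumr.
  apply: eq_big_seq => t tL.
  rewrite -msum_powers mulr_suml; apply: eq_big_seq => w wP; have [_ w0] := powersP wP.
  rewrite /= ffunE w0 addr0; case: ifP => _; last by rewrite mulr0.
  by rewrite monD // mulrCA [mon w * _]mulrC.
rewrite (part (fun m => m e == - a%:Z)) /lsum big_filter big_mkcond big_allpairs_dep big_map big_filter [in RHS]big_mkcond.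
rewrite !mulr_sumr; apply: eq_big_seq => t tL.
have [_ se] := strip_tsup (sL' t tL) erefl.
have [E|ne] := eqVneq (t.2 e') a.
  rewrite E mulrA -exprD -msum_powers -PoszD /= mulr_suml; apply: eq_big_seq => w wP.
  have [_ w0] := powersP wP; rewrite -E ffunE se w0 addr0 E eqxx /=.
  by rewrite monD // mulrA mulrC.
rewrite !mulr0 big_seq big1 // => w wP; have [_ w0] := powersP wP.
by rewrite /= ffunE se w0 addr0 eqr_opp (negbTE ne).
Qed.

(** The parts without [e] and without [e'] are the same in the two charts. *)
Lemma flip_coef_eq L L' m : lsup T L -> lsup T' L' -> lsum L = lsum L' ->
  m e = 0 -> m e' = 0 -> lco L m = lco L' m.
Proof.
move=> sL sL' EL me me'.
have := flip_part 0 sL sL' EL; rewrite expr0 mul1r.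
have -> : [seq (t.1, strip 0 t.2) | t : int * exps <- L' & t.2 e' == 0] = [seq t : int * exps <- L' | t.2 e' == 0].
  rewrite -[RHS]map_id; apply: eq_map => -[c w] /=.
  by rewrite /strip !mulr0z !subr0.
move=> E; have := lsum_inj hA cT _ _ E m.
rewrite (lco_filter (fun m => m e == - 0%:Z)) (lco_filter (fun m => m e' == 0)).
rewrite me me' !eqxx; apply.
  by move=> t; rewrite mem_filter => /andP[_ /sL].
move=> t; rewrite mem_filter => /andP[/eqP h /sL' tt g gT].
have [->//|ge'] := eqVneq g e'.
by apply: tt; apply: contra gT => /with_flip; apply.
Qed.

Let tot_u : tot u + 1 <= tot (delta e + delta e').
Proof.
have := tot_resol cw; have -> : resol p q r s = (delta e + delta e') - u.
  by rewrite /resol (quadE qd); apply/ffunP => g; rewrite !expsE; ring.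
by rewrite totB subr_gt0 lezD1.
Qed.

Let tot_v : tot v + 1 <= tot (delta e + delta e').
Proof.
have cw' : clockwise q r s p by rewrite -clockwise_rot.
have := tot_resol cw'; have -> : resol q r s p = (delta e + delta e') - v.
  by rewrite /resol (quadE qd) [seg r p]seg_sym [seg s p]seg_sym; apply/ffunP => g; rewrite !expsE; ring.
by rewrite totB subr_gt0 lezD1.
Qed.

Lemma totD m1 m2 : tot (m1 + m2) = tot m1 + tot m2.
Proof. by have := totB (m1 + m2) m2; rewrite addrK => ->; rewrite subrK. Qed.

Lemma tot0 : tot (0 : exps) = 0.
Proof. by have := totB (0 : exps) 0; rewrite !subrr. Qed.

Let tot_powers (a : nat) w : w \in powers u v a -> tot w + a%:Z <= tot (delta e + delta e') *+ a.
Proof.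
elim: a w => [|a IH] w; first by rewrite mem_seq1 => /eqP->; rewrite tot0.
move=> /allpairsP[[x y] /= [+ /IH h ->]].
have tu := tot_u; have tv := tot_v.
rewrite !in_cons in_nil orbF mulrS totD => /orP[] /eqP->; move: tu tv h; clear; lia.
Qed.

(** The part of [L] with [(A e)^-a] is [B^a] times the part of [L'] with [(A e')^a].
As both terms of [B] have a smaller total cut than [A e * A e'], some term of [L']
beats [m]. *)
Lemma flip_tot L L' m : lsup T L -> lsup T' L' -> lsum L = lsum L' ->
  lco L m != 0 -> m e < 0 -> exists m', lco L' m' != 0 /\ tot m < tot m'.
Proof.
move=> sL sL' EL mL me.
pose a := absz (m e); have ea : m e = - a%:Z by rewrite /a; move: me; clear; lia.
have EL' : lsum L = lsum (lred L') by rewrite EL; apply: lsum_ext => u'; rewrite lco_lred.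
have := flip_part a sL (lsup_lred sL') EL'.
set L1 := [seq (t.1, _) | t <- _] => E.
pose L2 := [seq (t.1, t.2 + w) | t <- L1, w <- powers u v a].
have e2 : lsum [seq t : int * exps <- L | t.2 e == - a%:Z] = lsum L2.
  rewrite E /lsum big_allpairs_dep mulr_sumr; apply: eq_bigr => t _.
  by rewrite mulrC -mulrA -msum_powers !mulr_sumr; apply: eq_bigr => w _; rewrite /= monD.
have s1 : lsup T L1.
  move=> t /mapP[t']; rewrite mem_filter => /andP[/eqP te' tL] -> /=.
  by case: (strip_tsup (lsup_lred sL' tL) te').
have s2 : lsup T L2.
  by move=> t /allpairsP[[x w] /= [/s1 tx /powersP[tw _] ->]]; apply: tsupD.
have := lsum_inj hA cT _ s2 e2 m; rewrite (lco_filter (fun m => m e == - a%:Z)) ea eqxx => h.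
have {}h : lco L2 m != 0.
  by rewrite -h // => t; rewrite mem_filter => /andP[_ /sL].
have [t /allpairsP[[x w] /= [xL1 wP ->]] /= Em] := lco_in h.
have [t' + Ex] := mapP xL1; rewrite mem_filter => /andP[_ t'L]; subst x.
exists t'.2; split; first exact: lred_neq0.
have := tot_powers wP; rewrite -Em /= [tot (strip _ _ + _)]totD /strip !totB.
have totMn (w' : exps) (c : nat) : tot (w' *~ c) = tot w' *+ c.
  rewrite -pmulrn; elim: c => [|c IH]; first by rewrite !mulr0n tot0.
  by rewrite !mulrS totD IH.
have a0 : (0 < a)%N by rewrite /a; move: me; clear; lia.
rewrite !totMn totD mulrnDl; move: a0; clear; lia.
Qed.

End Flip.

End UniversallyLaurent.

(** * Extremal functions *)

Section Extremal.
Variables (n : nat) (K : fieldType) (A : {set 'I_n.+3} -> K).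
Hypothesis hA : Atilde_functions A.
Notation V := 'I_n.+3.
Notation exps := {ffun {set V} -> int}.
Implicit Types (p q r s : V) (e f : {set V}) (m l : exps)
  (T : {set {set V}}) (L : seq (int * exps)) (M : seq exps).
Notation mon := (mon A).
Notation lsum := (lsum A).
Notation msum := (msum A).

Definition expansions (h : K) (Ls : {set {set V}} -> seq (int * exps)) :=
  forall T, complete_triangulation T -> lsup T (Ls T) /\ lsum (Ls T) = h.

Lemma tsup_lam T m : complete_triangulation T -> tsup T m -> pos m -> lam m.
Proof.
move=> cT tm pm; have pT := complete_partial cT; split=> //; first exact: tsup_onseg tm.
move=> e f _ _ me mf; apply: (chart_noncrossing pT).
  by apply: contraLR me => /tm ->; rewrite ltxx.
by apply: contraLR mf => /tm ->; rewrite ltxx.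
Qed.

Definition all_exps (Ls : {set {set V}} -> seq (int * exps)) : seq exps :=
  flatten [seq [seq t.2 | t <- Ls T] | T <- enum {set {set V}}].

Lemma in_all_exps Ls T m : lco (Ls T) m != 0 -> m \in all_exps Ls.
Proof.
move=> /lco_in[t tL <-]; apply/flattenP; exists [seq t.2 | t <- Ls T].
  by apply: map_f; rewrite mem_enum.
exact: map_f.
Qed.

(** By [flip_tot], a term with a negative exponent on a diagonal is not of maximal
total cut among all charts; and terms with exponents at least 0 on the diagonals are
cluster monomials. *)
Lemma universally_Laurent0 h Ls : expansions h Ls ->
  (forall T l, complete_triangulation T -> lam l -> tsup T l -> lco (Ls T) l = 0) -> h = 0.
Proof.
move=> hLs h0.
suff z T m : complete_triangulation T -> lco (Ls T) m = 0.
  have [T cT _] := extend_complete (@partial0 n).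
  have [_ <-] := hLs T cT.
  by rewrite -[RHS](_ : lsum [::] = 0); [apply: lsum_ext => m; rewrite z // /lco big_nil | rewrite /lsum big_nil].
move=> cT; apply/eqP; apply: contraT => ne.
(* An upper bound for the total cuts in all charts, for an induction going up. *)
pose top := (\sum_(m <- all_exps Ls) absz (tot m))%N.
have le_top T1 m1 : lco (Ls T1) m1 != 0 -> tot m1 <= top%:Z.
  move=> /in_all_exps mL; suff : (absz (tot m1) <= top)%N by clear; lia.
  by rewrite /top (big_rem m1) //=; exact: leq_addr.
have [c] : exists c : nat, top%:Z - tot m < c%:Z.
  by exists (absz (top%:Z - tot m)%R).+1; clear; lia.
elim: c T m cT ne => [|c IH] T m cT ne lt.
  by have := le_top _ _ ne; move: lt; clear; lia.
have [sT ET] := hLs T cT.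
have tm : tsup T m by have [t tL <-] := lco_in ne; exact: sT.
have [pm|/existsNP[e /not_implyP[de /negP]]] := pselect (pos m).
  by move: ne; rewrite h0 ?eqxx //; exact: (tsup_lam cT).
rewrite -ltNge => me.
have eT : e \in T.
  have : e \in with_edges T by apply: contraLR me => /tm ->; rewrite ltxx.
  by rewrite with_edgesE diag_not_edge // orbF.
have [p [q [r [s qd]]]] := quad_exists cT eT.
have cT' := flip_complete cT eT qd.
have [sT' ET'] := hLs _ cT'.
have [|m' [ne' lt']] := flip_tot hA cT eT qd sT sT' _ ne me; first by rewrite ET ET'.
by apply: (IH _ _ cT' ne'); move: lt lt'; clear; lia.
Qed.

(** Charts containing [l] are linked by flips of diagonals outside [l], for which
[flip_coef_eq] applies. *)
Lemma coef_consistent h Ls T T' l : expansions h Ls -> lam l ->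
  complete_triangulation T -> complete_triangulation T' -> tsup T l -> tsup T' l ->
  lco (Ls T) l = lco (Ls T') l.
Proof.
move=> hLs [sl pl nc] cT cT' tT tT'.
pose S := [set e | diagonal e && (0 < l e)]%SET.
have SE e : (e \in S) = diagonal e && (0 < l e) by rewrite finset.in_set.
have subS T1 : tsup T1 l -> S \subset T1.
  move=> t1; apply/fintype.subsetP => e; rewrite SE => /andP[de le].
  have : e \in with_edges T1 by apply: contraLR le => /t1 ->; rewrite ltxx.
  by rewrite with_edgesE diag_not_edge // orbF.
have supS T1 : S \subset T1 -> tsup T1 l.
  move=> /fintype.subsetP s1 e; rewrite with_edgesE negb_or => /andP[eT ee].
  have [ce|ce] := boolP (#|e| == 2%N); last by rewrite sl.
  have de : diagonal e by rewrite diagonalE ce ee.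
  by apply: contraNeq eT => le; apply: s1; rewrite SE de lt0r le pl.
pose P T1 := lco (Ls T) l = lco (Ls T1) l.
suff : P T' by [].
apply: (@flip_connected _ P S _ T T') => //; [|exact: subS|exact: subS].
move=> T1 e p q r s cT1 ST1 eT1 eS qd; rewrite /P => ->.
have cT2 := flip_complete cT1 eT1 qd.
have [s1 E1] := hLs _ cT1; have [s2 E2] := hLs _ cT2.
apply: (flip_coef_eq hA cT1 eT1 qd s1 s2); first by rewrite E1.
  have de : diagonal e := (ptriP _ (complete_partial cT1)).1 _ eT1.
  by move: eS; rewrite SE de /= -leNgt => le0; apply/eqP; rewrite eq_le le0 pl.
apply: (supS _ ST1); apply/negP => qsT.
have e1 : e \in with_edges T1 by rewrite with_edgesE eT1.
have := chart_noncrossing (complete_partial cT1) e1 qsT.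
by rewrite (quadE qd) clockwise_crossing //; case: (quad_sides qd).
Qed.

(** The difference of [h] and of the sum of its cluster monomials, with coefficients
read off in charts, falls under [universally_Laurent0]. *)
Lemma lam_span h : (forall T, complete_triangulation T -> exists L, lsup T L /\ lsum L = h) ->
  exists Ls L, [/\ expansions h Ls, lamlist L, lsum L = h &
    forall t, t \in L -> exists2 T, complete_triangulation T & t.1 = lco (Ls T) t.2].
Proof.
move=> hU.
have [Ls hLs] : exists Ls, expansions h Ls.
  have [Ls hLs] := @choice _ _ (fun T L => complete_triangulation T -> lsup T L /\ lsum L = h)
    (fun T => match pselect (complete_triangulation T) with
      | left cT => let: ex_intro L hL := hU T cT in ex_intro _ L (fun _ => hL)
      | right nT => ex_intro _ [::] (fun cT => False_ind _ (nT cT)) end).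
  by exists Ls.
have [Tl hTl] : exists Tl : exps -> {set {set V}}, forall l, lam l ->
    complete_triangulation (Tl l) /\ tsup (Tl l) l.
  have [Tl hTl] := @choice _ _ (fun l T => lam l -> complete_triangulation T /\ tsup T l)
    (fun l => match pselect (lam l) with
      | left ll => let: ex_intro2 T cT tT := lam_chart ll in ex_intro _ T (fun _ => conj cT tT)
      | right nl => ex_intro _ finset.set0 (fun ll => False_ind _ (nl ll)) end).
  by exists Tl.
pose Lam := undup [seq l <- all_exps Ls | `[< lam l >]].
have LamP l : l \in Lam -> lam l by rewrite mem_undup mem_filter => /andP[/asboolP].
pose L := [seq (lco (Ls (Tl l)) l, l) | l <- Lam].
have LL : lamlist L by move=> t /mapP[l /LamP ll ->].
have LE l : lam l -> lco L l = lco (Ls (Tl l)) l.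
  move=> ll; rewrite /lco big_map /=.
  have [lL|lL] := boolP (l \in Lam).
    by rewrite -big_filter filter_pred1_uniq ?undup_uniq // big_seq1.
  rewrite big_seq_cond big1 => [|u /andP[uL /eqP E]]; last by rewrite -E uL in lL.
  apply/eqP; rewrite eq_sym; apply: contraNT lL => /in_all_exps h1.
  by rewrite mem_undup mem_filter h1 andbT; apply/asboolP.
exists Ls, L; split=> //; last first.
  by move=> t /mapP[l lL ->] /=; have [cT tT] := hTl _ (LamP _ lL); exists (Tl l).
have [LT hLT] : exists LT, forall T, complete_triangulation T ->
   [/\ lsup T (LT T), lsum (LT T) = lsum L & forall l, lam l -> tsup T l -> lco (LT T) l = lco L l].
  have [LT hLT] := @choice _ _ (fun T L' => complete_triangulation T -> [/\ lsup T L', lsum L' = lsum L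
    & forall l, lam l -> tsup T l -> lco L' l = lco L l])
    (fun T => match pselect (complete_triangulation T) with
      | left cT => let: ex_intro L1 hL := lam_coef hA cT LL in ex_intro _ L1 (fun _ => hL)
      | right nT => ex_intro _ [::] (fun cT => False_ind _ (nT cT)) end).
  by exists LT.
apply/eqP; rewrite eq_sym -subr_eq0; apply/eqP.
apply: (@universally_Laurent0 _ (fun T => Ls T ++ lscale (-1) (LT T))).
  move=> T cT; have [s1 e1] := hLs T cT; have [s2 e2 _] := hLT T cT.
  split; first by apply: lsup_cat => //; apply: lsup_scale.
  by rewrite lsum_cat lsum_scale e1 e2 mulN1r.
move=> T l cT ll tl; have [s2 e2 c2] := hLT T cT.
rewrite lco_cat lco_scale c2 // LE // mulN1r; have [cTl tTl] := hTl l ll.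
by rewrite (coef_consistent hLs ll cT cTl tl tTl) subrr.
Qed.

Lemma Lplus_msum M : (forall T, complete_triangulation T -> forall m, m \in M -> expands A T m) ->
  Lplus (Atilde A) (msum M).
Proof.
move=> h [T cT] /=; rewrite /nonneg_laurent /=.
have pT := complete_partial cT.
elim: M h => [|m M IH] h.
  by exists [::]; rewrite /msum !big_nil.
have [|s Es] := IH; first by move=> T1 cT1 m1 m1M; apply: h => //; rewrite in_cons m1M orbT.
have [|M1 [E1 h1]] := h T cT m; first by rewrite mem_head.
exists ([seq (1%N, m1) | m1 <- M1] ++ s).
rewrite /msum big_cons -/(msum M) E1 Es big_cat big_map /=; congr (_ + _).
by rewrite /msum; apply: eq_big_seq => m1 /h1[t1 _]; rewrite mul1r (mon_tsup A pT t1).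
Qed.

Lemma Lplus_expansion T h : complete_triangulation T -> Lplus (Atilde A) h ->
  exists L, [/\ lsup T L, lsum L = h & forall m, 0 <= lco L m].
Proof.
move=> cT /(_ (exist _ T cT))[s /= ->]; have pT := complete_partial cT.
pose rs (m : exps) : exps := [ffun e => if e \in with_edges T then m e else 0].
have trs m : tsup T (rs m) by move=> e eT; rewrite ffunE (negbTE eT).
exists [seq (t.1%:Z, rs t.2) | t <- s]; split.
- by move=> t /mapP[u _ ->]; exact: trs.
- rewrite /lsum big_map; apply: eq_bigr => t _ /=; rewrite (mon_tsup A pT (trs _)) pmulrn.
  by congr (_ * _); apply: eq_bigr => e eT; rewrite ffunE eT.
- by move=> m; rewrite /lco big_map; apply: sumr_ge0.
Qed.

Lemma expands_pos T m : complete_triangulation T -> onseg m -> pos m -> expands A T m.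
Proof.
move=> cT sm pm; apply: expands_chart => // e; rewrite with_edgesE negb_or => /andP[_ ee].
have [ce|ce] := boolP (#|e| == 2%N); last by rewrite sm.
by apply: pm; rewrite diagonalE ce.
Qed.

Lemma Lplus_mon m : onseg m -> pos m -> Lplus (Atilde A) (mon m).
Proof.
move=> sm pm; rewrite -(@msum1 _ _ A); apply: Lplus_msum => T cT m'.
by rewrite mem_seq1 => /eqP->; apply: expands_pos.
Qed.

(** The coefficients of [lam_span] are coefficients in charts, hence at least 0.  So
[h] is a sum of cluster monomials, and extremality leaves just one. *)
Lemma Eset_lam h : Eset (Atilde A) h -> exists2 l, lam l & h = mon l.
Proof.
move=> [hp h0 ind].
have [|Ls [L [hLs LL EL hL]]] := lam_span (h := h).
  by move=> T cT; have [L [? ? _]] := Lplus_expansion cT hp; exists L.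
have L_ge0 t : t \in L -> 0 <= t.1.
  move=> /hL[T cT ->]; have [L1 [s1 e1 p1]] := Lplus_expansion cT hp.
  have [s2 e2] := hLs T cT.
  by rewrite (lsum_inj hA cT s2 s1) // e2 e1.
pose M := flatten [seq nseq (absz t.1) t.2 | t <- L].
have ML l : l \in M -> lam l by move=> /flattenP[x /mapP[t tL ->]] /nseqP[-> _]; exact: LL.
have EM : msum M = h.
  rewrite -EL /lsum /msum big_flatten big_map; apply: eq_big_seq => t tL.
  by rewrite big_nseq iter_addr_0 -mulr_natl pmulrn gez0_abs ?L_ge0.
case: M EM ML => [|l M] EM ML; first by case/eqP: h0; rewrite -EM /msum big_nil.
have ll : lam l by apply: ML; rewrite mem_head.
exists l => //; have [M0|Mn0] := eqVneq (msum M) 0.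
  by rewrite -EM /msum big_cons -/(msum M) M0 addr0.
case: ind; exists (mon l), (msum M); split=> //.
- by case: ll => ? ? _; exact: Lplus_mon.
- apply: Lplus_msum => T cT m mM; have [] : lam m by apply: ML; rewrite in_cons mM orbT.
  by move=> ? ? _; apply: expands_pos.
- exact: mon_neq0.
- by rewrite -EM /msum big_cons.
Qed.

(** In a chart containing the monomial, two nonzero summands would each contribute at
least 1 to its coefficient. *)
Lemma lam_Eset m : lam m -> Eset (Atilde A) (mon m).
Proof.
move=> lm; have [sm pm _] := lm; split; [exact: Lplus_mon|exact: mon_neq0|].
move=> [g [h [gp hp g0 h0 E]]].
have [T cT tm] := lam_chart lm.
have [L1 [s1 e1 p1]] := Lplus_expansion cT gp.
have [L2 [s2 e2 p2]] := Lplus_expansion cT hp.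
have c m' : lco L1 m' + lco L2 m' = (m' == m)%:Z.
  rewrite -lco_cat (@lsum_inj _ _ _ hA T _ (ones [:: m]) cT); first by rewrite lco_ones /= addn0 eq_sym.
  - exact: lsup_cat.
  - by move=> t; rewrite mem_seq1 => /eqP->.
  - by rewrite lsum_cat e1 e2 lsum_ones msum1.
have nz L (k : K) : lsum L = k -> k != 0 -> (forall m', 0 <= lco L m') ->
    (forall m', lco L m' <= (m' == m)%:Z) -> lco L m = 1.
  move=> ek kn0 ge le; have [z|nz] := eqVneq (lco L m) 0.
    case/eqP: kn0; rewrite -ek -[RHS](_ : lsum [::] = 0); last by rewrite /lsum big_nil.
    apply: lsum_ext => m'; rewrite [RHS]/lco big_nil.
    have [->//|ne] := eqVneq m' m; have := le m'; have := ge m'.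
    by rewrite (negbTE ne); clear; lia.
  by have := le m; have := ge m; rewrite eqxx; move: nz; clear; lia.
have le1 m' : lco L1 m' <= (m' == m)%:Z by rewrite -c lerDl.
have le2 m' : lco L2 m' <= (m' == m)%:Z by rewrite -c lerDr.
by have := c m; rewrite (nz L1 g) // (nz L2 h) // eqxx.
Qed.

Lemma pos_prod M : (forall m, m \in M -> onseg m /\ pos m) ->
  exists m, [/\ onseg m, pos m & mon m = \prod_(u <- M) mon u].
Proof.
elim: M => [|u M IH] h.
  by exists 0; split=> [e _|e _|]; rewrite ?ffunE ?mon0 ?big_nil.
have [|m [sm pm Em]] := IH; first by move=> v vM; apply: h; rewrite in_cons vM orbT.
have [su pu] := h u (mem_head _ _).
exists (u + m); split; first exact: onsegD.
  by move=> e de; rewrite ffunE addr_ge0 ?pu ?pm.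
by rewrite monD // big_cons Em.
Qed.

(** A product of cluster monomials need not be one, and conversely each variable, and
the inverse of each edge variable, is a cluster monomial. *)
Lemma PsetP h : Pset (Atilde A) h <-> exists m, [/\ onseg m, pos m & h = mon m].
Proof.
split=> [[s [hs ->]]|[m [sm pm ->]]].
  have : exists M, (forall m, m \in M -> onseg m /\ pos m)
      /\ \prod_(g <- s) g = \prod_(u <- M) mon u.
    elim: s hs => [|g s IH] hs; first by exists [::]; rewrite !big_nil.
    have [|M [hM EM]] := IH; first by move=> g' g's; apply: hs; rewrite in_cons g's orbT.
    have [l [sl pl _] El] := Eset_lam (hs g (mem_head _ _)).
    exists (l :: M); rewrite !big_cons EM El; split=> // m.
    by rewrite in_cons => /orP[/eqP->|/hM].
  by case=> M [/pos_prod[m [sm pm Em]] ->]; exists m; rewrite Em.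
exists [seq mon (delta e *~ m e) | e <- enum {set V}]; split; last first.
  rewrite big_map {1}[m]exps_decomp [RHS]big_enum /=.
  by apply: (big_morph mon (monD hA) (mon0 A)).
move=> g /mapP[e _ ->]; apply: lam_Eset.
have [ce|ce] := boolP (#|e| == 2%N); last first.
  rewrite sm // mulr0z; split=> [f _|f _|f f' _ _]; rewrite ?ffunE ?ltxx //.
split=> [f cf|f df|f f' df df'].
- rewrite exps_mulz deltaE; have [E|_] := eqVneq f e; last by rewrite mul0r.
  by rewrite E ce in cf.
- rewrite exps_mulz deltaE; have [E|_] := eqVneq f e; last by rewrite mul0r.
  rewrite mul1r;   by apply: pm; rewrite -E.
- rewrite !exps_mulz !deltaE; have [->|_] := eqVneq f e; last by rewrite mul0r ltxx.
  by have [->|_] := eqVneq f' e; [rewrite crossing_self|rewrite mul0r ltxx].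
Qed.

End Extremal.

(** * Cuts of cross-ratios *)

Section XSpaceCombinatorics.
Variable (n : nat).
Notation V := 'I_n.+3.
Notation exps := {ffun {set V} -> int}.
Implicit Types (i j k a b p q r s x y : V) (e f : {set V}) (m : exps)
  (T : {set {set V}}).

Lemma inarc_offset c a b x : inarc a b x =
  ((offset c a < offset c b) && (offset c a < offset c x <= offset c b)
   || (offset c b <= offset c a) && ((offset c a < offset c x) || (offset c x <= offset c b)))%N.
Proof.
have := ltn_ord a; have := ltn_ord b; have := ltn_ord c; have := ltn_ord x.
rewrite /inarc /offset.
by case: ifP => h1; case: ifP => h2; case: ifP => h3 h4 h5 h6 h7; apply/idP/idP; lia.
Qed.

Lemma separates_offset i j k l a b : clockwise i j k l -> separates a b j k l i ->
  [/\ offset i a < offset i j, offset i k <= offset i b & offset i b < offset i l]%N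
  \/ [/\ offset i b < offset i j, offset i k <= offset i a & offset i a < offset i l]%N.
Proof.
rewrite clockwise_offset /separates !(inarc_offset i) offset_id => /andP[/andP[j0 jk] kl].
move: (offset i a) (offset i b) (offset i j) (offset i k) (offset i l) j0 jk kl; clear.
move=> oa ob oj ok ol h1 h2 h3 h.
case: (ltnP oa ob) h => h5 h; [left|right]; split; lia.
Qed.

Lemma separates_sym i j k l a b : a != b -> separates a b i j k l = separates b a i j k l.
Proof.
move=> ne; rewrite /separates !(@inarc_sym _ a b) //.
by case: (inarc a b i); case: (inarc a b j); case: (inarc a b k); case: (inarc a b l).
Qed.

Lemma offset_eq0 i a : offset i a = 0%N -> a = i.
Proof. by move=> h; apply: (@offset_inj _ i); rewrite h offset_id. Qed.

(** The chord from [a] to [b] runs from [i, j) to [k, l); it crosses [ij] unless it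
starts in [i], and then [kl] unless it ends in [k]. *)
Lemma noncrossing_separates i j k l a b : clockwise i j k l -> separates a b j k l i ->
  ~~ crossing (seg i j) (seg a b) -> ~~ crossing (seg k l) (seg a b) -> seg a b = seg i k.
Proof.
move=> cw sep n1 n2.
wlog [h1 h2 h3] : a b n1 n2 {sep} / [/\ offset i a < offset i j, offset i k <= offset i b & offset i b < offset i l]%N.
  move=> W; case: (separates_offset cw sep) => h; first exact: W.
  by have := W b a; rewrite [seg b a]seg_sym; apply.
move: (cw); rewrite clockwise_offset => /andP[/andP[j0 jk] kl].
have ai : a = i.
  apply: offset_eq0; apply/eqP; apply: contraNT n1; rewrite -lt0n => a0.
  apply: crossing_cw; apply: (offset_clockwise _ h1 (leq_trans jk h2)).
  by rewrite offset_id.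
subst a.
suff -> : b = k by [].
apply: (@offset_inj _ i); apply/eqP; rewrite eq_sym eqn_leq h2 leqNgt; apply: contra n2 => kb.
apply: crossing_cw'; rewrite -clockwise_rot.
by apply: (offset_clockwise _ kb h3); rewrite offset_id (ltn_trans j0 jk).
Qed.

(** The exponents of [A_pq A_rs / (A_qr A_ps)], as the difference of the two
resolutions of the crossing of [pr] and [qs]. *)
Definition cross_ratio p q r s : exps := resol q r s p - resol p q r s.

Lemma cross_ratioE p q r s : cross_ratio p q r s =
  delta (seg p q) + delta (seg r s) - delta (seg q r) - delta (seg p s).
Proof.
rewrite /cross_ratio /resol [seg r p]seg_sym [seg s p]seg_sym.
by apply/ffunP => e; rewrite !expsE; ring.
Qed.

Definition deg0 m := forall a, cut a (ordS a) m = 0.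

Lemma deg0_cross_ratio p q r s : clockwise p q r s -> deg0 (cross_ratio p q r s).
Proof.
move=> cw a; have cw' : clockwise q r s p by rewrite -clockwise_rot.
have [_ /(_ a)] := dom_resol cw; have [_ /(_ a)] := dom_resol cw'.
by rewrite cut0 /cross_ratio cutB => <- <-.
Qed.

(** Along the diagonals of a chart, the cuts of the cross-ratios of that chart are
dual to the diagonals: no other diagonal of the chart separates opposite sides of the
quadrilateral of [e]. *)
Lemma cut_cross_ratio T e p q r s a b : complete_triangulation T -> e \in T -> quad T e p q r s ->
  seg a b \in T -> cut a b (cross_ratio p q r s) = 2 * (seg a b == e)%:Z.
Proof.
move=> cT eT qd abT; have [h1 h2 h3 h4 cw] := quad_sides qd.
have cw' : clockwise q r s p by rewrite -clockwise_rot.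
have pT := complete_partial cT.
have abT' : seg a b \in with_edges T by rewrite with_edgesE abT.
have eT' : e \in with_edges T by rewrite with_edgesE eT.
have nc f : f \in with_edges T -> ~~ crossing f (seg a b) by move=> fT; apply: (chart_noncrossing pT).
rewrite /cross_ratio cutB !cut_resol //.
have -> : separates a b p q r s = false.
  apply/negP => sep; have cw2 : clockwise s p q r by rewrite clockwise_rot.
  have := noncrossing_separates cw2 sep; rewrite [seg s p]seg_sym !nc // => /(_ isT isT) E.
  by have := nc _ eT'; rewrite E (quadE qd) [seg s q]seg_sym clockwise_crossing.
rewrite mulr0 subr0; congr (_ * (nat_of_bool _)%:Z).
apply/idP/eqP => [sep|E].
  by rewrite (quadE qd); apply: (noncrossing_separates cw sep); apply: nc.
have := E; rewrite (quadE qd) => /eqP; rewrite seg_eq => /orP[] /andP[/eqP-> /eqP->].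
  rewrite separates_sym; first exact: (inarc_quad cw').
  by case/clockwise_neq: cw.
exact: (inarc_quad cw').
Qed.

Lemma cut_even m : deg0 m -> forall a b, exists c, cut a b m = 2 * c.
Proof.
move=> d a b; have [c ->] := cut_parity a b m; exists c.
by rewrite big1 ?add0r // => p _; rewrite -[X in cut _ X]ord_predK d.
Qed.

Lemma half_cut m : deg0 m ->
  exists c : {set V} -> int, forall a b, cut a b m = 2 * c (seg a b).
Proof.
move=> dm; suff half e : exists z : int, forall a b, e = seg a b -> cut a b m = 2 * z.
  by have [c hc] := choice half; exists c => a b; exact: hc.
have [ce|ce] := boolP (#|e| == 2%N); last first.
  exists 0 => a b E; move: ce; rewrite E card_seg negbK => /eqP->.
  by rewrite cut_id.
have [x [y [_ _ E]]] := segP ce; have [z Ez] := cut_even dm x y.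
exists z => a b /eqP; rewrite E seg_eq => /orP[] /andP[/eqP<- /eqP<-] //.
by rewrite cut_sym.
Qed.

(** The degenerate case of [cut_defect] for a triangle. *)
Lemma cut_triangle i j k m : cyc3 i j k -> cut i j m + cut k i m - cut j k m
  = 2 * \sum_(x | inarc i j x) \sum_(y | inarc k i y) m (seg x y).
Proof.
move=> c3; have Z : Cut (fun=> false) m = 0 by rewrite /Cut big_pred0.
have := @Cut_defect _ (inarc i j) (fun=> false) (inarc k i) m; rewrite Z subr0 => <-; first last.
- by [].
- by move=> x; move: c3; rewrite /cyc3 /inarc; lia.
- by move=> x; rewrite andbF.
congr (_ + _ - _); first by apply: Cut_eq => x; rewrite orbF.
by apply: Cut_compl => x /=; move: c3; rewrite /cyc3 /inarc; lia.
Qed.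

Lemma cyc3_ordSS a : cyc3 (ordS a) (ordS (ordS a)) a.
Proof.
have := ordS_val (ordS a); have := ordS_val a; have := ltn_ord a.
rewrite /cyc3; move: (nat_of_ord (ordS (ordS a))) (nat_of_ord (ordS a)) (nat_of_ord a); clear.
by move=> z y x h; case: ifP => /eqP ? e1; case: ifP => /eqP ? e2; lia.
Qed.

(** Around a diagonal [pr] with quadrilateral [pqrs], the difference of the two
defects of [cut_defect] only involves the cuts along the sides.  As [m] lives on [T],
the one defect is zero and the other is twice the exponent of [pr].  For an edge, use
the triangle on it. *)
Lemma chart_cut_inj T m : complete_triangulation T -> tsup T m -> deg0 m ->
  (forall a b, seg a b \in T -> cut a b m = 0) -> m = 0.
Proof.
move=> cT tm d0 dT; have pT := complete_partial cT.
have side a b : seg a b \in with_edges T -> cut a b m = 0.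
  rewrite with_edgesE => /orP[/dT//|]; rewrite edge_seg => /orP[] /eqP->; first exact: d0.
  by rewrite cut_sym d0.
have m0 x y f : f \in with_edges T -> crossing f (seg x y) -> m (seg x y) = 0.
  move=> fT c; apply: tm; apply/negP => xyT.
  by have := chart_noncrossing pT fT xyT; rewrite c.
apply/ffunP => e; rewrite ffunE.
have [eT|eT] := boolP (e \in with_edges T); last by rewrite tm.
have [ee|ee] := boolP (edge e).
  have [a Ea] : exists a, e = seg a (ordS a) by case/existsP: ee => a /eqP ->; exists a.
  subst e; have eT' := eT; rewrite seg_sym in eT'.
  have [|q [c3 sq qa]] := @triangle_exists _ T (ordS a) a (ordS (ordS a)) cT eT'.
    exact: cyc3_ordSS.
  have c3' : cyc3 a (ordS a) q by rewrite cyc3_rot.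
  have := cut_triangle m c3'; rewrite !side // addr0 subr0 => /esym/eqP; rewrite mulf_eq0 /= => /eqP.
  rewrite (eq_bigl _ _ (inarc_edge a)) big_pred1_eq (bigD1 a) /=; last first.
    by move: c3'; rewrite /cyc3 /inarc; clear; lia.
  rewrite big1 ?addr0 => [|y /andP[hy ya]]; first by rewrite seg_sym.
  apply: (m0 _ _ (seg q a)) => //; rewrite crossing_sym; apply: crossing_cw.
  move: hy ya c3'; rewrite cyc3_offset !(inarc_offset a) ord_eqE => hy ya /andP[s0 sq'].
  have ya' : y != a by rewrite ord_eqE.
  have oy : (offset a q < offset a y)%N.
    move: hy; rewrite offset_id; have : offset a y != 0%N by apply: contra ya' => /eqP/offset_eq0->.
    by clear; lia.
  by rewrite -clockwise_rot; apply: (offset_clockwise _ sq' oy); rewrite offset_id.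
have eT1 : e \in T by move: eT; rewrite with_edgesE (negbTE ee) orbF.
have [p [q [r [s qd]]]] := quad_exists cT eT1.
have [h1 h2 h3 h4 cw] := quad_sides qd; have Ee := quadE qd; subst e.
have cw' : clockwise q r s p by rewrite -clockwise_rot.
have E1 := cut_defect m cw; have E2 := cut_defect m cw'.
move: E1 E2; rewrite [cut r p m]cut_sym [cut q p m]cut_sym.
rewrite (side p r eT) (side p s h4) (side q r h2) (side p q h1) (side r s h3).
move: (cw); rewrite clockwise_offset => /andP[/andP[q0 qr] rs].
rewrite [\sum_(x | inarc p q x) _]big1; last first.
  move=> x hx; rewrite big1 // => y hy; apply: (m0 _ _ (seg p r)) => //.
  apply: crossing_cw; move: hx hy; rewrite !(inarc_offset p) offset_id => hx hy.
  have [x0 xr ry] : [/\ 0 < offset p x, offset p x < offset p r & offset p r < offset p y]%N.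
    by move: hx hy q0 qr rs; clear; move: (offset p x) (offset p y) (offset p q) (offset p r) (offset p s); split; lia.
  by apply: (offset_clockwise _ xr ry); rewrite offset_id.
rewrite mulr0 !subr0 add0r ?addr0 => -> /esym/eqP; rewrite mulf_eq0 /= => /eqP.
rewrite (bigD1 r) /=; last by rewrite (inarc_offset p); move: q0 qr rs; clear; lia.
rewrite (bigD1 p) /=; last by rewrite (inarc_offset p) offset_id; move: q0 qr rs; clear; lia.
rewrite !big1 ?addr0; first by rewrite seg_sym.
- move=> x /andP[hx nxr]; rewrite big1 // => y hy; apply: (m0 _ _ (seg q r)) => //.
  have : offset p x != offset p r by apply: contra nxr => /eqP/offset_inj->.
  move: hx hy; rewrite !(inarc_offset p) offset_id => hx hy ne.
  have [qx xr] : [/\ offset p q < offset p x & offset p x < offset p r]%N.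
    by move: hx hy q0 qr rs ne; clear; move: (offset p x) (offset p y) (offset p q) (offset p r) (offset p s); split; lia.
  apply: crossing_cw; have [->|ny] := eqVneq y p.
    by rewrite -clockwise_rot; apply: (offset_clockwise _ qx xr); rewrite offset_id.
  have ny0 : offset p y != 0%N by apply: contra ny => /eqP/offset_eq0->.
  have ry : (offset p r < offset p y)%N by move: hy ny0 rs; clear; lia.
  exact: (offset_clockwise qx xr ry).
- move=> y /andP[hy nyp]; apply: (m0 _ _ (seg p s)) => //.
  have ny0 : offset p y != 0%N by apply: contra nyp => /eqP/offset_eq0->.
  move: hy; rewrite !(inarc_offset p) offset_id => hy.
  have sy : (offset p s < offset p y)%N by move: hy ny0; clear; lia.
  by apply: crossing_cw; apply: (offset_clockwise _ rs sy); rewrite offset_id (ltn_trans q0 qr).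
Qed.

End XSpaceCombinatorics.

(** * Functions on the X-space *)

Section XSpace.
Variables (n : nat) (K : fieldType) (A : {set 'I_n.+3} -> K).
Hypothesis hA : Atilde_functions A.
Notation V := 'I_n.+3.
Notation exps := {ffun {set V} -> int}.
Implicit Types (a b p q r s : V) (e f : {set V}) (m : exps)
  (T : {set {set V}}) (L : seq (int * exps)) (M : seq exps).
Notation mon := (mon A).
Notation lsum := (lsum A).
Notation msum := (msum A).

Lemma mon_sum (P : pred {set V}) (F : {set V} -> exps) :
  mon (\sum_(e | P e) F e) = \prod_(e | P e) mon (F e).
Proof. by apply: (big_morph mon (monD hA) (mon0 A)). Qed.

(** The exponents of the X-coordinate of [e], with the same choice of quadrilateral. *)
Definition chart_cross_ratio T e : exps :=
  if [pick v : V * V * (V * V) | quad T e v.1.1 v.1.2 v.2.1 v.2.2]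
    is Some ((p, q), (r, s)) then cross_ratio p q r s else 0.

Lemma chart_cross_ratioP T e : complete_triangulation T -> e \in T ->
  exists p q r s, quad T e p q r s /\ chart_cross_ratio T e = cross_ratio p q r s.
Proof.
move=> cT eT; rewrite /chart_cross_ratio; case: pickP => [[[p q] [r s]] qd|h]; first by exists p, q, r, s.
have [p [q [r [s qd]]]] := quad_exists cT eT.
by have := h ((p, q), (r, s)); rewrite /= qd.
Qed.

Lemma Xcoord_mon T e : complete_triangulation T -> e \in T -> Xcoord A T e = mon (chart_cross_ratio T e).
Proof.
move=> cT eT; rewrite /Xcoord /chart_cross_ratio; case: pickP => [[[p q] [r s]] /= qd|h]; last first.
  have [p [q [r [s qd]]]] := quad_exists cT eT.
  by have := h ((p, q), (r, s)); rewrite /= qd.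
have [_ _ _ _ cw] := quad_sides qd; have [n1 _ n3 [n4 _ n6]] := clockwise_neq cw.
rewrite cross_ratioE !(monD hA) !(monN hA) !mon_delta ?card_seg ?n1 ?n3 ?n4 ?n6 //.
by rewrite invfM !mulrA.
Qed.

Lemma tsup_chart_cross_ratio T e : complete_triangulation T -> e \in T -> tsup T (chart_cross_ratio T e).
Proof.
move=> cT eT; have [p [q [r [s [qd ->]]]]] := chart_cross_ratioP cT eT.
have [h1 h2 h3 h4 _] := quad_sides qd.
by rewrite cross_ratioE; apply: tsupB; [apply: tsupB; first apply: tsupD|]; apply: tsup_delta.
Qed.

Lemma deg0D m1 m2 : deg0 m1 -> deg0 m2 -> deg0 (m1 + m2).
Proof. by move=> h1 h2 a; rewrite cutD h1 h2. Qed.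

Lemma deg0Mz m (c : int) : deg0 m -> deg0 (m *~ c).
Proof. by move=> h a; rewrite cutMz h mul0r. Qed.

Lemma deg0_sum_cross_ratio T (c : {set V} -> int) : complete_triangulation T ->
  deg0 (\sum_(e in T) chart_cross_ratio T e *~ c e).
Proof.
move=> cT; apply: big_ind => [a|m1 m2|e eT]; [exact: cut0|exact: deg0D|].
apply: deg0Mz; have [p [q [r [s [qd ->]]]]] := chart_cross_ratioP cT eT.
by apply: deg0_cross_ratio; case: (quad_sides qd).
Qed.

Lemma tsupMz T m (c : int) : tsup T m -> tsup T (m *~ c).
Proof. by move=> h e eT; rewrite exps_mulz h // mul0r. Qed.

Lemma tsup_sum_cross_ratio T (c : {set V} -> int) : complete_triangulation T ->
  tsup T (\sum_(e in T) chart_cross_ratio T e *~ c e).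
Proof.
move=> cT; apply: big_ind => [|m1 m2|e eT]; [exact: tsup0|exact: tsupD|].
by apply: tsupMz; apply: tsup_chart_cross_ratio.
Qed.

(** By [cut_cross_ratio] the coefficients have to be the half cuts along [T], and
[chart_cut_inj] shows that these do. *)
Lemma deg0_chart T m : complete_triangulation T -> tsup T m -> deg0 m ->
  exists c : {set V} -> int, m = \sum_(e in T) chart_cross_ratio T e *~ c e.
Proof.
move=> cT tm d0.
have [c hc] := half_cut d0; exists c.
apply/eqP; rewrite -subr_eq0; apply/eqP; apply: (chart_cut_inj cT).
- by apply: tsupB => //; apply: tsup_sum_cross_ratio.
- by move=> a; rewrite cutB d0 deg0_sum_cross_ratio // subrr.
move=> a b abT; rewrite cutB cut_sum hc (bigD1 (seg a b)) //= big1 => [|e /andP[eT ne]].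
  have [p [q [r [s [qd ->]]]]] := chart_cross_ratioP cT abT.
  by rewrite cutMz (cut_cross_ratio cT abT qd abT) eqxx mulr1 addr0 subrr.
have [p [q [r [s [qd ->]]]]] := chart_cross_ratioP cT eT.
by rewrite cutMz (cut_cross_ratio cT eT qd abT) eq_sym (negbTE ne) mulr0 mul0r.
Qed.

Lemma Xprod_mon T (c : {set V} -> int) : complete_triangulation T ->
  \prod_(e in T) Xcoord A T e ^ c e = mon (\sum_(e in T) chart_cross_ratio T e *~ c e).
Proof. by move=> cT; rewrite mon_sum; apply: eq_bigr => e eT; rewrite Xcoord_mon // monMz. Qed.

Lemma Lplus_X_msum M : (forall m, m \in M -> [/\ onseg m, pos m & deg0 m]) ->
  Lplus (Xspace A) (msum M).
Proof.
move=> h [T cT] /=; rewrite /nonneg_laurent /=.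
elim: M h => [|m M IH] h.
  by exists [::]; rewrite /msum !big_nil.
have [|s Es] := IH; first by move=> m1 m1M; apply: h; rewrite in_cons m1M orbT.
have [|sm pm dm] := h m; first by rewrite mem_head.
have [M1 [E1 h1]] := expands_pos hA cT sm pm.
have h2 m1 : exists c : {ffun {set V} -> int}, m1 \in M1 -> m1 = \sum_(e in T) chart_cross_ratio T e *~ c e.
  have [m1M|] := boolP (m1 \in M1); last by exists 0.
  have [t1 [_ d1]] := h1 _ m1M.
  have [c Ec] : exists c : {set V} -> int, m1 = \sum_(e in T) chart_cross_ratio T e *~ c e.
    by apply: deg0_chart => // a; rewrite d1.
  by exists (finfun c) => _; rewrite {1}Ec; apply: eq_bigr => e _; rewrite ffunE.
have [c hc] := choice h2.
exists ([seq (1%N, c m1) | m1 <- M1] ++ s).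
rewrite /msum big_cons -/(msum M) E1 Es big_cat big_map /=; congr (_ + _).
by rewrite /msum; apply: eq_big_seq => m1 m1M; rewrite mul1r Xprod_mon // -hc.
Qed.

Lemma Lplus_X_expansion T h : complete_triangulation T -> Lplus (Xspace A) h ->
  exists L, [/\ lsup T L, lsum L = h, (forall m, 0 <= lco L m)
    & forall t, t \in L -> deg0 t.2].
Proof.
move=> cT /(_ (exist _ T cT))[s /= ->].
exists [seq (t.1%:Z, \sum_(e in T) chart_cross_ratio T e *~ t.2 e) | t : nat * exps <- s]; split.
- by move=> t /mapP[u _ ->]; exact: tsup_sum_cross_ratio.
- by rewrite /lsum big_map; apply: eq_bigr => t _ /=; rewrite -Xprod_mon // pmulrn.
- by move=> m; rewrite /lco big_map; apply: sumr_ge0.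
- by move=> t /mapP[u _ ->]; exact: deg0_sum_cross_ratio.
Qed.

(** The expansion of a function on the X-space in a chart only has terms of degree 0,
and all terms of the expansion of a monomial have its degree. *)
Lemma PstarP h : Pstar A h <-> exists m, [/\ onseg m, pos m, deg0 m & h = mon m].
Proof.
split=> [[hX /(PsetP hA)[m [sm pm Em]]]|[m [sm pm dm ->]]]; last first.
  split; last by apply/(PsetP hA); exists m.
  by rewrite -(@msum1 _ _ A); apply: Lplus_X_msum => m'; rewrite mem_seq1 => /eqP->.
exists m; split=> //.
have [T cT _] := extend_complete (@partial0 n).
have [L [sL EL _ dL]] := Lplus_X_expansion cT hX.
have [M [EM hM]] := expands_pos hA cT sm pm.
have sM : lsup T (ones M) by move=> t /mapP[u /hM[? _] ->].
have co : lco (ones M) =1 lco L.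
  by apply: (lsum_inj hA cT sM sL); rewrite lsum_ones -EM EL Em.
case: M EM hM sM co => [|m1 M] EM hM sM co.
  by have := mon_neq0 hA m; rewrite EM /msum big_nil eqxx.
have nz : lco L m1 != 0 by rewrite -co lco_ones /= eqxx.
have [t tL Et] := lco_in nz.
have [_ [_ d1]] := hM m1 (mem_head _ _).
by move=> a; rewrite -d1 -Et; exact: dL.
Qed.

End XSpace.

(** * Tropical points as degree-zero cluster monomials *)

Section TropicalPoints.
Variable (n : nat).
Notation V := 'I_n.+3.
Notation exps := {ffun {set V} -> int}.
Implicit Types (i j k a b p q r s x y : V) (e f : {set V}) (m c : exps)
  (T : {set {set V}}).

(** The normalization of the values off the diagonals required by [tropical]. *)
Definition ondiag c := forall e, ~~ diagonal e -> c e = 0.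

(** The exponents of the basis element [I_A A c]; compare [I_A_mon]. *)
Definition wvec c : exps :=
  \sum_(p : V) \sum_(q : V | (p < q)%N) delta (seg p q) *~ wexp c p q.

Lemma wexp_sym c p q : wexp c p q = wexp c q p.
Proof.
rewrite /wexp [seg q p]seg_sym [seg (ord_pred q) (ord_pred p)]seg_sym.
by rewrite [seg q (ord_pred p)]seg_sym [seg (ord_pred q) p]seg_sym; ring.
Qed.

Lemma onseg_wvec c : onseg (wvec c).
Proof.
rewrite /wvec; apply: big_ind => [e _|m1 m2|p _]; [by rewrite ffunE|exact: onsegD|].
apply: big_ind => [e _|m1 m2|q pq]; [by rewrite ffunE|exact: onsegD|].
move=> e ce; rewrite exps_mulz onseg_delta ?mul0r // card_seg ord_eqE.
by move: pq; clear; lia.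
Qed.

Lemma wvecE c p q : p != q -> wvec c (seg p q) = wexp c p q.
Proof.
have main p' q' : (p' < q')%N -> wvec c (seg p' q') = wexp c p' q'.
  move=> lt; have nep : (p' == q') = false by rewrite ord_eqE; move: lt; clear; lia.
  rewrite /wvec sum_ffunE (bigD1 p') //= addrC big1 ?add0r; last first.
    move=> u nup. have up := negbTE nup.
    rewrite sum_ffunE big1 // => v uv; rewrite exps_mulz deltaE seg_eq [p' == u]eq_sym up /=.
    have [E1|_] := eqVneq p' v; last by rewrite mul0r.
    have [E2|_] := eqVneq q' u; last by rewrite mul0r.
    by subst; move: lt uv; clear; lia.
  rewrite sum_ffunE (bigD1 q') //= big1 ?addr0 => [|v /andP[_ nvq]].
    by rewrite exps_mulz deltaE eqxx mul1r.
  have vq := negbTE nvq; rewrite exps_mulz deltaE seg_eq eqxx [q' == v]eq_sym vq [q' == p']eq_sym nep !andbF /=.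
  by rewrite mul0r.
rewrite ord_eqE neq_ltn => /orP[/main //|/main h].
by rewrite seg_sym h wexp_sym.
Qed.

Lemma inarc_ordS a b x : (inarc a b x)%:Z - (inarc a b (ordS x))%:Z = (x == b)%:Z - (x == a)%:Z.
Proof.
rewrite /inarc !ord_eqE ordS_val; have := ltn_ord x; have := ltn_ord a; have := ltn_ord b.
by case: ifP => /eqP; clear; move: (nat_of_ord x) (nat_of_ord a) (nat_of_ord b); lia.
Qed.

Lemma telescope_arc a b (g : V -> int) :
  \sum_(x | inarc a b x) (g x - g (ord_pred x)) = g b - g a.
Proof.
rewrite sumrB [X in _ - X](reindex_inj (can_inj (@ordSK n))) /=.
under [X in _ - X]eq_bigr do rewrite ordSK.
rewrite big_mkcond [X in _ - X]big_mkcond -sumrB.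
have -> : g b - g a = \sum_x ((x == b)%:Z - (x == a)%:Z) * g x.
  have S z : \sum_x (x == z)%:Z * g x = g z.
    rewrite (bigD1 z) //= eqxx mul1r big1 ?addr0 // => x nx.
    by rewrite (negbTE nx) mul0r.
  by under [RHS]eq_bigr do rewrite mulrBl; rewrite sumrB !S.
apply: eq_bigr => x _; rewrite -inarc_ordS mulrBl.
by congr (_ - _); case: ifP; rewrite ?mul1r ?mul0r.
Qed.

(** The exponents are second differences of [c], and their sum over the product of an
arc and its complement telescopes. *)
Lemma cut_wvec c a b : ondiag c -> cut a b (wvec c) = 2 * c (seg a b).
Proof.
move=> dc.
have z x : c (seg x x) = 0.
  by apply: dc; rewrite diagonalE card_seg eqxx.
have [->|nab] := eqVneq a b; first by rewrite cut_id z.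
rewrite /cut /Cut (eq_bigr (fun p => \sum_(q | ~~ inarc a b q) wexp c p q)); last first.
  move=> p hp; apply: eq_bigr => q hq; apply: wvecE.
  by apply: contraNneq hq => <-.
rewrite exchange_big /=.
pose H q := c (seg b q) - c (seg a q).
rewrite (eq_bigr (fun q => H q - H (ord_pred q))); last first.
  move=> q _; rewrite -[RHS](_ : \sum_(p | inarc a b p) ((c (seg p q) - c (seg p (ord_pred q)))
    - (c (seg (ord_pred p) q) - c (seg (ord_pred p) (ord_pred q)))) = _).
    by apply: eq_bigr => p _; rewrite /wexp [seg (ord_pred q) _]seg_sym; ring.
  by rewrite (telescope_arc a b (fun p => c (seg p q) - c (seg p (ord_pred q)))) /H; ring.
rewrite (eq_bigl (inarc b a)); last by move=> q; rewrite (inarc_sym q nab).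
by rewrite telescope_arc /H !z [seg b a]seg_sym; ring.
Qed.

Lemma deg0_wvec c : ondiag c -> deg0 (wvec c).
Proof.
move=> dc a; rewrite cut_wvec // dc ?mulr0 //.
by rewrite diagonalE edge_seg eqxx /= andbF.
Qed.

Lemma wvec_inj c1 c2 : ondiag c1 -> ondiag c2 -> wvec c1 = wvec c2 -> c1 = c2.
Proof.
move=> d1 d2 E; apply/ffunP => e; have [de|nde] := boolP (diagonal e); last by rewrite d1 // d2.
have [a [b [_ _ ->]]] := segP (diag_card de).
by apply: (@mulfI _ 2) => //; rewrite -!cut_wvec // E.
Qed.

(** The half cuts of [m] have the exponents [m] by [cut_cell]. *)
Lemma wvec_onto m : onseg m -> deg0 m -> exists c, ondiag c /\ wvec c = m.
Proof.
move=> sm dm.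
have [c0 hc] := half_cut dm.
pose c : exps := [ffun e => if diagonal e then c0 e else 0].
have dc : ondiag c by move=> e /negbTE de; rewrite ffunE de.
exists c; split=> //; apply: cut_inj => // [|a b]; first exact: onseg_wvec.
rewrite cut_wvec // ffunE; case: ifP => [_|nd]; first by rewrite hc.
have [->|nab] := eqVneq a b; first by rewrite cut_id mulr0.
have : edge (seg a b) by move: nd; rewrite diagonalE card_seg nab => /negbT; rewrite negbK.
by rewrite edge_seg mulr0 => /orP[] /eqP->; [rewrite dm|rewrite cut_sym dm].
Qed.

Lemma opposite_diag i j k l x y : clockwise i j k l -> inarc i j x -> inarc k l y ->
  diagonal (seg x y).
Proof.
move=> cw hx hy; suff cw' : clockwise x k y i by case/andP: (clockwise_diag cw').
rewrite -clockwise_rot clockwise_offset; move: cw hx hy.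
rewrite clockwise_offset !(inarc_offset i) offset_id.
by move: (offset i x) (offset i y) (offset i j) (offset i k) (offset i l); clear; lia.
Qed.

Lemma arc_clockwise i j k l x x' y y' : clockwise i j k l ->
  inarc i j x -> inarc j k x' -> inarc k l y -> inarc l i y' -> clockwise x x' y y'.
Proof.
rewrite clockwise_offset !(inarc_offset i) offset_id => cw hx hx' hy hy'.
have [x0 xx xy] : [/\ 0 < offset i x, offset i x < offset i x' & offset i x' < offset i y]%N.
  move: cw hx hx' hy; clear.
  by move: (offset i x) (offset i x') (offset i y) (offset i j) (offset i k) (offset i l) => *; split; lia.
have [E|ne] := eqVneq (offset i y') 0%N.
  by rewrite -clockwise_rot; apply: (offset_clockwise _ xx xy); rewrite E.
apply: (offset_clockwise xx xy); move: cw hx hx' hy hy' ne; clear.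
by move: (offset i x) (offset i x') (offset i y) (offset i y') (offset i j) (offset i k) (offset i l) => *; lia.
Qed.

Definition arc_pairs m i j k l := \sum_(x | inarc i j x) \sum_(y | inarc k l y) m (seg x y).

Lemma arc_pairs_ge0 m i j k l : pos m -> clockwise i j k l -> 0 <= arc_pairs m i j k l.
Proof.
move=> pm cw; apply: sumr_ge0 => x hx; apply: sumr_ge0 => y hy.
by apply: pm; exact: (opposite_diag cw hx hy).
Qed.

Lemma arc_pairs_ge m i j k l : pos m -> clockwise i j k l -> m (seg j l) <= arc_pairs m i j k l.
Proof.
move=> pm cw; have ij : inarc i j j by move: cw; rewrite /inarc /clockwise; clear; lia.
have kl : inarc k l l by move: cw; rewrite /inarc /clockwise; clear; lia.
rewrite /arc_pairs (bigD1 j) //= (bigD1 l) //= -addrA lerDl; apply: addr_ge0.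
  by apply: sumr_ge0 => y /andP[hy _]; apply: pm; exact: (opposite_diag cw ij hy).
apply: sumr_ge0 => x /andP[hx _]; apply: sumr_ge0 => y hy.
by apply: pm; exact: (opposite_diag cw hx hy).
Qed.

Lemma arc_pairs_witness m i j k l : 0 < arc_pairs m i j k l ->
  exists x y, [/\ inarc i j x, inarc k l y & 0 < m (seg x y)].
Proof.
move=> h; apply: contrapT => nh; move: h; rewrite ltNge => /negP; apply.
rewrite /arc_pairs -oppr_ge0 -sumrN; apply: sumr_ge0 => x hx; rewrite -sumrN; apply: sumr_ge0 => y hy.
by rewrite oppr_ge0 leNgt; apply/negP => h; apply: nh; exists x, y.
Qed.

(** One of the two inequalities contained in the tropical Pluecker relation, with its
defect; the other one is [wvec_defect'].  The segments counted by the one defect cross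
those counted by the other. *)
Lemma wvec_defect c i j k l : ondiag c -> clockwise i j k l ->
  c (seg i k) + c (seg j l) = c (seg i l) + c (seg j k) + arc_pairs (wvec c) i j k l.
Proof.
move=> dc cw; have := cut_defect (wvec c) cw; rewrite !cut_wvec // -/(arc_pairs _ _ _ _ _).
by move: (c _) (c _) (c _) (c _) (arc_pairs _ _ _ _ _); clear; lia.
Qed.

Lemma wvec_defect' c i j k l : ondiag c -> clockwise i j k l ->
  c (seg i k) + c (seg j l) = c (seg i j) + c (seg k l) + arc_pairs (wvec c) j k l i.
Proof.
move=> dc cw; have cw' : clockwise j k l i by rewrite -clockwise_rot.
have := wvec_defect dc cw'; rewrite [seg k i]seg_sym [seg j i]seg_sym.
by move: (c _) (c _) (c _) (c _) (arc_pairs _ _ _ _ _); clear; lia.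
Qed.

Lemma cell_clockwise p q : diagonal (seg p q) -> clockwise (ord_pred p) p (ord_pred q) q.
Proof.
rewrite diag_seg /clockwise !ord_pred_val; have := ltn_ord p; have := ltn_ord q.
by case: ifP => /eqP; case: ifP => /eqP; move: (nat_of_ord p) (nat_of_ord q); clear; lia.
Qed.

Lemma trop_ondiag c : tropical c -> ondiag c. Proof. by case. Qed.

(** The tropical relation for two consecutive pairs of vertices gives the sign of an
exponent; in general it says that one of the two defects vanishes, which excludes
crossings. *)
Lemma tropical_lam c : tropical c -> lam (wvec c).
Proof.
move=> tc; have dc := trop_ondiag tc; have [_ pl] := tc.
have pm : pos (wvec c).
  move=> e de; have [p [q [_ npq E]]] := segP (diag_card de); subst e.
  rewrite wvecE //; have := pl _ _ _ _ (cell_clockwise de).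
  rewrite /wexp [seg (ord_pred q) (ord_pred p)]seg_sym => h.
  have : c (seg (ord_pred p) q) + c (seg p (ord_pred q))
     <= c (seg (ord_pred p) (ord_pred q)) + c (seg p q) by rewrite h le_max lexx orbT.
  by move: (c _) (c _) (c _) (c _); clear; lia.
split=> //; first exact: onseg_wvec.
move=> e f de df me mf; apply/negP => cr.
have [a [b [_ _ Ee]]] := segP (diag_card de); subst e.
have [s [t [Ef cw]]] := crossingP cr; subst f.
have cw' : clockwise s b t a by rewrite -clockwise_rot.
have h1 := arc_pairs_ge pm cw; have h2 := arc_pairs_ge pm cw'.
rewrite [seg b a]seg_sym in h2.
have h3 := wvec_defect dc cw; have h4 := wvec_defect' dc cw.
have := pl _ _ _ _ cw; rewrite maxEle; case: ifP => _;
  move: h1 h2 h3 h4 me mf; move: (arc_pairs _ _ _ _ _) (arc_pairs _ _ _ _ _);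
  move: (c _) (c _) (c _) (c _) (c _) (c _) (wvec c _) (wvec c _); clear; lia.
Qed.

(** If both defects were positive there would be two crossing diagonals. *)
Lemma lam_tropical c : ondiag c -> lam (wvec c) -> tropical c.
Proof.
move=> dc [sm pm nc]; split=> // i j k l cw.
have cw' : clockwise j k l i by rewrite -clockwise_rot.
have h1 := arc_pairs_ge0 pm cw; have h2 := arc_pairs_ge0 pm cw'.
have h3 := wvec_defect dc cw; have h4 := wvec_defect' dc cw.
have h5 : ~~ ((0 < arc_pairs (wvec c) i j k l) && (0 < arc_pairs (wvec c) j k l i)).
  apply/negP => /andP[/arc_pairs_witness[x [y [hx hy mxy]]] /arc_pairs_witness[x' [y' [hx' hy' mxy']]]].
  have := nc _ _ (opposite_diag cw hx hy) (opposite_diag cw' hx' hy') mxy mxy'.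
  by rewrite clockwise_crossing // (arc_clockwise cw).
rewrite maxEle; case: ifP; move: h1 h2 h3 h4 h5;
  move: (arc_pairs _ _ _ _ _) (arc_pairs _ _ _ _ _);
  move: (c _) (c _) (c _) (c _) (c _) (c _); clear; lia.
Qed.

End TropicalPoints.

(** * Stasheff polytopes *)

Section TropicalCharts.
Variables (n : nat) (K : fieldType) (A : {set 'I_n.+3} -> K).
Hypothesis hA : Atilde_functions A.
Notation V := 'I_n.+3.
Notation exps := {ffun {set V} -> int}.
Implicit Types (i j k a b p q r s x y : V) (e f : {set V}) (m c : exps)
  (T : {set {set V}}) (M : seq exps).
Notation mon := (mon A).
Notation lsum := (lsum A).
Notation msum := (msum A).

(** The tropical value of a subtraction-free expression, [ev] being the value of its
terms. *)
Definition is_max (ev : exps -> int) M (z : int) :=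
  (exists2 m, m \in M & ev m = z) /\ (forall m, m \in M -> ev m <= z).

Lemma is_max_exists ev M : M != [::] -> exists z, is_max ev M z.
Proof.
elim: M => // m M IH _; case: (eqVneq M [::]) => [->|/IH[z [[u uM Eu] hz]]].
  exists (ev m); split; first by exists m; rewrite ?mem_head.
  by move=> u; rewrite mem_seq1 => /eqP->.
exists (Num.max (ev m) z); split.
  rewrite maxEle; case: ifP => _; first by exists u; rewrite // in_cons uM orbT.
  by exists m; rewrite ?mem_head.
by move=> w; rewrite in_cons le_max => /orP[/eqP->|/hz ->]; rewrite ?lexx ?orbT.
Qed.

Lemma is_max_uniq ev M1 M2 z1 z2 : M1 =i M2 -> is_max ev M1 z1 -> is_max ev M2 z2 -> z1 = z2.
Proof.
move=> E [[m1 h1 <-] g1] [[m2 h2 <-] g2]; apply/eqP; rewrite eq_le.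
by rewrite g2 -?E // g1 // E.
Qed.

Lemma is_max_cat ev M1 M2 z1 z2 : is_max ev M1 z1 -> is_max ev M2 z2 ->
  is_max ev (M1 ++ M2) (Num.max z1 z2).
Proof.
move=> [[m1 h1 e1] g1] [[m2 h2 e2] g2]; split.
  rewrite maxEle; case: ifP => _.
    by exists m2; rewrite // mem_cat h2 orbT.
  by exists m1; rewrite // mem_cat h1.
by move=> m; rewrite mem_cat le_max => /orP[/g1|/g2] ->; rewrite ?orbT.
Qed.

Lemma is_max_mul ev M1 M2 z1 z2 : {morph ev : m1 m2 / m1 + m2} ->
  is_max ev M1 z1 -> is_max ev M2 z2 -> is_max ev (msums M1 M2) (z1 + z2).
Proof.
move=> evD [[m1 h1 e1] g1] [[m2 h2 e2] g2]; split.
  by exists (m1 + m2); [apply/allpairsP; exists (m1, m2)|rewrite evD e1 e2].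
by move=> m /allpairsP[[u w] /= [hu hw ->]]; rewrite evD lerD ?g1 ?g2.
Qed.

(** The Laurent expansions of the [A e] in [T] are subtraction-free and satisfy the
Pluecker relations, so their tropicalizations at [v] satisfy the tropical ones. *)
Lemma tropical_chart T (v : {set V} -> int) : complete_triangulation T ->
  exists x : exps, tropical x /\ forall e, e \in T -> x e = v e.
Proof.
move=> cT; have pT := complete_partial cT.
pose ev m : int := \sum_(e in T) m e * v e.
have evD : {morph ev : m1 m2 / m1 + m2}.
  move=> m1 m2; rewrite /ev -big_split; apply: eq_bigr => e _ /=.
  by rewrite ffunE mulrDl.
have hM e : exists M, #|e| == 2%N -> [/\ A e = msum M, (forall m, m \in M -> tsup T m)
    & (e \in with_edges T -> M = [:: delta e])].
  have [ce|ce] := boolP (#|e| == 2%N); last by exists [::].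
  have [eT|eT] := boolP (e \in with_edges T).
    exists [:: delta e] => _; split=> //; first by rewrite msum1 mon_delta.
    by move=> m; rewrite mem_seq1 => /eqP->; apply: tsup_delta.
  have [M [EM hM]] := expands_seg hA cT ce.
  by exists M => _; split=> //; [rewrite -EM mon_delta|move=> m /hM[]].
have [Me hMe] := choice hM.
have hx e : exists z, #|e| == 2%N -> is_max ev (Me e) z.
  have [ce|ce] := boolP (#|e| == 2%N); last by exists 0.
  have [E1 _ _] := hMe e ce.
  have [|z hz] := @is_max_exists ev (Me e); last by exists z.
  by apply: contraTneq (A_neq0 hA ce) => E; rewrite E1 E /msum big_nil eqxx.
have [x0 hx0] := choice hx.
pose x : exps := [ffun e => if diagonal e then x0 e else 0].
have evd e : ev (delta e) = if e \in T then v e else 0.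
  rewrite /ev; case: ifP => eT.
    rewrite (bigD1 e) //= big1 ?addr0 => [|f /andP[_ /negbTE fe]]; first by rewrite deltaE eqxx mul1r.
    by rewrite deltaE fe mul0r.
  rewrite big1 // => f fT; rewrite deltaE; have [E|_] := eqVneq f e; last by rewrite mul0r.
  by rewrite -E fT in eT.
have x0T e : e \in with_edges T -> x0 e = if e \in T then v e else 0.
  move=> eT; have ce := chart_card pT eT; have [_ _ /(_ eT) E] := hMe e ce.
  have [[m + <-] _] := hx0 e ce; rewrite E mem_seq1 => /eqP->; exact: evd.
have xE e : #|e| == 2%N -> x e = x0 e.
  move=> ce; rewrite ffunE diagonalE ce /=; case: ifP => // /negbFE ee.
  rewrite x0T ?with_edgesE ?ee ?orbT //; case: ifP => // eT.
  by have := (ptriP _ pT).1 _ eT; rewrite diagonalE ee andbF.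
exists x; split; last first.
  move=> e eT; have eT' : e \in with_edges T by rewrite with_edgesE eT.
  by rewrite xE ?(chart_card pT eT') // x0T // eT.
split=> [e /negbTE de|i j k l cw]; first by rewrite ffunE de.
have [n1 n2 n3 [n4 n5 n6]] := clockwise_neq cw.
rewrite !xE ?card_seg //.
have cij : #|seg i j| == 2%N by rewrite card_seg.
have cik : #|seg i k| == 2%N by rewrite card_seg.
have cil : #|seg i l| == 2%N by rewrite card_seg.
have cjk : #|seg j k| == 2%N by rewrite card_seg.
have cjl : #|seg j l| == 2%N by rewrite card_seg.
have ckl : #|seg k l| == 2%N by rewrite card_seg.
have [Eij tij _] := hMe _ cij; have [Eik tik _] := hMe _ cik; have [Eil til _] := hMe _ cil.
have [Ejk tjk _] := hMe _ cjk; have [Ejl tjl _] := hMe _ cjl; have [Ekl tkl _] := hMe _ ckl.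
have pl := hA.1 _ _ _ _ cw.
rewrite Eij Eik Eil Ejk Ejl Ekl -!msum_mul // -msum_cat in pl.
have tm M1 M2 : (forall m, m \in M1 -> tsup T m) -> (forall m, m \in M2 -> tsup T m) ->
    forall m, m \in msums M1 M2 -> tsup T m.
  by move=> h1 h2 m /allpairsP[[u w] /= [/h1 hu /h2 hw ->]]; apply: tsupD.
have so M : (forall m, m \in M -> tsup T m) -> lsup T (ones M).
  by move=> h t /mapP[u /h hu ->].
apply: (@is_max_uniq ev (msums (Me (seg i k)) (Me (seg j l)))
    (msums (Me (seg i j)) (Me (seg k l)) ++ msums (Me (seg i l)) (Me (seg j k)))).
- have co : lco (ones (msums (Me (seg i k)) (Me (seg j l)))) =1
    lco (ones (msums (Me (seg i j)) (Me (seg k l)) ++ msums (Me (seg i l)) (Me (seg j k)))).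
    apply: (lsum_inj hA cT); rewrite ?lsum_ones //; apply: so; first exact: tm.
    by move=> m; rewrite mem_cat => /orP[]; apply: tm.
  by move=> m; rewrite -!has_pred1 !has_count; have := co m; rewrite !lco_ones => -[->].
- by apply: is_max_mul => //; apply: hx0.
- by apply: is_max_cat; apply: is_max_mul => //; apply: hx0.
Qed.

Variable R : realType.

Lemma realify_tropical c : tropical c -> tropical (realify R c).
Proof.
move=> [dc pl]; split=> [e de|i j k l cw]; first by rewrite ffunE dc.
by rewrite !ffunE -!intrD pl //= !maxEle ler_int; case: ifP.
Qed.

Lemma three_noncrossing e1 e2 e3 : ~~ crossing e1 e2 -> ~~ crossing e1 e3 -> ~~ crossing e2 e3 ->
  forall e f, [|| e == e1, e == e2 | e == e3] -> [|| f == e1, f == e2 | f == e3] ->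
  ~~ crossing e f.
Proof.
move=> h12 h13 h23 e f /or3P[] /eqP-> /or3P[] /eqP->.
- exact: crossing_self.
- exact: h12.
- exact: h13.
- by rewrite crossing_sym; exact: h12.
- exact: crossing_self.
- exact: h23.
- by rewrite crossing_sym; exact: h13.
- by rewrite crossing_sym; exact: h23.
- exact: crossing_self.
Qed.

(** Complete [pq], [p(q-1)] and [(p-1)q] to a triangulation [T].  A tropical point
equal to [c] on [T] is in the face of [T], hence satisfies the inequality at
[(p-1)(q-1)] by the Stasheff property; the tropical relation for these four vertices
turns it into the sign of the exponent at [pq]. *)
Lemma stasheff_wvec_pos c (cR : {set V} -> R) : stasheff cR -> ondiag c ->
  (forall e, diagonal e -> cR e = (c e)%:~R) -> pos (wvec c).
Proof.
move=> st dc cE e de; have [p [q [_ npq E]]] := segP (diag_card de); subst e.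
have cw := cell_clockwise de.
have [p' Ep] : exists p', ord_pred p = p' by exists (ord_pred p).
have [q' Eq] : exists q', ord_pred q = q' by exists (ord_pred q).
rewrite Ep Eq in cw.
pose T1 := [set e | diagonal e && ((e == seg p q') || (e == seg p' q))]%SET.
have T1E e : (e \in T1) = diagonal e && ((e == seg p q') || (e == seg p' q)).
  by rewrite finset.in_set.
pose T0 := (seg p q |: T1)%SET.
have T0E e : (e \in T0) = (e == seg p q) || (e \in T1) by rewrite finset.in_setU1.
have sh x y z : ~~ crossing (seg x y) (seg x z) by rewrite [seg x y]seg_sym crossing_share.
have par : ~~ crossing (seg p q') (seg p' q).
  by rewrite crossing_seg; move: cw; rewrite /clockwise; clear; lia.
have sh' x y z : ~~ crossing (seg y x) (seg z x) by rewrite [seg z x]seg_sym crossing_share.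
have pT0 : partial_triangulation T0.
  apply/ptriP; split=> [e|e f]; rewrite !T0E !T1E.
    by case/orP => [/eqP->//|/andP[]].
  move=> he hf; apply: (three_noncrossing (sh p q q') (sh' q p p') par).
    by case/orP: he => [->//|/andP[_ ->]]; rewrite orbT.
  by case/orP: hf => [->//|/andP[_ ->]]; rewrite orbT.
have [T cT T0T] := extend_complete pT0.
have T1T : T1 \subset T.
  apply/fintype.subsetP => e eT1; apply: (fintype.subsetP T0T).
  by rewrite T0E eT1 orbT.
have pT1 : partial_triangulation T1.
  have [h1 h2] := ptriP _ pT0; apply/ptriP; split=> [e h|e f he hf].
    by apply: h1; rewrite T0E h orbT.
  by apply: h2; rewrite T0E ?he ?hf orbT.
have [x [tx xT]] := tropical_chart c cT.
have pT := complete_partial cT; have [hd _] := ptriP _ pT.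
have fx : face cR T (realify R x).
  split; first exact: realify_tropical.
    by move=> e eT; rewrite ffunE xT // cE // hd.
  move=> e; rewrite /compatible finset.in_set => /and3P[dgE eT /forall_inP nc].
  by case/negP: eT; have [_ mx] := (completeP T).1 cT; apply: (mx _ dgE) => f fT; exact: nc.
have [_ _ fle] := st T1 T pT1 pT T1T _ fx.
have dpq' : diagonal (seg p' q') by case/andP: (clockwise_diag cw).
have [m1 m2 m3 [m4 m5 m6]] := clockwise_neq cw.
have le1 : x (seg p' q') <= c (seg p' q').
  have := fle (seg p' q'); rewrite ffunE cE // ler_int; apply.
  rewrite /compatible finset.in_set; apply/and3P; split=> //.
    by rewrite T1E !seg_eq !eqxx (negbTE m1) (negbTE m3) [q' == p]eq_sym (negbTE m4) (negbTE m6) /= ?andbF.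
  apply/forall_inP => f; rewrite T1E => /andP[_ /orP[] /eqP->].
    exact: sh'.
  exact: sh.
have xc e : e \in T0 -> x e = c e by move=> h; apply: xT; apply: (fintype.subsetP T0T).
have x1 : x (seg p q) = c (seg p q) by apply: xc; rewrite T0E eqxx.
have xd y z : (seg y z == seg p q') || (seg y z == seg p' q) -> x (seg y z) = c (seg y z).
  move=> h; have [dyz|ndg] := boolP (diagonal (seg y z)).
    by apply: xc; rewrite T0E T1E dyz h orbT.
  by rewrite (trop_ondiag tx) // dc.
have x2 : x (seg p q') = c (seg p q') by apply: xd; rewrite eqxx.
have x3 : x (seg p' q) = c (seg p' q) by apply: xd; rewrite eqxx orbT.
have := tx.2 _ _ _ _ cw; rewrite wvecE // /wexp Ep Eq [seg q' p']seg_sym.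
move=> h1.
have h2 : x (seg p' q) + x (seg p q') <= x (seg p' q') + x (seg p q).
  by rewrite h1 le_max lexx orbT.
rewrite x1 x2 x3 in h2; move: le1 h2.
by move: (c _) (c _) (c _) (c _) (x _); clear; lia.
Qed.

Lemma pos_submodular c i j k l : ondiag c -> pos (wvec c) -> clockwise i j k l ->
  c (seg i l) + c (seg j k) <= c (seg i k) + c (seg j l)
  /\ c (seg i j) + c (seg k l) <= c (seg i k) + c (seg j l).
Proof.
move=> dc pm cw; have cw' : clockwise j k l i by rewrite -clockwise_rot.
rewrite {1}(wvec_defect dc cw) (wvec_defect' dc cw) !lerDl.
by split; apply: arc_pairs_ge0.
Qed.

(** A point of the face of [T2] satisfies [x e <= c e] on all diagonals.  If [e]
crosses [f] in [T2], the tropical relation and induction bound [x e + x f] by the sum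
of [c] over two opposite sides of the quadrilateral of [e] and [f]; by submodularity
this is at most [c e + c f], and [x f = c f]. *)
Lemma pos_stasheff c (cR : {set V} -> R) : ondiag c -> pos (wvec c) ->
  (forall e, diagonal e -> cR e = (c e)%:~R) -> stasheff cR.
Proof.
move=> dc pm cE T1 T2 p1 p2 T12 x [tx xT2 xc2].
have key e : x e <= (c e)%:~R.
  have [de|nde] := boolP (diagonal e); last by rewrite tx.1 // dc.
  move: {2}(ncross T2 e).+1 (ltnSn (ncross T2 e)) => N; elim: N e de => // N IH e de lt.
  have IH' f : (ncross T2 f < ncross T2 e)%N -> x f <= (c f)%:~R.
    move=> lt'; have [df|ndf] := boolP (diagonal f); last by rewrite tx.1 // dc.
    by apply: IH => //; apply: leq_trans lt' _; rewrite -ltnS.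
  have [eT2|eT2] := boolP (e \in T2); first by rewrite xT2 // cE.
  have [z|] := eqVneq (ncross T2 e) 0%N.
    rewrite -cE //; apply: xc2; rewrite /compatible finset.in_set; apply/and3P; split=> //.
    by apply/forall_inP => f fT2; exact: (ncross0 z fT2).
  rewrite -lt0n => /ncross_gt0[f fT2 cr].
  have [a [b [_ _ E]]] := segP (diag_card de); subst e.
  have [a' [b' [Ef cw [n1 n2 n3 n4]]]] := ncross_sides p2 fT2 cr; subst f.
  have df : diagonal (seg a' b') by apply: (ptriP _ p2).1.
  have [s1 s2] := pos_submodular dc pm cw.
  have := tx.2 _ _ _ _ cw; rewrite (xT2 _ fT2) cE // => h.
  have : x (seg a b) + (c (seg a' b'))%:~R <= (c (seg a b) + c (seg a' b'))%:~R.
    rewrite h ge_max; apply/andP; split.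
      by apply: le_trans (lerD (IH' _ n1) (IH' _ n3)) _; rewrite -intrD ler_int.
    by apply: le_trans (lerD (IH' _ n4) (IH' _ n2)) _; rewrite -intrD ler_int.
  by rewrite intrD lerD2r.
split=> // e; first by move=> eT1; apply: xT2; apply: (fintype.subsetP T12).
by rewrite /compatible finset.in_set => /and3P[de _ _]; rewrite cE.
Qed.

End TropicalCharts.

(** * Supports *)

Section Supports.
Variables (n : nat) (K : fieldType) (A : {set 'I_n.+3} -> K).
Hypothesis hA : Atilde_functions A.
Notation V := 'I_n.+3.
Notation exps := {ffun {set V} -> int}.
Implicit Types (a b p q r s x y : V) (e f : {set V}) (m l : exps)
  (T : {set {set V}}) (M : seq exps).
Notation mon := (mon A).
Notation lsum := (lsum A).
Notation msum := (msum A).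

Lemma I_A_mon l : I_A A l = mon (wvec l).
Proof.
rewrite /wvec (big_morph mon (monD hA) (mon0 A)); apply: eq_bigr => p _.
rewrite (big_morph mon (monD hA) (mon0 A)); apply: eq_bigr => q pq.
rewrite monMz // mon_delta // card_seg ord_eqE; move: pq; clear; lia.
Qed.

(** The multiplicities of the cluster monomials are their numbers of repetitions in [M]. *)
Definition resolution m M := mon m = msum M /\ forall u, u \in M -> lam u /\ dom u m.

Lemma expansion_coef m M c l : resolution m M -> expansion A (mon m) c -> tropical l ->
  c l = count_mem (wvec l) M.
Proof.
move=> [EM hM] [/finite_seqP[r0 Er0] Strop Ef] tl.
pose r := undup r0; have ur : uniq r := undup_uniq r0.
pose S : set exps := fun l => c l != 0.
have Er : S = [set` r]%classic.
  by rewrite /S Er0; apply/seteqP; split=> u /=; rewrite mem_undup.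
have rP u : (u \in r) = (c u != 0).
  apply/idP/idP => h; first by have : S u by rewrite Er.
  by have : S u := h; rewrite Er.
rewrite -/S Er -fsbig_seq // in Ef.
pose L := [seq (c u, wvec u) | u <- r].
have LL : lamlist L.
  by move=> t /mapP[u ur' ->]; apply: tropical_lam; apply: Strop; rewrite /= -rP.
have EL : lsum L = lsum (ones M).
  by rewrite lsum_ones -EM Ef /lsum big_map; apply: eq_bigr => u _; rewrite I_A_mon.
have := lam_coef_uniq hA LL _ EL (tropical_lam tl); rewrite lco_ones => <-; last first.
  by apply: lamlist_ones => u /hM[].
rewrite /lco big_map /= big_seq_cond.
rewrite (eq_bigl (fun u => (u \in r) && (u == l))); last first.
  move=> u; case ru : (u \in r) => //=; apply/eqP/eqP => [E|->//].
  apply: wvec_inj => //; apply: trop_ondiag => //; apply: Strop; rewrite /= -rP //.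
rewrite -big_seq_cond; have [lr|lr] := boolP (l \in r).
  by rewrite -big_filter filter_pred1_uniq // big_seq1.
rewrite big_seq_cond big1 => [|u /andP[uL /eqP E]]; last by rewrite -E uL in lr.
by apply/eqP; move: lr; rewrite rP negbK.
Qed.

Lemma expansion_resolution m M : deg0 m -> resolution m M ->
  expansion A (mon m) (fun l => if `[< tropical l >] then (count_mem (wvec l) M)%:Z else 0).
Proof.
move=> dm [EM hM].
have pre u : exists l, u \in M -> tropical l /\ wvec l = u.
  have [uM|_] := boolP (u \in M); last by exists 0.
  have [lu [_ du]] := hM u uM; have [su _ _] := lu.
  have [|l [dl El]] := wvec_onto su; first by move=> a; rewrite du dm.
  by exists l => _; split=> //; apply: lam_tropical => //; rewrite El.
have [g hg] := choice pre.
pose r := [seq g u | u <- undup M].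
have ur : uniq r.
  rewrite map_inj_in_uniq ?undup_uniq // => u v; rewrite !mem_undup => uM vM E.
  by rewrite -(hg u uM).2 E (hg v vM).2.
pose S : set exps := fun l =>
  (if `[< tropical l >] then (count_mem (wvec l) M)%:Z else 0) != 0.
have SE : S = [set` r]%classic.
  apply/seteqP; split=> l; rewrite /S /=.
    case: asboolP => [tl h|_]; last by rewrite eqxx.
    have wM : wvec l \in M by rewrite -has_pred1 has_count lt0n -eqz_nat.
    have [tg Eg] := hg _ wM.
    have -> : l = g (wvec l) by apply: wvec_inj => //; apply: trop_ondiag.
    by apply: map_f; rewrite mem_undup.
  move=> /mapP[u]; rewrite mem_undup => uM ->; have [tg Eg] := hg _ uM.
  case: asboolP => // _; rewrite Eg.
  by rewrite eqz_nat -lt0n -has_count has_pred1.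
split.
- by rewrite -/S SE.
- by move=> l /=; case: asboolP => // _; rewrite eqxx.
- rewrite -/S SE -fsbig_seq // /r big_map EM.
  rewrite -lsum_ones (@lsumE _ _ _ _ (undup M)) ?undup_uniq //; last first.
    by move=> u /mapP[t /mapP[w wM ->] ->] /=; rewrite mem_undup.
  apply: eq_big_seq => u; rewrite mem_undup => uM; have [tg Eg] := hg _ uM.
  by rewrite lco_ones I_A_mon Eg; case: asboolP.
Qed.

Lemma supp_setE m M : deg0 m -> resolution m M ->
  supp_set A (mon m) = (fun l => tropical l /\ wvec l \in M).
Proof.
move=> dm res; have ex := expansion_resolution dm res.
have h l : tropical l -> (coef A (mon m) l != 0) = (wvec l \in M).
  move=> tl; rewrite /coef.
  have ex' := xgetPex (fun _ => 0) (ex_intro _ _ ex).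
  by rewrite (expansion_coef res ex' tl) eqz_nat -lt0n -has_count has_pred1.
apply/seteqP; split=> l [tl hl]; split=> //; first by rewrite -(h l tl).
exact: (eq_ind_r is_true hl (h l tl)).
Qed.

Lemma resolution_exists m : onseg m -> pos m -> exists M, resolution m M
  /\ forall a b, exists2 l, l \in M & cut a b l = cut a b m.
Proof. by move=> sm pm; have [M [h1 h2 h3]] := resolve hA sm pm; exists M; split. Qed.

(** One direction is [resolve]; for the other one, compare [m] with the cluster
monomial [l] itself in [count_mono]. *)
Lemma in_resolution m M l : onseg m -> pos m -> resolution m M -> lam l ->
  (l \in M) <-> dom l m.
Proof.
move=> sm pm [EM hM] ll; split=> [/hM[]//|d].
have [sl pl _] := ll.
have := @count_mono _ _ _ hA l m [:: l] M l sl pl sm pm d.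
rewrite msum1 => /(_ erefl EM); rewrite -has_pred1 has_count /= eqxx; apply.
  by move=> u; rewrite mem_seq1 => /eqP->.
by move=> u /hM[].
Qed.

Lemma dom_deg0 m1 m2 : deg0 m1 -> deg0 m2 ->
  (forall a b, cut a b m1 <= cut a b m2) -> dom m1 m2.
Proof. by move=> d1 d2 h; split=> // a; rewrite d1 d2. Qed.

Lemma supp_set_dom m : onseg m -> pos m -> deg0 m ->
  supp_set A (mon m) = (fun l => tropical l /\ dom (wvec l) m).
Proof.
move=> sm pm dm; have [M [res _]] := resolution_exists sm pm.
rewrite (supp_setE dm res).
by apply/seteqP; split=> l [tl h]; split=> //; apply/(in_resolution sm pm res (tropical_lam tl)).
Qed.

Lemma supp_set_wvec c : ondiag c -> pos (wvec c) ->
  supp_set A (mon (wvec c)) = (fun l => tropical l /\ forall e, diagonal e -> l e <= c e).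
Proof.
move=> dc pc; rewrite supp_set_dom //; [|exact: onseg_wvec|exact: deg0_wvec].
apply/seteqP; split=> l [tl h]; split=> //; have dl := trop_ondiag tl.
  move=> e de; have [a [b [_ _ ->]]] := segP (diag_card de).
  by have [+ _] := h => /(_ a b); rewrite !cut_wvec // ler_pM2l.
apply: dom_deg0; [exact: deg0_wvec|exact: deg0_wvec|move=> a b].
rewrite !cut_wvec // ler_pM2l //.
by have [de|nde] := boolP (diagonal (seg a b)); [exact: h|rewrite dl // dc].
Qed.

(** Each cut of [m1] is attained at a point of its support. *)
Lemma supp_set_subset m1 m2 : onseg m1 -> pos m1 -> deg0 m1 -> onseg m2 -> pos m2 -> deg0 m2 ->
  (supp_set A (mon m1) `<=` supp_set A (mon m2))%classic <-> dom m1 m2.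
Proof.
move=> s1 p1 d1 s2 p2 d2; rewrite !supp_set_dom //; split=> [sub|d l [tl h]]; last first.
  by split=> //; apply: dom_trans d.
apply: dom_deg0 => // a b.
have [M [[EM hM] att]] := resolution_exists s1 p1; have [u uM <-] := att a b.
have [lu du] := hM u uM; have [su _ _] := lu.
have [|l [dl El]] := wvec_onto su; first by move=> a'; rewrite du.2 d1.
have tl : tropical l by apply: lam_tropical => //; rewrite El.
by have [|_ [+ _]] := sub l; [rewrite El|rewrite El => h; exact: h].
Qed.

Lemma sub_multiset M1 M2 : (forall u, (count_mem u M1 <= count_mem u M2)%N) ->
  exists M3, perm_eq M2 (M1 ++ M3).
Proof.
elim: M1 M2 => [|u M1 IH] M2 h; first by exists M2.
have uM2 : u \in M2.
  by rewrite -has_pred1 has_count; apply: leq_trans (h u); rewrite /= eqxx.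
have pe := perm_to_rem uM2.
have [|M3 p3] := IH (rem u M2).
  by move=> v; have := h v; rewrite (permP pe) /= leq_add2l.
by exists M3; apply: perm_trans pe _; rewrite /= perm_cons.
Qed.

(** If [dom m1 m2], the multiplicities grow and the difference is again a sum of
cluster monomials.  Conversely, the multiplicity of a cluster monomial is a
coefficient in a chart of the X-space, where the difference has coefficients at least
0, so the supports are included. *)
Lemma Lle_dom m1 m2 : onseg m1 -> pos m1 -> deg0 m1 -> onseg m2 -> pos m2 -> deg0 m2 ->
  Lle (Xspace A) (mon m1) (mon m2) <-> dom m1 m2.
Proof.
move=> s1 p1 d1 s2 p2 d2.
have [M1 [[E1 h1] att1]] := resolution_exists s1 p1.
have [M2 [[E2 h2] att2]] := resolution_exists s2 p2.
split=> [le|d]; last first.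
  have [|M3 pe] := @sub_multiset M1 M2.
    move=> u; apply: (count_mono hA u s1 p1 s2 p2 d E1 E2) => v; first by move/h1 => [].
    by move/h2 => [].
  rewrite /Lle; have -> : mon m2 - mon m1 = msum M3.
    rewrite E1 E2 {1}/msum (perm_big _ pe) /= -/(msum _) msum_cat.
    by rewrite addrC addKr.
  apply: Lplus_X_msum => // u uM3.
  have [[su pu _] [_ du]] : lam u /\ dom u m2.
    by apply: h2; rewrite (perm_mem pe) mem_cat uM3 orbT.
  by split=> // a; rewrite du d2.
apply/supp_set_subset => //.
rewrite (supp_setE d1 (conj E1 h1)) (supp_setE d2 (conj E2 h2)) => l [tl lM]; split=> //.
have ll := tropical_lam tl; have [T cT tT] := lam_chart ll.
have [L [sL EL pL _]] := Lplus_X_expansion hA cT le.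
have l1 : lamlist (ones M1) by apply: lamlist_ones => u /h1[].
have l2 : lamlist (ones M2) by apply: lamlist_ones => u /h2[].
have [L1 [sL1 EL1 cL1]] := lam_coef hA cT l1.
have [L2 [sL2 EL2 cL2]] := lam_coef hA cT l2.
have := @lsum_inj _ _ _ hA T L2 (L1 ++ L) cT sL2 (lsup_cat sL1 sL).
rewrite lsum_cat EL1 EL2 EL !lsum_ones -E1 -E2 addrC subrK => /(_ erefl (wvec l)).
rewrite lco_cat cL1 // cL2 // !lco_ones => E.
have := pL (wvec l); move: lM; rewrite -!has_pred1 !has_count; move: E; clear.
by move: (lco L _) (count_mem _ _) (count_mem _ _); lia.
Qed.

End Supports.

Theorem theorem3p14 (R : realType) (n : nat) (hn : (1 <= n)%N)
    (K : fieldType) (A : {set 'I_n.+3} -> K) (hA : Atilde_functions A) :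
  set_bij (Pstar A) (@St n R) (supp_set A)
  /\ (forall f1 f2 : K, Pstar A f1 -> Pstar A f2 ->
        Lle (Xspace A) f1 f2 <-> (supp_set A f1 `<=` supp_set A f2)%classic).
Proof.
have faceE (c : {ffun {set 'I_n.+3} -> int}) (cR : {set 'I_n.+3} -> R) :
    (forall e, diagonal e -> cR e = (c e)%:~R) ->
    (fun l => tropical l /\ forall e, diagonal e -> l e <= c e)
    = (fun l => tropical l /\ face cR finset.set0 (realify R l)).
  move=> cE; apply/seteqP; split=> l [tl h]; split=> //.
    split=> [|e|e]; [exact: realify_tropical|by rewrite finset.in_set0|].
    by rewrite /compatible finset.in_set => /and3P[de _ _]; rewrite ffunE cE // ler_int h.
  have [_ _ h'] := h => e de; have := h' e; rewrite ffunE cE // ler_int; apply.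
  rewrite /compatible finset.in_set de finset.in_set0 /=; apply/forall_inP => f.
  by rewrite finset.in_set0.
split; last first.
  move=> f1 f2 /(PstarP hA)[m1 [s1 p1 d1 ->]] /(PstarP hA)[m2 [s2 p2 d2 ->]].
  rewrite (Lle_dom hA s1 p1 d1 s2 p2 d2).
  exact: iff_sym (supp_set_subset hA s1 p1 d1 s2 p2 d2).
split.
- move=> f /(PstarP hA)[m [sm pm dm ->]]; have [c [dc Ec]] := wvec_onto sm dm.
  rewrite -Ec in pm *; exists (fun e => (c e)%:~R); split.
  + exact: (pos_stasheff dc pm).
  + by move=> e _; exists (c e).
  + by rewrite supp_set_wvec // (faceE _ (fun e => (c e)%:~R)).
- move=> f1 f2; rewrite !in_setE => /(PstarP hA)[m1 [s1 p1 d1 ->]] /(PstarP hA)[m2 [s2 p2 d2 ->]] E.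
  have d12 : dom m1 m2 by apply/(supp_set_subset hA) => //; rewrite E.
  have d21 : dom m2 m1 by apply/(supp_set_subset hA) => //; rewrite E.
  congr (mon A _); apply: cut_inj => // a b; apply/eqP; rewrite eq_le.
  by rewrite d12.1 d21.1.
- move=> S [cR [st reg ->]].
  have val e : exists z : int, diagonal e -> cR e = z%:~R.
    have [de|_] := boolP (diagonal e); last by exists 0.
    by have [z Ez] := reg e de; exists z.
  have [c0 hc0] := choice val.
  pose c : {ffun {set 'I_n.+3} -> int} := [ffun e => if diagonal e then c0 e else 0].
  have dc : ondiag c by move=> e /negbTE de; rewrite ffunE de.
  have cE e : diagonal e -> cR e = (c e)%:~R by move=> de; rewrite ffunE de hc0.
  have pc := stasheff_wvec_pos hA st dc cE.
  exists (mon A (wvec c)).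
    by apply/(PstarP hA); exists (wvec c); split=> //; [exact: onseg_wvec|exact: deg0_wvec].
  by rewrite supp_set_wvec // (faceE _ _ cE).
Qed.
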